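(* Let $p>1$, and let $F:\mathbb{R}\to[0,\infty)$ and $f_0:\mathbb{R}\times\mathbb{R}\to[0,\infty)$ satisfy (A-1), (A-2) and (A-3) (stated in the context). Let $T>0$ be given and let $f$ be a $C^1$ solution on $[0,T]\times\mathbb{R}^2$ of the Vlasov–Poisson system $$\partial_t f+v\,\partial_x f-E\,\partial_v f=0,\qquad \rho(t,x)=\int_{\mathbb{R}}\bigl(F(v)-f(t,x,v)\bigr)\,dv,$$ $$E(t,x)=\frac12\left(\int_{-\infty}^x\rho(t,y)\,dy-\int_x^\infty\rho(t,y)\,dy\right),\qquad f(0,x,v)=f_0(x,v).$$ If there is a constant $C$ such that $|\|(F-f)(t)\||\le C$ for all $t\in[0,T]$, then for some $\delta>0$ the solution $f$ may be extended to a $C^1$ solution of this system on $[0,T+\delta]\times\mathbb{R}^2$ for which $|\|(F-f)(t)\||$ is bounded on $[0,T+\delta]$.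
   Context: Notation. $R(x)=\sqrt{1+|x|^2}$ and $R^{-p}(x)=(R(x))^{-p}$. For $h:\mathbb{R}^2\to\mathbb{R}$ (a function of $(x,v)$), $\|h\|_\infty=\sup_{z\in\mathbb{R}^2}|h(z)|$. For $\sigma:\mathbb{R}\to\mathbb{R}$ (a function of $x$), $\|\sigma\|_p=\sup_{x\in\mathbb{R}}|\sigma(x)|R^p(x)$ (a weighted sup norm, not an $L^p$ norm). For a function of $(x,v)$, $\|\partial_x h\|_p=\sup_{x,v}|\partial_x h(x,v)|R^p(x)$. Put $$|\|h\||=\|h\|_\infty+\|\partial_v h\|_\infty+\|\partial_x h\|_p+\left\|\int h\,dv\right\|_p .$$ $F-f$ denotes $F(v)-f(t,x,v)$, $(F-f)(t)$ is the function $(x,v)\mapsto F(v)-f(t,x,v)$, and $(F-f_0)(x,v)=F(v)-f_0(x,v)$. Assumptions. (A-1) $f_0\in C^1(\mathbb{R}^2)$ is nonnegative with compact $v$-support (there is a bounded set of $v$ outside of which $f_0(x,v)=0$ for all $x$), and there is a constant $C$ such that for all $x,v\in\mathbb{R}$, $|(F-f_0)(x,v)|+|\partial_v(F-f_0)(x,v)|\le C R^{-p}(x)$. (A-2) $F\in C^3(\mathbb{R})$ is nonnegative and there is $W\in(0,\infty)$ such that $F(v)=0$ for $|v|>W$. (A-3) $|\|F-f_0\||$ is finite. *)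

(* Defs.v *)
From HB Require Import structures.
From mathcomp Require Export all_boot all_order all_algebra.
From mathcomp Require Export all_classical all_reals all_analysis.

Set Implicit Arguments.
Unset Strict Implicit.
Unset Printing Implicit Defensive.

Export Order.TTheory GRing.Theory Num.Theory.
Export numFieldNormedType.Exports.

Local Open Scope classical_set_scope.
Local Open Scope ring_scope.

Section Regularity.
Context {R : realType}.

Definition is_Ck (k : nat) (F : R -> R) : Prop :=
  (forall i : nat, (i < k)%N -> forall v : R, derivable (derive1n i F) v 1) /\
  continuous (derive1n k F).

Definition partial_x (h : R -> R -> R) (x v : R) : R := derive1 (h ^~ v) x.

Definition partial_v (h : R -> R -> R) (x v : R) : R := derive1 (h x) v.

Definition is_C1_plane (h : R -> R -> R) : Prop :=
  [/\ forall x v : R, derivable (h ^~ v) x 1,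
      forall x v : R, derivable (h x) v 1,
      continuous (fun z : R * R => h z.1 z.2),
      continuous (fun z : R * R => partial_x h z.1 z.2) &
      continuous (fun z : R * R => partial_v h z.1 z.2)].

(* The time derivative on [0, T] is taken along times of [0, T] only, hence it
   is one-sided at both endpoints. *)
Definition time_quotient (f : R -> R -> R -> R) (t x v : R) (s : R) : R :=
  (f s x v - f t x v) / (s - t).

Definition partial_t (T : R) (f : R -> R -> R -> R) (t x v : R) : R :=
  lim (time_quotient f t x v s @[s --> within `[0, T] t^']).

Definition slab (T : R) : set (R * R * R) := [set z | z.1.1 \in `[0, T]].

Definition is_C1_slab (T : R) (f : R -> R -> R -> R) : Prop :=
  [/\ forall t x v : R, t \in `[0, T] ->
        [/\ cvg (time_quotient f t x v s @[s --> within `[0, T] t^']),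
            derivable (f t ^~ v) x 1 &
            derivable (f t x) v 1],
      {within slab T, continuous (fun z => f z.1.1 z.1.2 z.2)},
      {within slab T, continuous (fun z => partial_t T f z.1.1 z.1.2 z.2)},
      {within slab T, continuous (fun z => partial_x (f z.1.1) z.1.2 z.2)} &
      {within slab T, continuous (fun z => partial_v (f z.1.1) z.1.2 z.2)}].

End Regularity.

Section Norms.
Context {R : realType}.
Local Notation mu := (@lebesgue_measure R).

Definition weight (x : R) : R := Num.sqrt (1 + `|x| ^+ 2).

(* All norms take values in the extended reals, so that finiteness is an
   explicit hypothesis. *)
Definition sup_norm (h : R -> R -> R) : \bar R :=
  ereal_sup (range (fun z : R * R => `|h z.1 z.2|%:E)).

Definition wnorm (p : R) (sigma : R -> R) : \bar R :=
  ereal_sup (range (fun x : R => (`|sigma x| * weight x `^ p)%:E)).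

Definition wnorm2 (p : R) (h : R -> R -> R) : \bar R :=
  ereal_sup (range (fun z : R * R => (`|h z.1 z.2| * weight z.1 `^ p)%:E)).

Definition triple_norm (p : R) (h : R -> R -> R) : \bar R :=
  (sup_norm h + sup_norm (partial_v h) + wnorm2 p (partial_x h)
   + wnorm p (fun x => \int[mu]_v h x v)%R)%E.

Definition bg_diff (F : R -> R) (g : R -> R -> R) (x v : R) : R := F v - g x v.

End Norms.

Section VlasovPoisson.
Context {R : realType}.
Local Notation mu := (@lebesgue_measure R).

Definition charge_density (F : R -> R) (f : R -> R -> R -> R) (t x : R) : R :=
  \int[mu]_v bg_diff F (f t) x v.

Definition electric_field (F : R -> R) (f : R -> R -> R -> R) (t x : R) : R :=
  2^-1 * (\int[mu]_(y in `]-oo, x]) charge_density F f t y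
          - \int[mu]_(y in `[x, +oo[) charge_density F f t y).

(* [Rintegral] is total, so the convergence of the integrals defining the
   density and the field has to be part of the notion of solution. *)
Definition VP_solution (F : R -> R) (f0 : R -> R -> R) (T : R)
    (f : R -> R -> R -> R) : Prop :=
  [/\ is_C1_slab T f,
      forall t x : R, t \in `[0, T] ->
        mu.-integrable setT (EFin \o bg_diff F (f t) x),
      forall t : R, t \in `[0, T] ->
        mu.-integrable setT (EFin \o charge_density F f t),
      forall t x v : R, t \in `[0, T] ->
        partial_t T f t x v + v * partial_x (f t) x v
        - electric_field F f t x * partial_v (f t) x v = 0 &
      forall x v : R, f 0 x v = f0 x v].

Definition assumption_A1 (p : R) (F : R -> R) (f0 : R -> R -> R) : Prop :=
  [/\ is_C1_plane f0,
      forall x v : R, 0 <= f0 x v,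
      exists M : R, forall x v : R, M < `|v| -> f0 x v = 0 &
      exists C : R, forall x v : R,
        `|bg_diff F f0 x v| + `|partial_v (bg_diff F f0) x v|
          <= C * weight x `^ (- p)].

Definition assumption_A2 (F : R -> R) : Prop :=
  [/\ is_Ck 3 F,
      forall v : R, 0 <= F v &
      exists2 W : R, 0 < W & forall v : R, W < `|v| -> F v = 0].

Definition assumption_A3 (p : R) (F : R -> R) (f0 : R -> R -> R) : Prop :=
  (triple_norm p (bg_diff F f0) < +oo)%E.

End VlasovPoisson.

(* Main.v *)
Require Import Defs.
From mathcomp Require Import all_boot all_order all_algebra.
From mathcomp Require Import all_classical all_reals all_analysis.
From mathcomp Require Import measurable_realfun ring lra.

(** Move the time origin to T and put h = f(T). The solution beyond T is governed by
its electric field E(t,x), whose slope in x is the charge density rho, the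
integral of F - f over v. A field E determines characteristics X' = V,
V' = -E(t,X), and f(t,x,v) = h(foot at time 0 of the characteristic through
(t,x,v)) solves the transport equation; f determines rho, and rho a new field.
The solution is a fixed point of this map on a short time interval ]-r, r[.

The obstacle is decay. The difference of two fields does not decay like R^-p,
so the map is not seen to be a contraction by estimating rho in the weighted
norm. Conservation of charge avoids this: integrating the equation over v gives
d_t rho = d_x j, where j is the integral of v f, so that the charge of an
interval changes only by the flux j through its two endpoints [mass_derive].
The fields are determined by the charges of intervals [field_of_small], hence
two of them differ by at most a constant times |t| times the sup distance of the
two transported functions, and that is bounded by the sup distance of the two
fields that transport them. The map contracts in the plain sup norm
[next_contraction].

The weighted bounds survive as invariants of the iteration. The x-derivative of
the foot has a velocity component driven by the slope of E only, so it decays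
like R^-p, and d_x f is bounded by D R^-p with D determined by h alone
[transport_x_bound]. Through d_t rho = d_x j, the density then stays below
(A + 1) R^-p for a short time, where A R^-p bounds the density of h. All
requirements on a field are inequalities between finitely many of its values
[admissible], so they pass to the pointwise limit of the iterates, and no
function space is needed.

Differentiability of f follows from one expansion of the characteristics with a
quadratic remainder, valid jointly in (t,x,v) [characteristic_expansion]; it
contains the transport equation.

The construction needs h to vanish for large |v|. This comes from a maximum
principle for f - e t on a cone that shrinks in time at least as fast as the
characteristics move [support_propagates], the field of f being bounded on
[0, T]. Finally the two solutions are glued at T, where both one-sided time
derivatives have the value prescribed by the equation [glue_partial_t]. *)

Import Order.TTheory GRing.Theory Num.Theory numFieldNormedType.Exports.

Set Implicit Arguments.
Unset Strict Implicit.
Unset Printing Implicit Defensive.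

Local Open Scope classical_set_scope.
Local Open Scope ring_scope.

(** * Calculus on the line *)

Section Calculus.
Context {R : realType}.
Local Notation mu := (@lebesgue_measure R).
Implicit Types (f g : R -> R) (a b s t x y : R).

Lemma is_derive_continuous g x l : is_derive x 1 g l -> {for x, continuous g}.
Proof. by move=> [+ _] => /derivable1_diffP/differentiable_continuous. Qed.

Lemma is_derive_of_cvg g x l :
  (g y - g x) / (y - x) @[y --> x^'] --> l -> is_derive x 1 g l.
Proof.
move=> H.
have H2 : h^-1 *: (g (h *: 1 + x) - g x) @[h --> 0^'] --> l.
  apply/cvgrPdist_lt => e e0; move/cvgrPdist_lt : H => /(_ _ e0).
  rewrite !near_withinE => -[d /= d0 Hd].
  exists d => //= h /=; rewrite sub0r normrN => hd h0.
  have := Hd (h + x); rewrite /ball_ /= opprD addrCA subrr addr0 normrN => /(_ hd).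
  rewrite -subr_eq0 addrK => /(_ h0).
  by rewrite -[h *: 1]/(h * 1) mulr1 -[h^-1 *: _]/(h^-1 * _) mulrC.
by split; [apply/cvg_ex; exists l|exact: cvg_lim].
Qed.

Lemma cvg_of_is_derive g x l :
  is_derive x 1 g l -> (g y - g x) / (y - x) @[y --> x^'] --> l.
Proof.
move=> [dg <-]; have := cvg_toP dg; rewrite -/(derive g x 1) => /(_ _ erefl) H.
apply/cvgrPdist_lt => e e0; move/cvgrPdist_lt : H => /(_ _ e0).
rewrite !near_withinE => -[d /= d0 Hd].
exists d => //= y /=; rewrite distrC => hd yx.
have := Hd (y - x); rewrite /ball_ /= sub0r normrN => /(_ hd).
rewrite subr_eq0 => /(_ yx).
by rewrite -[(_ - _) *: 1]/(_ * 1) mulr1 subrK -[_^-1 *: _]/(_^-1 * _) mulrC.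
Qed.

(** The only way in which derivatives are produced from estimates below: every
expansion comes with a quadratic remainder. *)
Lemma is_derive_of_quadratic_remainder g x l (C d : R) : 0 < d ->
  (forall y, `|y - x| < d -> `|g y - g x - l * (y - x)| <= C * (y - x) ^+ 2) ->
  is_derive x 1 g l.
Proof.
move=> d0 H; apply: is_derive_of_cvg; apply/cvgrPdist_le => e e0.
have C1 : 0 < `|C| + 1 by rewrite ltr_wpDl.
rewrite !near_withinE.
exists (Num.min d (e / (`|C| + 1))) => /=.
  by rewrite lt_min d0 divr_gt0.
move=> y /=; rewrite lt_min distrC => /andP[yd ye] yx.
have yx0 : y - x != 0 by rewrite subr_eq0.
have -> : l - (g y - g x) / (y - x) = - ((g y - g x - l * (y - x)) / (y - x)).
  by field.
rewrite normrN normrM normfV ler_pdivrMr ?normr_gt0//.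
apply: le_trans (H _ yd) _; rewrite -real_normK ?num_real// expr2 mulrA.
rewrite ler_pM2r ?normr_gt0//.
move: ye; rewrite ltr_pdivlMr// => /ltW; apply: le_trans.
rewrite mulrC ler_wpM2l//; apply: le_trans (ler_norm _) _.
by rewrite lerDl.
Qed.

(** The two distance bounds place c between a and b without deciding how a and b
are ordered; times before and after the initial time are treated alike. *)
Lemma mvt_itv (i : interval R) g (dg : R -> R) a b :
  a \in i -> b \in i -> (forall s, s \in i -> is_derive s 1 g (dg s)) ->
  exists c, [/\ c \in i, `|c - a| <= `|b - a|, `|c - b| <= `|b - a| &
    g b - g a = dg c * (b - a)].
Proof.
wlog ab : a b / a <= b => [H|] ai bi dgi.
  have [ab|/ltW ba] := leP a b; first exact: H.
  have [c [ci ca cb E]] := H _ _ ba bi ai dgi.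
  exists c; split=> //; rewrite ?(distrC b a)//.
  by rewrite -opprB E -mulrN opprB.
have sub s : s \in `[a, b] -> s \in i.
  rewrite in_itv/= => sab; exact: (@interval_is_interval _ i _ _ ai bi).
have [] := @MVT_segment _ g dg a b ab.
- by move=> x /subset_itv_oo_cc xab; exact/dgi/sub.
- apply: derivable_within_continuous => x xab.
  by have [] := dgi x (sub _ xab).
- move=> c cab E; exists c; split=> //; first exact: sub.
  + by move: cab; rewrite in_itv/= => /andP[? ?]; rewrite !ger0_norm; lra.
  + move: cab; rewrite in_itv/= => /andP[? ?]; rewrite ler0_norm ?ger0_norm; lra.
Qed.

Lemma mvt_le (i : interval R) g (dg : R -> R) a b (M : R) :
  a \in i -> b \in i -> (forall s, s \in i -> is_derive s 1 g (dg s)) ->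
  (forall s, s \in i -> `|dg s| <= M) -> `|g b - g a| <= M * `|b - a|.
Proof.
move=> ai bi H HM; have [c [ci _ _ ->]] := mvt_itv ai bi H.
by rewrite normrM ler_wpM2r// HM.
Qed.

Lemma integrable_itv g a b : continuous g -> mu.-integrable `[a, b] (EFin \o g).
Proof.
move=> cg; apply: continuous_compact_integrable; first exact: segment_compact.
exact: continuous_subspaceT.
Qed.

Lemma primitive_exists g (r : R) : continuous g ->
  exists P : R -> R, forall s, s \in `[-r, r] -> is_derive s 1 P (g s).
Proof.
(* Starting one unit before -r makes the derivative two-sided at the endpoint -r. *)
move=> cg; exists (fun s => \int[mu]_(t in `[- r - 1, s]) g t) => s.
rewrite in_itv/= => /andP[rs sr].
have [||||H1 H2] := @continuous_FTC1_closed R g (-r-1) s (s + 1).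
- by rewrite ltrDl.
- exact: integrable_itv.
- by lra.
- exact: cg.
- by split; [exact: H1|rewrite -derive1E; exact: H2].
Qed.

Lemma Rintegral_itv_cst (a b c : R) : a <= b ->
  \int[mu]_(_ in `[a, b]) c = c * (b - a).
Proof.
move=> ab; rewrite Rintegral_cst//= lebesgue_measure_itv/= lte_fin.
have [->|ab'] := eqVneq a b; first by rewrite ltxx subrr.
by rewrite lt_neqAle ab' ab.
Qed.

Lemma Rintegral_norm_le g a b (M : R) : a <= b -> continuous g ->
  (forall s, s \in `[a, b] -> `|g s| <= M) ->
  `|\int[mu]_(s in `[a, b]) g s| <= M * (b - a).
Proof.
move=> ab cg gM; apply: le_trans (le_normr_Rintegral _ _) _ => //.
  exact: integrable_itv.
rewrite -(Rintegral_itv_cst M ab); apply: le_Rintegral => //.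
- apply: (@integrable_itv (fun x => `|g x|)).
  by move=> x; apply: cvg_norm; exact: cg.
- apply: (@integrable_itv (cst M)); exact: cst_continuous.
Qed.

End Calculus.

Lemma geometric_small (R : realType) (c e : R) : 0 < e ->
  exists n : nat, forall m, (n <= m)%N -> c / 2 ^+ m < e.
Proof.
move=> e0; exists (Num.bound (c / e)) => m nm.
rewrite ltr_pdivrMr ?exprn_gt0// mulrC -ltr_pdivrMr//; exact: upper_nthrootP.
Qed.

(** Replaces completeness of function spaces, both for Picard iterates and for
the iterated fields. *)
Lemma geometric_limit (R : realType) (X : Type) (u : nat -> X -> R) (c : R) :
  0 <= c -> (forall n z, `|u n.+1 z - u n z| <= c / 2 ^+ n) ->
  exists U : X -> R, forall n z, `|U z - u n z| <= 2 * c / 2 ^+ n.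
Proof.
move=> c0 H.
have tele z n k : `|u (k + n)%N z - u n z| <= 2 * c / 2 ^+ n - 2 * c / 2 ^+ (k + n).
  elim: k => [|k IH]; first by rewrite add0n !subrr normr0.
  have -> : u (k.+1 + n)%N z - u n z
    = (u (k + n).+1 z - u (k + n)%N z) + (u (k + n)%N z - u n z).
    by rewrite addSn; ring.
  apply: le_trans (ler_normD _ _) _; apply: le_trans (lerD (H _ _) IH) _.
  have E : 2 * c / 2 ^+ (k.+1 + n) = c / 2 ^+ (k + n).
    by rewrite addSn exprS invfM; field; rewrite expf_neq0.
  by rewrite E; lra.
have p2 n : 0 < (2 : R) ^+ n by rewrite exprn_gt0.
have tele2 z n m : (n <= m)%N -> `|u m z - u n z| <= 2 * c / 2 ^+ n.
  move=> nm; rewrite -(subnK nm); apply: le_trans (tele _ n _) _.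
  by rewrite gerBl divr_ge0// ?mulr_ge0// ltW.
have cau z : cvgn (u ^~ z).
  apply/cauchy_cvgP/cauchy_exP => e e0.
  have [n /(_ _ (leqnn _)) ne] := geometric_small (2 * c) e0.
  exists (u n z); exists n => // m /= nm.
  by rewrite /ball/= distrC; apply: le_lt_trans ne; exact: tele2.
exists (fun z => limn (u ^~ z)) => n z.
have H1 : `|u m z - u n z| @[m --> \oo] --> `|limn (u ^~ z) - u n z|.
  by apply: cvg_norm; apply: cvgB; [exact: cau|exact: cvg_cst].
rewrite -(cvg_lim _ H1)//; apply: limr_le; first by apply/cvg_ex; eexists; exact: H1.
by exists n => // m /= nm; exact: tele2.
Qed.

(** * Second order equations on a short time interval *)

Section Ode.
Context {R : realType}.
Implicit Types (u w d e : R -> R) (r s t x v : R).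

Lemma is_derive_near d (d' : R -> R) (l s : R) (i : set R) :
  open i -> i s -> (forall y, i y -> d y = d' y) ->
  is_derive s 1 d' l -> is_derive s 1 d l.
Proof.
move=> oi si H /cvg_of_is_derive H1; apply: is_derive_of_cvg.
apply: cvg_trans H1; apply: near_eq_cvg; apply: cvg_within.
near=> y; rewrite /= !H//; near: y; exact: open_nbhs_nbhs.
Unshelve. all: by end_near. Qed.

(** Extends functions of time constantly beyond an interval, so that all iterates
are defined and continuous for all times. *)
Definition clamp (a b s : R) := Num.max a (Num.min b s).

Lemma clamp_in a b s : a <= b -> clamp a b s \in `[a, b].
Proof. by move=> ab; rewrite in_itv/= le_max lexx/= ge_max ab ge_min lexx. Qed.

Lemma clamp_id a b s : s \in `[a, b] -> clamp a b s = s.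
Proof.
by rewrite in_itv/= /clamp => /andP[as_ sb]; rewrite min_r// max_r.
Qed.

Lemma clamp_lip a b s t : a <= b -> `|clamp a b s - clamp a b t| <= `|s - t|.
Proof.
move=> ab; rewrite /clamp.
wlog st : s t / s <= t => [H|].
  have [/H//|/ltW /H] := leP s t.
  by move=> h; rewrite distrC [leRHS]distrC.
have -> : `|s - t| = t - s by rewrite ler0_norm ?opprB ?subr_le0.
by case: (leP a b) ab => // _ _; case: (leP b s); case: (leP b t);
  rewrite /Order.max; do ?case: ifPn; rewrite -?leNgt => *;
  rewrite ler_norml; apply/andP; split; lra.
Qed.

Lemma lipschitz_continuous (g : R -> R) (L : R) :
  (forall s t, `|g s - g t| <= L * `|s - t|) -> continuous g.
Proof.
move=> H x; apply/cvgrPdist_le => e e0.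
have L1 : 0 < `|L| + 1 by rewrite ltr_wpDl.
exists (e / (`|L| + 1)); first by rewrite /= divr_gt0.
move=> y /=; rewrite ltr_pdivlMr// => /ltW ye.
apply: le_trans (H _ _) _; apply: le_trans ye; rewrite mulrC ler_wpM2l//.
by apply: le_trans (ler_norm _) _; rewrite lerDl.
Qed.

Lemma clamp_continuous a b : a <= b -> continuous (clamp a b).
Proof.
by move=> ab; apply: (@lipschitz_continuous _ 1) => s t; rewrite mul1r clamp_lip.
Qed.

(** A substitute for the lemma of Gronwall on short intervals. If M is the maximum
of |d| + |e| between t and s, the mean value theorem gives
M <= |d t| + |e t| + 2 r ((1 + B) M + K), and r (1 + B) <= 1/4 lets the left
side absorb the term in M. *)
Lemma growth_bound r (B K : R) d e (e' : R -> R) t s :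
  0 <= B -> 0 <= K -> r * (1 + B) <= 1/4 -> t \in `]-r, r[ -> s \in `]-r, r[ ->
  (forall s, s \in `]-r, r[ -> is_derive s 1 d (e s)) ->
  (forall s, s \in `]-r, r[ -> is_derive s 1 e (e' s)) ->
  (forall s, s \in `]-r, r[ -> `|e' s| <= B * `|d s| + K) ->
  `|d s| + `|e s| <= 2 * (`|d t| + `|e t|) + 4 * r * K.
Proof.
move=> B0 K0 rB tI sI dd de e'B.
pose a := Num.min s t; pose b := Num.max s t.
have ab : a <= b by rewrite /a /b ge_min !le_max lexx.
have sab : s \in `[a, b] by rewrite in_itv/= /a /b ge_min le_max lexx.
have tab : t \in `[a, b] by rewrite in_itv/= /a /b ge_min le_max lexx !orbT.
have sub y : y \in `[a, b] -> y \in `]-r, r[.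
  rewrite in_itv/= => /andP[ay yb].
  move: tI sI; rewrite !in_itv/= => /andP[? ?] /andP[? ?].
  rewrite (lt_le_trans _ ay)/=; last by rewrite lt_min; apply/andP.
  by rewrite (le_lt_trans yb)// gt_max; apply/andP.
have cq : {within `[a, b], continuous (fun y => `|d y| + `|e y|)}.
  apply: continuous_in_subspaceT => y; rewrite inE/= => /sub yI.
  apply: cvgD; apply: cvg_norm.
    exact: (is_derive_continuous (dd _ yI)).
  exact: (is_derive_continuous (de _ yI)).
have [c cab cmax] := EVT_max ab cq.
set M := `|d c| + `|e c| in cmax.
have M0 : 0 <= M by rewrite addr_ge0.
have ct : `|c - t| <= 2 * r.
  have /sub := cab; move: tI; rewrite !in_itv/= ler_norml => /andP[? ?] /andP[? ?].
  by apply/andP; split; lra.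
have r0 : 0 < r by move: tI; rewrite in_itv/= => /andP[? ?]; lra.
have Hd : `|d c - d t| <= M * `|c - t|.
  apply: (mvt_le tab cab (fun y yab => dd y (sub y yab))) => y yab.
  by apply: le_trans (cmax _ yab); rewrite lerDr.
have He : `|e c - e t| <= (B * M + K) * `|c - t|.
  apply: (mvt_le tab cab (fun y yab => de y (sub y yab))) => y yab.
  apply: le_trans (e'B _ (sub _ yab)) _; rewrite lerD2r ler_wpM2l//.
  by apply: le_trans (cmax _ yab); rewrite lerDl.
have HM : M <= `|d t| + `|e t| + (M + (B * M + K)) * (2 * r).
  have H1 : (M + (B * M + K)) * `|c - t| <= (M + (B * M + K)) * (2 * r).
    by rewrite ler_wpM2l// !addr_ge0// mulr_ge0.
  have := lerB_dist (d c) (d t); have := lerB_dist (e c) (e t).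
  move: Hd He H1; rewrite mulrDl /M; lra.
have HB : M * (r * (1 + B)) <= M * (1 / 4) by rewrite ler_wpM2l.
apply: le_trans (cmax _ sab) _; rewrite -/M.
have -> : 4 * r * K = 2 * (K * (2 * r)) by ring.
have : (M + (B * M + K)) * (2 * r) = 2 * (M * (r * (1 + B))) + K * (2 * r) by ring.
lra.
Qed.

Lemma uniform_limit_cont (u : nat -> R -> R) (U : R -> R) (c : R) :
  (forall n s, `|U s - u n s| <= c / 2 ^+ n) -> (forall n, continuous (u n)) ->
  continuous U.
Proof.
move=> H cu x; apply/cvgrPdist_lt => e e0.
have [n /(_ _ (leqnn n)) ne] := @geometric_small R c (e / 3) ltac:(lra).
have /cvgrPdist_lt/(_ (e / 3) ltac:(lra)) := cu n x; apply: filterS => y ye.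
have -> : U x - U y = (U x - u n x) + (u n x - u n y) - (U y - u n y) by ring.
apply: le_lt_trans (ler_normB _ _) _.
have := ler_normD (U x - u n x) (u n x - u n y).
have := H n x; have := H n y; lra.
Qed.

Lemma eq_of_geometric (a b c : R) :
  (forall n : nat, `|a - b| <= c / 2 ^+ n) -> a = b.
Proof.
move=> H; apply/eqP; rewrite -subr_eq0 -normr_le0 leNgt; apply/negP => ab.
have [n /(_ _ (leqnn n))] := geometric_small c ab.
by rewrite ltNge H.
Qed.

Definition primitive r (g : R -> R) : R -> R :=
  xget (cst 0) [set P | forall s, s \in `[-r, r] -> is_derive s 1 P (g s)].

Lemma primitiveP r (g : R -> R) : continuous g ->
  forall s, s \in `[-r, r] -> is_derive s 1 (primitive r g) (g s).
Proof.
move=> cg; have [P HP] := primitive_exists r cg.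
by apply: (@xgetPex _ (cst 0)
  [set P | forall s, s \in `[-r, r] -> is_derive s 1 P (g s)]); exists P.
Qed.

Lemma primitive_lip r (g h : R -> R) (c : R) s t : continuous g -> continuous h ->
  (forall s, `|g s - h s| <= c) -> s \in `[-r, r] -> t \in `[-r, r] ->
  `|(primitive r g s - primitive r g t) - (primitive r h s - primitive r h t)|
    <= c * `|s - t|.
Proof.
move=> cg ch gh sr tr.
have -> : (primitive r g s - primitive r g t) - (primitive r h s - primitive r h t)
  = (primitive r g - primitive r h) s - (primitive r g - primitive r h) t.
  by rewrite !fctE; ring.
apply: (mvt_le (dg := fun y => g y - h y) tr sr) => y yr; last exact: gh.
by apply: is_deriveB; exact: primitiveP.
Qed.

(** The equation u'' = G(s, u) as a first order system for (u, u'), with data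
(x, v) at time t. *)
Definition solves r (G : R -> R -> R) t x v (uw : (R -> R) * (R -> R)) :=
  [/\ continuous uw.1, continuous uw.2, uw.1 t = x, uw.2 t = v &
    forall s, s \in `]-r, r[ ->
      is_derive s 1 uw.1 (uw.2 s) /\ is_derive s 1 uw.2 (G s (uw.1 s))].

Definition flow r (G : R -> R -> R) t x v : (R -> R) * (R -> R) :=
  xget (cst 0, cst 0) [set uw | solves r G t x v uw].

(** Picard iteration in the sup norm. Each step integrates over times at distance
at most 2 r from t, so its Lipschitz constant is at most 2 r (1 + B) <= 1/2. *)
Lemma ode_exists r (B K : R) (G : R -> R -> R) x v t :
  0 <= B -> r * (1 + B) <= 1/4 -> t \in `]-r, r[ ->
  (forall u, continuous u -> continuous (fun s => G s (u s))) ->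
  (forall s a b, `|G s a - G s b| <= B * `|a - b|) ->
  (forall s, `|G s x| <= K) ->
  exists uw, solves r G t x v uw.
Proof.
move=> B0 rB tI cG GB GK.
have r0 : 0 < r by move: tI; rewrite in_itv/= => /andP[? ?]; lra.
have rr : - r <= r by lra.
have tI' : t \in `[-r, r] by exact: subset_itv_oo_cc.
have r2 : 2 * r * B <= 1/2 by lra.
have r1 : 2 * r <= 1/2.
  have : 0 <= r * B by rewrite mulr_ge0// ltW.
  by lra.
have r3 a : 0 <= a -> a * (2 * r) <= a.
  by move=> a0; rewrite ler_piMr//; lra.
pose cl := clamp (-r) r.
have clI s : cl s \in `[-r, r] by exact: clamp_in.
have clt s : `|cl s - t| <= 2 * r.
  by have := clI s; move: tI'; rewrite !in_itv/= ler_norml => /andP[? ?] /andP[? ?];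
    apply/andP; split; lra.
pose P g s := primitive r g (cl s) - primitive r g t.
have cP g : continuous g -> continuous (P g).
  move=> cg s; apply: cvgB; last exact: cvg_cst.
  apply: (@continuous_comp _ _ _ cl (primitive r g)).
    exact: clamp_continuous.
  exact: (is_derive_continuous (primitiveP cg (clI s))).
have lipP g h c s : continuous g -> continuous h ->
    (forall s, `|g s - h s| <= c) -> `|P g s - P h s| <= c * (2 * r).
  move=> cg ch gh; apply: le_trans (primitive_lip cg ch gh (clI s) tI') _.
  by rewrite ler_wpM2l//; apply: le_trans (gh 0).
have P0 g c s : continuous g -> (forall s, `|g s| <= c) -> `|P g s| <= c * (2 * r).
  move=> cg gc; apply: (@le_trans _ _ (c * `|cl s - t|)).
    by apply: (mvt_le tI' (clI s) (primitiveP cg)) => y _.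
  by rewrite ler_wpM2l//; apply: le_trans (gc 0).
pose step (z : (R -> R) * (R -> R)) : (R -> R) * (R -> R) :=
  (fun s => x + P z.2 s, fun s => v + P (fun s => G s (z.1 s)) s).
(* z n is the n-th Picard iterate of the pair (u, u'). *)
pose z n := iter n step (cst x, cst v).
have cz n : continuous (z n).1 /\ continuous (z n).2.
  elim: n => [|n [c1 c2]] /=; first by split; exact: cst_continuous.
  by split=> s; apply: cvgD; [exact: cvg_cst|exact: cP|exact: cvg_cst|
    apply: cP; exact: cG].
pose c := `|v| + K.
have K0 : 0 <= K by exact: le_trans (GK 0).
have c0 : 0 <= c by rewrite addr_ge0.
have Hz n : (forall s, `|(z n.+1).1 s - (z n).1 s| <= c / 2 ^+ n) /\
            (forall s, `|(z n.+1).2 s - (z n).2 s| <= c / 2 ^+ n).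
  elim: n => [|n [H1 H2]].
    rewrite expr0 divr1; split=> s /=; rewrite addrAC subrr add0r.
      apply: (le_trans (@P0 (cst v) `|v| s (@cst_continuous _ _ _) (fun=> lexx _))).
      by apply: (le_trans (r3 _ _)) => //; rewrite /c lerDl.
    apply: (le_trans (P0 _ _ s (cG _ (@cst_continuous _ _ _)) GK)).
    by apply: (le_trans (r3 _ _)) => //; rewrite /c lerDr.
  have E : c / 2 ^+ n.+1 = c / 2 ^+ n * (1/2).
    by rewrite exprS invfM; field; rewrite expf_neq0.
  have cn : 0 <= c / 2 ^+ n by rewrite divr_ge0// exprn_ge0.
  split=> s.
    rewrite [(z n.+2).1 s]/= [(z n.+1).1 s]/= opprD addrACA subrr add0r.
    apply: le_trans (lipP _ _ _ s (cz n.+1).2 (cz n).2 H2) _.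
    by rewrite E ler_wpM2l.
  rewrite [(z n.+2).2 s]/= [(z n.+1).2 s]/= opprD addrACA subrr add0r.
  apply: (le_trans (lipP _ _ (B * (c / 2 ^+ n)) s (cG _ (cz n.+1).1) (cG _ (cz n).1) _)).
    by move=> y; apply: le_trans (GB _ _ _) _; rewrite ler_wpM2l.
  by rewrite E mulrC mulrA mulrC ler_wpM2l.
have [u Hu] := @geometric_limit R R (fun n s => (z n).1 s) c c0 (fun n => (Hz n).1).
have [w Hw] := @geometric_limit R R (fun n s => (z n).2 s) c c0 (fun n => (Hz n).2).
have cu : continuous u.
  by apply: (@uniform_limit_cont (fun n => (z n).1) u (2 * c)) => n;
    [move=> s; exact: Hu|exact: (cz n).1].
have cw : continuous w.
  by apply: (@uniform_limit_cont (fun n => (z n).2) w (2 * c)) => n;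
    [move=> s; exact: Hw|exact: (cz n).2].
have Eu s : u s = x + P w s.
  apply: (@eq_of_geometric _ _ (2 * c + 2 * c)) => n.
  have -> : u s - (x + P w s) = (u s - (z n.+1).1 s) + (P (z n).2 s - P w s).
    by rewrite [(z n.+1).1 s]/=; ring.
  apply: le_trans (ler_normD _ _) _; rewrite mulrDl lerD//.
    apply: le_trans (Hu _ _) _.
    rewrite ler_wpM2l ?mulr_ge0// lef_pV2 ?posrE ?exprn_gt0//.
    by rewrite exprS ler_peMl ?exprn_ge0// ler1n.
  have := lipP (z n).2 w (2 * c / 2 ^+ n) s (cz n).2 cw.
  move=> /(_ (fun y => eq_ind_r (fun a => a <= _) (Hw n y) (distrC _ _))).
  move=> /le_trans; apply; by rewrite r3// divr_ge0 ?mulr_ge0 ?exprn_ge0.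
have Ew s : w s = v + P (fun s => G s (u s)) s.
  apply: (@eq_of_geometric _ _ (2 * c + 2 * c)) => n.
  have -> : w s - (v + P (fun s => G s (u s)) s) =
    (w s - (z n.+1).2 s) + (P (fun s => G s ((z n).1 s)) s - P (fun s => G s (u s)) s).
    by rewrite [(z n.+1).2 s]/=; ring.
  apply: le_trans (ler_normD _ _) _; rewrite mulrDl lerD//.
    apply: le_trans (Hw _ _) _.
    rewrite ler_wpM2l ?mulr_ge0// lef_pV2 ?posrE ?exprn_gt0//.
    by rewrite exprS ler_peMl ?exprn_ge0// ler1n.
  have cn : 0 <= 2 * c / 2 ^+ n by rewrite divr_ge0 ?mulr_ge0 ?exprn_ge0.
  have := lipP _ _ (B * (2 * c / 2 ^+ n)) s (cG _ (cz n).1) (cG _ cu).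
  move=> H; apply: le_trans (H _) _.
    move=> y; apply: le_trans (GB _ _ _) _; rewrite ler_wpM2l// distrC.
    exact: Hu.
  by rewrite mulrC mulrA ler_piMl//; lra.
have Pt g : P g t = 0 by rewrite /P /cl clamp_id// subrr.
exists (u, w); split=> //=; first by rewrite Eu Pt addr0.
  by rewrite Ew Pt addr0.
have dP g a s : continuous g -> s \in `]-r, r[ ->
    is_derive s 1 (fun s => a + P g s) (g s).
  move=> cg sI; have sI' := subset_itv_oo_cc sI.
  apply: (@is_derive_near _
    (cst (a - primitive r g t) + primitive r g) _ _ `]-r, r[%classic) => //.
    move=> y /= yI; rewrite /P /cl clamp_id; last exact: subset_itv_oo_cc.
    by rewrite !fctE; ring.
  have := @is_deriveD _ _ _ _ _ s 1 _ _ (is_derive_cst (a - primitive r g t) s 1)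
    (primitiveP cg sI').
  by rewrite add0r.
move=> s sI; split.
  rewrite (_ : u = (fun s => x + P w s)); last by apply/funext => y; rewrite Eu.
  exact: dP.
rewrite (_ : w = (fun s => v + P (fun s => G s (u s)) s)); last first.
  by apply/funext => y; rewrite Ew.
by apply: (dP (fun s => G s (u s)) v s) => //; exact: cG.
Qed.

Lemma flowP r (B K : R) (G : R -> R -> R) x v t :
  0 <= B -> r * (1 + B) <= 1/4 -> t \in `]-r, r[ ->
  (forall u, continuous u -> continuous (fun s => G s (u s))) ->
  (forall s a b, `|G s a - G s b| <= B * `|a - b|) ->
  (forall s, `|G s x| <= K) ->
  solves r G t x v (flow r G t x v).
Proof.
move=> ? ? ? ? ? ?; apply: (@xgetPex _ (cst 0, cst 0) [set uw | solves r G t x v uw]).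
by apply: (@ode_exists r B K).
Qed.

End Ode.

(** * Characteristics of an admissible field *)

Section Characteristics.
Context {R : realType}.
Implicit Types (u w d : R -> R) (r s t x v : R).

(** The weight R^-p. *)
Definition decay (p x : R) : R := weight x `^ (- p).

Lemma weight_ge1 x : 1 <= weight x.
Proof.
rewrite /weight -[leLHS]sqrtr1 ler_wsqrtr// lerDl; exact: sqr_ge0.
Qed.

Lemma decay_gt0 p x : 0 < decay p x.
Proof. by rewrite /decay powR_gt0// (lt_le_trans ltr01 (weight_ge1 x)). Qed.

Lemma decay_le1 p x : 0 <= p -> decay p x <= 1.
Proof.
move=> p0; rewrite /decay powRN invf_le1.
  have -> : 1 = 1 `^ p :> R by rewrite powR1.
  rewrite ge0_ler_powR ?nnegrE ?weight_ge1//.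
  exact: le_trans ler01 (weight_ge1 x).
by rewrite powR_gt0// (lt_le_trans ltr01 (weight_ge1 x)).
Qed.

(** The class of fields preserved by the iteration; e is the x-derivative of E.
Differentiability is encoded by a Taylor inequality, so that every condition
compares finitely many values and passes to pointwise limits. *)
Definition admissible (p K B L : R) (E e : R -> R -> R) :=
  [/\ forall t x, `|E t x| <= K,
      forall t t' x, `|E t x - E t' x| <= L * `|t - t'|,
      forall t x, `|e t x| <= B * decay p x,
      forall t x y, `|E t y - E t x - e t x * (y - x)| <= L * (y - x) ^+ 2 &
      forall t t' x x', `|e t x - e t' x'| <= L * (`|t - t'| + `|x - x'|)].

Lemma lipschitz2_comp_continuous (G : R -> R -> R) (C : R) u :
  (forall s s' a a', `|G s a - G s' a'| <= C * (`|s - s'| + `|a - a'|)) ->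
  continuous u -> continuous (fun s => G s (u s)).
Proof.
move=> H cu s; apply/cvgrPdist_le => eps e0.
have C1 : 0 < 2 * (`|C| + 1) by rewrite mulr_gt0// ltr_wpDl.
have d0 : 0 < eps / (2 * (`|C| + 1)) by rewrite divr_gt0.
have /cvgrPdist_le/(_ _ d0) Hu := cu s.
near=> y.
have H1 : `|s - y| <= eps / (2 * (`|C| + 1)).
  near: y; exists (eps / (2 * (`|C| + 1))) => // y /=; exact: ltW.
have H2 : `|u s - u y| <= eps / (2 * (`|C| + 1)) by near: y.
apply: le_trans (H _ _ _ _) _.
apply: (@le_trans _ _ ((`|C| + 1) * (`|s - y| + `|u s - u y|))).
  by rewrite ler_wpM2r ?addr_ge0//; apply: le_trans (ler_norm _) _; rewrite lerDl.
apply: (@le_trans _ _ ((`|C| + 1) * (eps / (2 * (`|C| + 1)) + eps / (2 * (`|C| + 1))))).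
  by rewrite ler_wpM2l ?addr_ge0// lerD.
by rewrite le_eqVlt; apply/orP; left; apply/eqP; field; lra.
Unshelve. all: by end_near. Qed.

Lemma is_derive_comb (l1 l2 : R) u w s (a b : R) :
  is_derive s 1 u a -> is_derive s 1 w b ->
  is_derive s 1 (fun y => l1 * u y + l2 * w y) (l1 * a + l2 * b).
Proof. by move=> ua wb; exact: (is_deriveD (is_deriveZ l1 ua) (is_deriveZ l2 wb)). Qed.

Section OneField.
Variables (p K B L r : R) (E e : R -> R -> R).
Hypotheses (p0 : 0 <= p) (K0 : 0 <= K) (B0 : 0 <= B) (L0 : 0 <= L).
Hypothesis rB : r * (1 + B) <= 1/4.
Hypothesis adm : admissible p K B L E e.

Lemma field_derive t x : is_derive x 1 (E t) (e t x).
Proof.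
have [_ _ _ H _] := adm.
by apply: (@is_derive_of_quadratic_remainder _ _ _ _ L 1) => // y _; exact: H.
Qed.

Lemma field_slope t x : `|e t x| <= B.
Proof.
have [_ _ H _ _] := adm; apply: le_trans (H _ _) _.
by rewrite ler_piMr// decay_le1.
Qed.

Lemma field_lip t x y : `|E t x - E t y| <= B * `|x - y|.
Proof.
have inf (z : R) : z \in `]-oo, +oo[ by rewrite in_itv.
exact: (mvt_le (inf y) (inf x) (fun s _ => field_derive t s)
  (fun s _ => field_slope t s)).
Qed.

Lemma field_lip2 t t' x y :
  `|E t x - E t' y| <= (L + B) * (`|t - t'| + `|x - y|).
Proof.
have [_ HL _ _ _] := adm.
have -> : E t x - E t' y = (E t x - E t' x) + (E t' x - E t' y) by ring.
apply: le_trans (ler_normD _ _) _.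
have := HL t t' x; have := field_lip t' x y.
have : 0 <= B * `|t - t'| by rewrite mulr_ge0.
have : 0 <= L * `|x - y| by rewrite mulr_ge0.
lra.
Qed.

Definition characteristic t x v := flow r (fun s y => - E s y) t x v.

(** Right side of the equation satisfied by the derivatives of the characteristic
through (t, x, v) with respect to its data. *)
Definition linearized t x v s y := - e s ((characteristic t x v).1 s) * y.

Lemma characteristicP t x v : t \in `]-r, r[ ->
  solves r (fun s y => - E s y) t x v (characteristic t x v).
Proof.
move=> tI; apply: (flowP (B := B) (K := K)) => //.
- move=> u cu; have := lipschitz2_comp_continuous field_lip2 cu.
  by move=> H s; apply: cvgN; exact: H.
- by move=> s a b; rewrite -opprD normrN field_lip.
- by move=> s; rewrite normrN; have [H _ _ _ _] := adm.
Qed.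

Lemma linearizedP t x v t' a b : t \in `]-r, r[ -> t' \in `]-r, r[ ->
  solves r (linearized t x v) t' a b (flow r (linearized t x v) t' a b).
Proof.
move=> tI t'I; apply: (flowP (B := B) (K := B * `|a|)) => //.
- move=> u cu s; apply: cvgM; last exact: cu.
  apply: cvgN; have [cY _ _ _ _] := characteristicP x v tI.
  by have [_ _ _ _ H] := adm; exact: (lipschitz2_comp_continuous H cY).
- move=> s c c'; rewrite /linearized -mulrBr normrM normrN ler_wpM2r//.
  exact: field_slope.
- by move=> s; rewrite /linearized normrM normrN ler_wpM2r// field_slope.
Qed.

Lemma dist_itv t s : t \in `]-r, r[ -> s \in `]-r, r[ ->
  [/\ 0 < r, r <= 1/4 & `|s - t| <= 2 * r].
Proof.
rewrite !in_itv/= => /andP[? ?] /andP[? ?].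
have rp : 0 < r by lra.
have := mulr_ge0 (ltW rp) B0 => H.
move: rB => rB'.
split=> //; first by lra.
by rewrite ler_norml; apply/andP; split; lra.
Qed.

Lemma characteristic_speed t x v s : t \in `]-r, r[ -> s \in `]-r, r[ ->
  `|(characteristic t x v).2 s - v| <= K * `|s - t|.
Proof.
move=> tI sI; have [_ _ _ V0 H] := characteristicP x v tI.
have := @mvt_le _ _ _ _ _ _ K tI sI (fun s sI => (H s sI).2).
rewrite V0; apply=> y _.
by rewrite normrN; have [HK _ _ _ _] := adm.
Qed.

Lemma characteristic_straight t x v s : t \in `]-r, r[ -> s \in `]-r, r[ ->
  `|(characteristic t x v).1 s - x - (s - t) * v| <= K * `|s - t| ^+ 2.
Proof.
move=> tI sI; have [_ _ Y0 V0 H] := characteristicP x v tI.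
have [c [cI ct _]] := mvt_itv tI sI (fun s sI => (H s sI).1).
rewrite Y0 => ->.
rewrite mulrC -mulrBr normrM mulrC expr2 mulrA ler_wpM2r//.
by apply: le_trans (characteristic_speed x v tI cI) _; rewrite ler_wpM2l.
Qed.

Lemma characteristic_near t x v s : t \in `]-r, r[ -> s \in `]-r, r[ ->
  `|(characteristic t x v).1 s - x| <= (`|v| + K) * `|s - t|.
Proof.
move=> tI sI; have := characteristic_straight x v tI sI.
have [_ r4 st] := dist_itv tI sI.
have : K * `|s - t| ^+ 2 <= K * `|s - t|.
  by rewrite ler_wpM2l// expr2 ler_piMr//; lra.
have := lerB_dist ((characteristic t x v).1 s - x) ((s - t) * v).
rewrite normrM; lra.
Qed.

Lemma linearized_bound t x v t' a b s :
  t \in `]-r, r[ -> t' \in `]-r, r[ -> s \in `]-r, r[ ->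
  `|(flow r (linearized t x v) t' a b).1 s| + `|(flow r (linearized t x v) t' a b).2 s|
   <= 2 * (`|a| + `|b|).
Proof.
move=> tI t'I sI; have [_ _ J0 J1 H] := linearizedP x v a b tI t'I.
have := growth_bound B0 (lexx 0) rB t'I sI
  (fun s sI => (H s sI).1) (fun s sI => (H s sI).2).
rewrite J0 J1 mulr0 addr0; apply=> y yI; rewrite addr0 /linearized normrM normrN.
by rewrite ler_wpM2r// field_slope.
Qed.

Definition gap t x v t' x' v' : R := `|t' - t| + `|x' - x| + `|v' - v|.

Lemma gap_ge t x v t' x' v' :
  [/\ 0 <= gap t x v t' x' v', `|t' - t| <= gap t x v t' x' v',
   `|x' - x| <= gap t x v t' x' v' & `|v' - v| <= gap t x v t' x' v'].
Proof.
have := normr_ge0 (t' - t); have := normr_ge0 (x' - x); have := normr_ge0 (v' - v).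
by rewrite /gap; split; lra.
Qed.

Lemma characteristic_stable t x v t' x' v' s :
  t \in `]-r, r[ -> t' \in `]-r, r[ -> s \in `]-r, r[ ->
  gap t x v t' x' v' <= 1 ->
  `|(characteristic t' x' v').1 s - (characteristic t x v).1 s| + `|(characteristic t' x' v').2 s - (characteristic t x v).2 s|
   <= 2 * (2 + `|v| + 2 * K) * gap t x v t' x' v'.
Proof.
move=> tI t'I sI g1.
have [g0 gt gx gv] := gap_ge t x v t' x' v'.
have [_ _ Y0 V0 H] := characteristicP x v tI.
have [_ _ Y0' V0' H'] := characteristicP x' v' t'I.
have := growth_bound B0 (lexx 0) rB tI sI
  (fun s sI => is_deriveB (H' s sI).1 (H s sI).1)
  (fun s sI => is_deriveB (H' s sI).2 (H s sI).2).
rewrite mulr0 addr0 !fctE Y0 V0 => G.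
apply: le_trans (G _) _.
  move=> y yI; rewrite addr0 -opprD normrN; exact: field_lip.
have h1 := characteristic_near x' v' t'I tI; have h2 := characteristic_speed x' v' t'I tI.
have -> : (characteristic t' x' v').1 t - x = ((characteristic t' x' v').1 t - x') + (x' - x) by ring.
have -> : (characteristic t' x' v').2 t - v = ((characteristic t' x' v').2 t - v') + (v' - v) by ring.
rewrite -mulrA ler_wpM2l//.
have h3 := ler_normD ((characteristic t' x' v').1 t - x') (x' - x).
have h4 := ler_normD ((characteristic t' x' v').2 t - v') (v' - v).
have v'1 : `|v'| <= 1 + `|v| by have := lerB_dist v' v; lra.
move: h1 h2; rewrite !(distrC t t').
have : (`|v'| + K) * `|t' - t| <= (1 + `|v| + K) * `|t' - t|.
  by rewrite ler_wpM2r//; lra.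
have : (1 + `|v| + 2 * K) * `|t' - t| <= (1 + `|v| + 2 * K) * gap t x v t' x' v'.
  by rewrite ler_wpM2l// !addr_ge0// mulr_ge0.
have gE : gap t x v t' x' v' = `|t' - t| + `|x' - x| + `|v' - v| by [].
set A := (1 + `|v| + 2 * K) * gap _ _ _ _ _ _.
have -> : (2 + `|v| + 2 * K) * gap t x v t' x' v' = A + gap t x v t' x' v'.
  by rewrite /A; ring.
have := normr_ge0 (t' - t); rewrite gE; lra.
Qed.

(** The derivative of the characteristic through (t, x, v) with respect to x, and
[jacobi_v] that with respect to v. *)
Definition jacobi_x t x v := flow r (linearized t x v) t 1 0.
Definition jacobi_v t x v := flow r (linearized t x v) t 0 1.

(** The characteristic through (t', x', v') passes at time t, up to quadratic
errors, through x + l1 with velocity v + l2. What remains after subtracting the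
linear part solves the linearized equation up to the Taylor remainder of E,
which is quadratic in the distance of the two characteristics, and
[growth_bound] concludes. The form of l1 and l2 is the transport equation: the
t-derivative is -v times the x-derivative plus E times the v-derivative. *)
Lemma characteristic_expansion t x v : t \in `]-r, r[ ->
  exists C : R, forall t' x' v' s, t' \in `]-r, r[ -> s \in `]-r, r[ ->
    gap t x v t' x' v' <= 1 -> forall l1 l2,
    l1 = (x' - x) - v * (t' - t) -> l2 = (v' - v) + E t x * (t' - t) ->
    `|(characteristic t' x' v').1 s - (characteristic t x v).1 s
      - (l1 * (jacobi_x t x v).1 s + l2 * (jacobi_v t x v).1 s)| +
    `|(characteristic t' x' v').2 s - (characteristic t x v).2 s
      - (l1 * (jacobi_x t x v).2 s + l2 * (jacobi_v t x v).2 s)|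
    <= C * gap t x v t' x' v' ^+ 2.
Proof.
move=> tI.
pose C1 := 2 * (2 + `|v| + 2 * K).
pose C2 := L + B * (2 + `|v| + K).
pose C3 := 2 * (K + 1 + C2) + 4 * r * (L * C1 ^+ 2).
exists C3 => t' x' v' s t'I sI g1 l1 l2 El1 El2.
have [g0 gt gx gv] := gap_ge t x v t' x' v'.
set g := gap t x v t' x' v' in g0 g1 gt gx gv *.
have [_ _ Y0 V0 H] := characteristicP x v tI.
have [_ _ Y0' V0' H'] := characteristicP x' v' t'I.
have [_ _ a0 b0 HJ1] := linearizedP x v 1 0 tI tI.
have [_ _ c0 d0 HJ2] := linearizedP x v 0 1 tI tI.
rewrite -/(jacobi_x t x v) in a0 b0 HJ1.
rewrite -/(jacobi_v t x v) in c0 d0 HJ2.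
have v'1 : `|v'| <= 1 + `|v| by have := lerB_dist v' v; lra.
have st0 := characteristic_stable tI t'I _ g1.
have [adm1 adm2 adm3 adm4 adm5] := adm.
have := @growth_bound _ r B (L * (C1 * g) ^+ 2) _ _ _ t s B0 _ rB tI sI
  (fun s sI => is_deriveB (is_deriveB (H' s sI).1 (H s sI).1)
    (is_derive_comb l1 l2 (HJ1 s sI).1 (HJ2 s sI).1))
  (fun s sI => is_deriveB (is_deriveB (H' s sI).2 (H s sI).2)
    (is_derive_comb l1 l2 (HJ1 s sI).2 (HJ2 s sI).2)).
rewrite !fctE a0 b0 c0 d0 Y0 V0 => G.
apply: le_trans (G _ _) _.
- by rewrite mulr_ge0// sqr_ge0.
- move=> y yI; rewrite /linearized.
  set Y := (characteristic t x v).1 y; set Y' := (characteristic t' x' v').1 y.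
  set j1 := (jacobi_x t x v).1 y; set j2 := (jacobi_v t x v).1 y.
  have -> : - E y Y' - - E y Y - (l1 * (- e y Y * j1) + l2 * (- e y Y * j2)) =
    - (E y Y' - E y Y - e y Y * (Y' - Y))
    - e y Y * (Y' - Y - (l1 * j1 + l2 * j2)).
    by ring.
  apply: le_trans (ler_normB _ _) _; rewrite normrN [leRHS]addrC lerD//; last first.
    by rewrite normrM ler_wpM2r// field_slope.
  apply: le_trans (adm4 _ _ _) _; rewrite ler_wpM2l//.
  rewrite -real_normK ?num_real// ler_sqr ?nnegrE//.
    have := st0 _ yI; rewrite -/C1 -/g -/Y -/Y'.
    have := normr_ge0 ((characteristic t' x' v').2 y - (characteristic t x v).2 y); lra.
  by rewrite !mulr_ge0// !addr_ge0// mulr_ge0.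
rewrite !mulr1 !mulr0 addr0 add0r.
have E1 : `|(characteristic t' x' v').1 t - x - l1| <= (K + 1) * g ^+ 2.
  have -> : (characteristic t' x' v').1 t - x - l1 =
    ((characteristic t' x' v').1 t - x' - (t - t') * v') + (t - t') * (v' - v).
    by rewrite El1; ring.
  apply: le_trans (ler_normD _ _) _; rewrite [leRHS]mulrDl lerD//.
    apply: le_trans (characteristic_straight x' v' t'I tI) _.
    by rewrite ler_wpM2l// distrC ler_sqr ?nnegrE.
  by rewrite normrM mul1r expr2 distrC ler_pM.
have E2 : `|(characteristic t' x' v').2 t - v - l2| <= C2 * g ^+ 2.
  have [c [cI c1 c2]] := mvt_itv t'I tI (fun s sI => (H' s sI).2).
  rewrite V0' => Ec.
  have -> : (characteristic t' x' v').2 t - v - l2 =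
    (E c ((characteristic t' x' v').1 c) - E t x) * (t' - t).
    have -> : (characteristic t' x' v').2 t = v' + - E c ((characteristic t' x' v').1 c) * (t - t').
      by rewrite -Ec; ring.
    by rewrite El2; ring.
  rewrite normrM expr2 mulrA ler_pM//.
  have -> : E c ((characteristic t' x' v').1 c) - E t x =
     (E c ((characteristic t' x' v').1 c) - E t ((characteristic t' x' v').1 c)) +
     (E t ((characteristic t' x' v').1 c) - E t x) by ring.
  apply: le_trans (ler_normD _ _) _.
  rewrite /C2 [leRHS]mulrDl lerD//.
    apply: le_trans (adm2 _ _ _) _; rewrite ler_wpM2l//.
    by apply: le_trans c2 _; rewrite distrC.
  apply: le_trans (field_lip _ _ _) _; rewrite -mulrA ler_wpM2l//.
  have -> : (characteristic t' x' v').1 c - x = ((characteristic t' x' v').1 c - x') + (x' - x) by ring.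
  apply: le_trans (ler_normD _ _) _.
  have h1 := characteristic_near x' v' t'I cI.
  have h2 : (`|v'| + K) * `|c - t'| <= (1 + `|v| + K) * g.
    rewrite ler_pM ?addr_ge0//; first by lra.
    by apply: le_trans c1 _; rewrite distrC.
  have -> : (2 + `|v| + K) * g = (1 + `|v| + K) * g + g by ring.
  lra.
rewrite /C3 [leRHS]mulrDl lerD//; last first.
  by rewrite le_eqVlt; apply/orP; left; apply/eqP; ring.
rewrite -mulrA ler_wpM2l// [leRHS]mulrDl lerD//.
Qed.

(** Gives continuity of the derivatives of the characteristics in (t, x, v). *)
Lemma linearized_stable t x v a b : t \in `]-r, r[ -> `|a| + `|b| <= 1 ->
  exists C : R, forall t' x' v' s, t' \in `]-r, r[ -> s \in `]-r, r[ ->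
    gap t x v t' x' v' <= 1 ->
    `|(flow r (linearized t' x' v') t' a b).1 s - (flow r (linearized t x v) t a b).1 s| +
    `|(flow r (linearized t' x' v') t' a b).2 s - (flow r (linearized t x v) t a b).2 s|
    <= C * gap t x v t' x' v'.
Proof.
move=> tI ab.
pose C1 := 2 * (2 + `|v| + 2 * K).
exists (2 * (2 + 2 * B) + 4 * r * (L * C1 * 2)) => t' x' v' s t'I sI g1.
have [g0 gt gx gv] := gap_ge t x v t' x' v'.
have st0 := characteristic_stable tI t'I _ g1.
set g := gap t x v t' x' v' in g0 g1 gt gx gv st0 *.
have [_ _ a0 b0 H] := linearizedP x v a b tI tI.
have [_ _ a0' b0' H'] := linearizedP x' v' a b t'I t'I.
have [adm1 adm2 adm3 adm4 adm5] := adm.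
have C10 : 0 <= C1 by rewrite mulr_ge0// !addr_ge0// mulr_ge0.
set J' := flow r (linearized t' x' v') t' a b in a0' b0' H' *.
set J := flow r (linearized t x v) t a b in a0 b0 H *.
have J'2 y : y \in `]-r, r[ -> `|J'.1 y| + `|J'.2 y| <= 2.
  move=> yI; have := linearized_bound x' v' a b t'I t'I yI; rewrite -/J'.
  by move: ab; lra.
have := @growth_bound _ r B (L * C1 * g * 2) _ _ _ t s B0 _ rB tI sI
  (fun s sI => is_deriveB (H' s sI).1 (H s sI).1)
  (fun s sI => is_deriveB (H' s sI).2 (H s sI).2).
rewrite !fctE a0 b0 => G.
apply: le_trans (G _ _) _.
- by rewrite mulr_ge0// mulr_ge0// mulr_ge0.
- move=> y yI; rewrite /linearized.
  set Y := (characteristic t x v).1 y; set Y' := (characteristic t' x' v').1 y.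
  have -> : - e y Y' * J'.1 y - - e y Y * J.1 y =
    - e y Y * (J'.1 y - J.1 y) + (e y Y - e y Y') * J'.1 y by ring.
  apply: le_trans (ler_normD _ _) _; rewrite lerD//.
    by rewrite normrM normrN ler_wpM2r// field_slope.
  rewrite normrM ler_pM//.
    apply: le_trans (adm5 _ _ _ _) _; rewrite subrr normr0 add0r -mulrA ler_wpM2l//.
    have := st0 _ yI; rewrite -/C1 -/Y -/Y' (distrC Y').
    have := normr_ge0 ((characteristic t' x' v').2 y - (characteristic t x v).2 y); lra.
  have := J'2 _ yI; have := normr_ge0 (J'.2 y); lra.
have tt' : `|t - t'| <= g by rewrite distrC.
have E1 : `|J'.1 t - a| <= 2 * g.
  have := @mvt_le _ _ _ _ _ _ 2 t'I tI (fun s sI => (H' s sI).1).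
  rewrite a0' => F; apply: le_trans (F _) _; last by rewrite ler_wpM2l.
  move=> y yI; have := J'2 _ yI; have := normr_ge0 (J'.1 y); lra.
have E2 : `|J'.2 t - b| <= (2 * B) * g.
  have := @mvt_le _ _ _ _ _ _ (2 * B) t'I tI (fun s sI => (H' s sI).2).
  rewrite b0' => F; apply: le_trans (F _) _; last by rewrite ler_wpM2l// mulr_ge0.
  move=> y yI; rewrite /linearized normrM normrN mulrC ler_pM// ?field_slope//.
  have := J'2 _ yI; have := normr_ge0 (J'.2 y); lra.
rewrite [leRHS]mulrDl lerD//; last first.
  by rewrite le_eqVlt; apply/orP; left; apply/eqP; ring.
by rewrite -mulrA ler_wpM2l// [leRHS]mulrDl lerD.
Qed.

(** The velocity component vanishes at time t and is driven by the slope of E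
along the characteristic, so it inherits the decay of that slope. *)
Lemma jacobi_x_speed t x v s (m : R) : t \in `]-r, r[ -> s \in `]-r, r[ ->
  (forall y, y \in `]-r, r[ -> `|e y ((characteristic t x v).1 y)| <= m) ->
  `|(jacobi_x t x v).2 s| <= 4 * r * m.
Proof.
move=> tI sI em; have [_ _ a0 b0 H] := linearizedP x v 1 0 tI tI.
have [r0 _ st] := dist_itv tI sI.
have m0 : 0 <= m by apply: le_trans (em _ tI).
have := @mvt_le _ _ _ _ _ _ (2 * m) tI sI (fun s sI => (H s sI).2).
rewrite b0 subr0 => F; apply: le_trans (F _) _; last first.
  rewrite (_ : 4 * r * m = 2 * m * (2 * r)); last by ring.
  by rewrite ler_wpM2l// mulr_ge0.
move=> y yI; rewrite /linearized normrM normrN mulrC ler_pM// ?em//.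
have := linearized_bound x v 1 0 tI tI yI; rewrite normr1 normr0.
have := normr_ge0 ((flow r (linearized t x v) t 1 0).2 y); lra.
Qed.

End OneField.

(** The factor r is what makes the iteration of fields contract. *)
Lemma characteristic_field_stable (p K B L r : R) (E e E' e' : R -> R -> R) (m : R) t x v s :
  0 <= p -> 0 <= K -> 0 <= B -> 0 <= L -> r * (1 + B) <= 1/4 -> 0 <= m ->
  admissible p K B L E e -> admissible p K B L E' e' ->
  (forall t x, `|E t x - E' t x| <= m) ->
  t \in `]-r, r[ -> s \in `]-r, r[ ->
  `|(characteristic r E t x v).1 s - (characteristic r E' t x v).1 s| +
  `|(characteristic r E t x v).2 s - (characteristic r E' t x v).2 s| <= 4 * r * m.
Proof.
move=> p0 K0 B0 L0 rB m0 aE aE' EE' tI sI.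
have [_ _ Y0 V0 H] := characteristicP p0 B0 L0 rB aE x v tI.
have [_ _ Y0' V0' H'] := characteristicP p0 B0 L0 rB aE' x v tI.
have := @growth_bound _ r B m _ _ _ t s B0 m0 rB tI sI
  (fun s sI => is_deriveB (H s sI).1 (H' s sI).1)
  (fun s sI => is_deriveB (H s sI).2 (H' s sI).2).
rewrite !fctE Y0 V0 Y0' V0' !subrr !normr0 addr0 mulr0 add0r; apply.
move=> y yI.
set Y := (characteristic r E t x v).1 y; set Y' := (characteristic r E' t x v).1 y.
have -> : - E y Y - - E' y Y' = (E' y Y' - E' y Y) - (E y Y - E' y Y) by ring.
apply: le_trans (ler_normB _ _) _; rewrite lerD// (distrC Y).
exact: (field_lip p0 B0 aE').
Qed.

End Characteristics.

(** * Transport of a datum along the characteristics *)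

Section Transport.
Context {R : realType}.
Implicit Types (u w d : R -> R) (r s t x v : R).

(** The increment is split at the corner (a0, b), so each mean value theorem moves
one variable only. *)
Lemma increment2 (h hx hv : R -> R -> R) (a b a0 b0 : R) :
  (forall x v, is_derive x 1 (h ^~ v) (hx x v)) ->
  (forall v, is_derive v 1 (h a0) (hv a0 v)) ->
  exists c : R * R, [/\ `|c.1 - a0| <= `|a - a0|, `|c.2 - b0| <= `|b - b0| &
    h a b - h a0 b0 = hx c.1 b * (a - a0) + hv a0 c.2 * (b - b0)].
Proof.
move=> Hx Hv.
have inf (z : R) : z \in `]-oo, +oo[ by rewrite in_itv.
have [c1 [_ c1a _ E1]] := mvt_itv (inf a0) (inf a) (fun s _ => Hx s b).
have [c2 [_ c2b _ E2]] := mvt_itv (inf b0) (inf b) (fun s _ => Hv s).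
exists (c1, c2); split=> //=.
by rewrite -E1 -E2; ring.
Qed.

Lemma cvg_squeeze_dist (T : Type) (F : set_system T) (FF : Filter F)
    (c a : T -> R) (a0 : R) :
  (forall y, `|c y - a0| <= `|a y - a0|) -> a y @[y --> F] --> a0 ->
  c y @[y --> F] --> a0.
Proof.
move=> H /cvgrPdist_lt Ha; apply/cvgrPdist_lt => e e0.
apply: filterS (Ha e e0) => y; rewrite !(distrC a0); exact: le_lt_trans.
Qed.

Lemma is_derive_comp2 (h hx hv : R -> R -> R) (a b : R -> R) (s a' b' : R) :
  (forall x v, is_derive x 1 (h ^~ v) (hx x v)) ->
  (forall x v, is_derive v 1 (h x) (hv x v)) ->
  continuous (fun z : R * R => hx z.1 z.2) ->
  continuous (fun z : R * R => hv z.1 z.2) ->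
  is_derive s 1 a a' -> is_derive s 1 b b' ->
  is_derive s 1 (fun y => h (a y) (b y)) (hx (a s) (b s) * a' + hv (a s) (b s) * b').
Proof.
move=> Hx Hv cx cv da db; apply: is_derive_of_cvg.
have ca : a y @[y --> s^'] --> a s.
  exact: cvg_within_filter (is_derive_continuous da).
have cb : b y @[y --> s^'] --> b s.
  exact: cvg_within_filter (is_derive_continuous db).
have /choice [c Hc] : forall y, exists c : R * R,
   [/\ `|c.1 - a s| <= `|a y - a s|, `|c.2 - b s| <= `|b y - b s| &
    h (a y) (b y) - h (a s) (b s) = hx c.1 (b y) * (a y - a s) + hv (a s) c.2 * (b y - b s)].
  by move=> y; exact: increment2.
rewrite (_ : (fun y => _) = (fun y => hx (c y).1 (b y) * ((a y - a s) / (y - s))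
   + hv (a s) (c y).2 * ((b y - b s) / (y - s)))); last first.
  by apply/funext => y; have [_ _ ->] := Hc y; rewrite mulrDl !mulrA.
have c1 : (c y).1 @[y --> s^'] --> a s.
  by apply: (@cvg_squeeze_dist _ _ _ (fun y => (c y).1) a) => // y; have [] := Hc y.
have c2 : (c y).2 @[y --> s^'] --> b s.
  by apply: (@cvg_squeeze_dist _ _ _ (fun y => (c y).2) b) => // y; have [] := Hc y.
apply: cvgD; apply: cvgM; try exact: cvg_of_is_derive.
- exact: (cvg_comp _ _ (cvg_pair c1 cb) (cx (a s, b s))).
- exact: (cvg_comp _ _ (cvg_pair (cvg_cst (a s)) c2) (cv (a s, b s))).
Qed.

(** What a restart needs to know about the function from which it starts; hx and hv
are its partial derivatives. *)
Record datum (p M A : R) (h hx hv : R -> R -> R) : Prop := Datum {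
  datum_x : forall x v, is_derive x 1 (h ^~ v) (hx x v);
  datum_v : forall x v, is_derive v 1 (h x) (hv x v);
  datum_cx : continuous (fun z : R * R => hx z.1 z.2);
  datum_cv : continuous (fun z : R * R => hv z.1 z.2);
  datum_bound : forall x v, `|h x v| <= A;
  datum_bx : forall x v, `|hx x v| <= A * decay p x;
  datum_bv : forall x v, `|hv x v| <= A;
  datum_supp : forall x v, M < `|v| -> h x v = 0
}.

(** What is known about the transport of a datum by E. N bounds the velocity
support and D the sizes of f and its derivatives; [transport_solves] provides
both independently of E. *)
Record transported (r p N D : R) (E : R -> R -> R) (f fx fv : R -> R -> R -> R)
  : Prop := Transported {
  tr_x : forall t x v, t \in `]-r, r[ -> is_derive x 1 (f t ^~ v) (fx t x v);
  tr_v : forall t x v, t \in `]-r, r[ -> is_derive v 1 (f t x) (fv t x v);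
  tr_t : forall t x v, t \in `]-r, r[ ->
    is_derive t 1 (fun s => f s x v) (- v * fx t x v + E t x * fv t x v);
  tr_c : forall t x v, t \in `]-r, r[ ->
    {for (t, x, v), continuous (fun z : R * R * R => f z.1.1 z.1.2 z.2)};
  tr_cx : forall t x v, t \in `]-r, r[ ->
    {for (t, x, v), continuous (fun z : R * R * R => fx z.1.1 z.1.2 z.2)};
  tr_cv : forall t x v, t \in `]-r, r[ ->
    {for (t, x, v), continuous (fun z : R * R * R => fv z.1.1 z.1.2 z.2)};
  tr_supp : forall t x v, t \in `]-r, r[ -> N < `|v| ->
    [/\ f t x v = 0, fx t x v = 0 & fv t x v = 0];
  tr_bound : forall t x v, t \in `]-r, r[ -> `|f t x v| <= D;
  tr_bx : forall t x v, t \in `]-r, r[ -> `|fx t x v| <= D * decay p x;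
  tr_bv : forall t x v, t \in `]-r, r[ -> `|fv t x v| <= D
}.

Lemma itv_near t r : t \in `]-r, r[ -> exists2 d : R, 0 < d &
  forall s, `|s - t| < d -> s \in `]-r, r[.
Proof.
rewrite in_itv/= => /andP[t1 t2]; exists (Num.min (r - t) (t + r)).
  by rewrite lt_min; apply/andP; split; lra.
move=> s; rewrite lt_min ltr_norml ltr_norml in_itv/=.
by move=> /andP[/andP[? ?] /andP[? ?]]; apply/andP; split; lra.
Qed.

Lemma gap_continuous r (g : R * R * R -> R) (C : R) t x v : t \in `]-r, r[ ->
  (forall t' x' v', t' \in `]-r, r[ -> gap t x v t' x' v' <= 1 ->
    `|g (t', x', v') - g (t, x, v)| <= C * gap t x v t' x' v') ->
  {for (t, x, v), continuous g}.
Proof.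
move=> tI H; apply/cvgrPdist_le => e e0.
have [d d0 Hd] := itv_near tI.
have C1 : 0 < `|C| + 1 by rewrite ltr_wpDl.
pose m := Num.min d (Num.min (1/3) (e / (3 * (`|C| + 1)))).
have m0 : 0 < m by rewrite !lt_min d0 !divr_gt0// mulr_gt0.
exists (ball t m `*` ball x m, ball v m) => /=.
  split; last exact: nbhsx_ballx.
  by exists (ball t m, ball x m) => //=; split; exact: nbhsx_ballx.
move=> [[t' x'] v'] /= [[bt bx] bv].
have mg : gap t x v t' x' v' <= 3 * m.
  by move: bt bx bv; rewrite /ball/= /gap !(distrC _ t) !(distrC _ x) !(distrC _ v); lra.
have [m1 m2 m3] : [/\ m <= d, m <= 1/3 & m <= e / (3 * (`|C| + 1))].
  by split; rewrite /m !ge_min lexx ?orbT.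
rewrite distrC; apply: le_trans (H _ _ _ _ _) _.
- by apply: Hd; rewrite distrC; apply: lt_le_trans m1.
- lra.
have [g0 _ _ _] := gap_ge t x v t' x' v'.
apply: (@le_trans _ _ ((`|C| + 1) * gap t x v t' x' v')).
  by rewrite ler_wpM2r//; have := ler_norm C; lra.
apply: (@le_trans _ _ ((`|C| + 1) * (3 * m))); first by rewrite ler_wpM2l// ltW.
by move: m3; rewrite ler_pdivlMr ?mulr_gt0//; lra.
Qed.

(** Peetre's inequality: the weight varies by a bounded factor over bounded
distances. *)
Lemma decay_compare p c : 0 <= p -> 0 <= c -> exists2 D : R, 1 <= D &
  forall x y, `|y - x| <= c -> decay p y <= D * decay p x.
Proof.
move=> p0 c0.
(* 1 + x^2 <= 2 (1 + c^2) (1 + y^2) when |y - x| <= c. *)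
pose q := Num.sqrt (2 * (1 + c ^+ 2)).
have q1 : 1 <= q.
  by rewrite /q -[leLHS]sqrtr1 ler_wsqrtr//; have := sqr_ge0 c; lra.
have qp : 0 < q by exact: lt_le_trans q1.
have D0 : 0 < q `^ p by rewrite powR_gt0.
exists (q `^ p).
  have -> : 1 = 1 `^ p :> R by rewrite powR1.
  by rewrite ge0_ler_powR ?nnegrE// ltW.
move=> x y yx.
have wx := lt_le_trans ltr01 (weight_ge1 x).
have wy := lt_le_trans ltr01 (weight_ge1 y).
rewrite /decay !powRN ler_pdivlMr ?powR_gt0// mulrC ler_pdivrMr ?powR_gt0//.
rewrite -powRM; [|exact: ltW..].
apply: ge0_ler_powR => //; rewrite ?nnegrE; [exact: ltW|by rewrite mulr_ge0// ltW|].
rewrite /q /weight -sqrtrM; last by rewrite mulr_ge0// addr_ge0// sqr_ge0.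
rewrite ler_wsqrtr// !real_normK ?num_real//.
have : (y - x) ^+ 2 <= c ^+ 2 by rewrite -real_normK ?num_real// ler_sqr ?nnegrE.
have := sqr_ge0 (2 * y - x). have := sqr_ge0 (c * y).
nra.
Qed.

Lemma derive_outside_support (g : R -> R) (W v l : R) :
  (forall v, W < `|v| -> g v = 0) -> is_derive v 1 g l -> W < `|v| -> l = 0.
Proof.
move=> gW [_ <-] Wv.
suff [_ ->] : is_derive v 1 g 0 by [].
apply: (@is_derive_near _ _ (cst 0) _ _ [set y | W < `|y|]) => //.
apply: (@open_comp _ _ (fun y : R => `|y|) [set y | W < y]); last exact: open_gt.
by move=> y _; exact: norm_continuous.
Qed.

Lemma datum_supp_deriv (p M A : R) (h hx hv : R -> R -> R) x v :
  datum p M A h hx hv -> M < `|v| -> hx x v = 0 /\ hv x v = 0.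
Proof.
move=> H Mv; split.
  have [_ <-] := datum_x H x v.
  have -> : h ^~ v = cst 0 by apply/funext => y /=; rewrite (datum_supp H).
  exact: derive_cst.
exact: (derive_outside_support (datum_supp H x) (datum_v H x v)).
Qed.

Lemma datum_lip (p M A : R) (h hx hv : R -> R -> R) a b a' b' :
  0 <= p -> datum p M A h hx hv ->
  `|h a b - h a' b'| <= A * (`|a - a'| + `|b - b'|).
Proof.
move=> p0 H.
have [c [_ _ ->]] := increment2 a b b' (datum_x H) (datum_v H a').
apply: le_trans (ler_normD _ _) _; rewrite !normrM mulrDr lerD// ler_wpM2r//.
  apply: le_trans (datum_bx H _ _) _.
  by rewrite ler_piMr ?decay_le1//; apply: le_trans (datum_bound H 0 0).
exact: datum_bv H _ _.
Qed.

Definition transport r E (h : R -> R -> R) t x v := h ((characteristic r E t x v).1 0) ((characteristic r E t x v).2 0).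
Definition transport_x r E e (hx hv : R -> R -> R) t x v :=
  hx ((characteristic r E t x v).1 0) ((characteristic r E t x v).2 0) * (jacobi_x r E e t x v).1 0 +
  hv ((characteristic r E t x v).1 0) ((characteristic r E t x v).2 0) * (jacobi_x r E e t x v).2 0.
Definition transport_v r E e (hx hv : R -> R -> R) t x v :=
  hx ((characteristic r E t x v).1 0) ((characteristic r E t x v).2 0) * (jacobi_v r E e t x v).1 0 +
  hv ((characteristic r E t x v).1 0) ((characteristic r E t x v).2 0) * (jacobi_v r E e t x v).2 0.

Section OneTransport.
Variables (p M A : R) (h hx hv : R -> R -> R).
Hypotheses (p0 : 0 <= p) (M0 : 0 <= M) (dat : datum p M A h hx hv).
Variables (K B L r : R) (E e : R -> R -> R).
Hypotheses (K0 : 0 <= K) (B0 : 0 <= B) (L0 : 0 <= L) (r0 : 0 < r).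
Hypothesis rB : r * (1 + B) <= 1/4.
Hypothesis adm : admissible p K B L E e.

Let zI : 0 \in `]-r, r[.
Proof. by rewrite in_itv/= oppr_lt0 r0. Qed.

Let foot1_x t x v : t \in `]-r, r[ ->
  is_derive x 1 (fun x => (characteristic r E t x v).1 0) ((jacobi_x r E e t x v).1 0) /\
  is_derive x 1 (fun x => (characteristic r E t x v).2 0) ((jacobi_x r E e t x v).2 0).
Proof.
move=> tI; have [C HC] := characteristic_expansion p0 K0 B0 L0 rB adm x v tI.
have H y : `|y - x| < 1 ->
    `|(characteristic r E t y v).1 0 - (characteristic r E t x v).1 0 - (jacobi_x r E e t x v).1 0 * (y - x)| +
    `|(characteristic r E t y v).2 0 - (characteristic r E t x v).2 0 - (jacobi_x r E e t x v).2 0 * (y - x)|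
    <= C * (y - x) ^+ 2.
  move=> yx; have := HC t y v 0 tI zI.
  have -> : gap t x v t y v = `|y - x| by rewrite /gap !subrr !normr0 addr0 add0r.
  move=> /(_ (ltW yx) (y - x) 0); rewrite !subrr !mulr0 subr0 add0r => /(_ erefl erefl).
  by rewrite !mul0r !addr0 real_normK ?num_real// ![(y - x) * _]mulrC.
split; apply: (@is_derive_of_quadratic_remainder _ _ _ _ C 1) => // y /H; apply: le_trans.
  by rewrite lerDl.
by rewrite lerDr.
Qed.

Let foot1_v t x v : t \in `]-r, r[ ->
  is_derive v 1 (fun v => (characteristic r E t x v).1 0) ((jacobi_v r E e t x v).1 0) /\
  is_derive v 1 (fun v => (characteristic r E t x v).2 0) ((jacobi_v r E e t x v).2 0).
Proof.
move=> tI; have [C HC] := characteristic_expansion p0 K0 B0 L0 rB adm x v tI.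
have H y : `|y - v| < 1 ->
    `|(characteristic r E t x y).1 0 - (characteristic r E t x v).1 0 - (jacobi_v r E e t x v).1 0 * (y - v)| +
    `|(characteristic r E t x y).2 0 - (characteristic r E t x v).2 0 - (jacobi_v r E e t x v).2 0 * (y - v)|
    <= C * (y - v) ^+ 2.
  move=> yx; have := HC t x y 0 tI zI.
  have -> : gap t x v t x y = `|y - v| by rewrite /gap !subrr !normr0 add0r add0r.
  move=> /(_ (ltW yx) 0 (y - v)); rewrite !subrr !mulr0 subr0 addr0 => /(_ erefl erefl).
  by rewrite !mul0r !add0r real_normK ?num_real// ![(y - v) * _]mulrC.
split; apply: (@is_derive_of_quadratic_remainder _ _ _ _ C 1) => // y /H; apply: le_trans.
  by rewrite lerDl.
by rewrite lerDr.
Qed.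

Let foot1_t t x v : t \in `]-r, r[ ->
  is_derive t 1 (fun t => (characteristic r E t x v).1 0)
    (- v * (jacobi_x r E e t x v).1 0 + E t x * (jacobi_v r E e t x v).1 0) /\
  is_derive t 1 (fun t => (characteristic r E t x v).2 0)
    (- v * (jacobi_x r E e t x v).2 0 + E t x * (jacobi_v r E e t x v).2 0).
Proof.
move=> tI; have [C HC] := characteristic_expansion p0 K0 B0 L0 rB adm x v tI.
have [d d0 Hd] := itv_near tI.
pose m := Num.min d 1.
have m0 : 0 < m by rewrite lt_min d0 ltr01.
have H y : `|y - t| < m ->
    `|(characteristic r E y x v).1 0 - (characteristic r E t x v).1 0
      - (- v * (jacobi_x r E e t x v).1 0 + E t x * (jacobi_v r E e t x v).1 0) * (y - t)| +
    `|(characteristic r E y x v).2 0 - (characteristic r E t x v).2 0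
      - (- v * (jacobi_x r E e t x v).2 0 + E t x * (jacobi_v r E e t x v).2 0) * (y - t)|
    <= C * (y - t) ^+ 2.
  rewrite lt_min => /andP[/Hd yI y1]; have := HC y x v 0 yI zI.
  have -> : gap t x v y x v = `|y - t| by rewrite /gap !subrr !normr0 !addr0.
  move=> /(_ (ltW y1) _ _ erefl erefl); rewrite real_normK ?num_real// !subrr !add0r.
  set a := (- (v * _) * _ + _ * _); set b := (- (v * _) * _ + _ * _).
  set a' := (- v * _ + _) * _; set b' := (- v * _ + _) * _.
  by have -> : a = a' by [rewrite /a /a'; ring]; have -> : b = b' by [rewrite /b /b'; ring].
split; apply: (@is_derive_of_quadratic_remainder _ _ _ _ C m) => // y /H; apply: le_trans.
  by rewrite lerDl.
by rewrite lerDr.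
Qed.

Let foot_c t x v : t \in `]-r, r[ ->
  {for (t, x, v), continuous (fun z : R * R * R => (characteristic r E z.1.1 z.1.2 z.2).1 0)} /\
  {for (t, x, v), continuous (fun z : R * R * R => (characteristic r E z.1.1 z.1.2 z.2).2 0)}.
Proof.
move=> tI; split; apply: (@gap_continuous r _ (2 * (2 + `|v| + 2 * K))) => //
  t' x' v' t'I g1 /=; apply: le_trans (characteristic_stable p0 K0 B0 L0 rB adm tI t'I zI g1).
  by rewrite lerDl.
by rewrite lerDr.
Qed.

Let linearized_c t x v a b : t \in `]-r, r[ -> `|a| + `|b| <= 1 ->
  {for (t, x, v), continuous (fun z : R * R * R =>
     (flow r (linearized r E e z.1.1 z.1.2 z.2) z.1.1 a b).1 0)} /\
  {for (t, x, v), continuous (fun z : R * R * R =>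
     (flow r (linearized r E e z.1.1 z.1.2 z.2) z.1.1 a b).2 0)}.
Proof.
move=> tI ab; have [C HC] := linearized_stable p0 K0 B0 L0 rB adm x v tI ab.
split; apply: (@gap_continuous r _ C) => // t' x' v' t'I g1 /=;
  apply: le_trans (HC _ _ _ _ t'I zI g1).
  by rewrite lerDl.
by rewrite lerDr.
Qed.

Lemma transport_deriv_x t x v : t \in `]-r, r[ ->
  is_derive x 1 (transport r E h t ^~ v) (transport_x r E e hx hv t x v).
Proof.
move=> /foot1_x => /(_ x v) [d1 d2].
exact: (is_derive_comp2 (datum_x dat) (datum_v dat) (datum_cx dat) (datum_cv dat) d1 d2).
Qed.

Lemma transport_deriv_v t x v : t \in `]-r, r[ ->
  is_derive v 1 (transport r E h t x) (transport_v r E e hx hv t x v).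
Proof.
move=> /foot1_v => /(_ x v) [d1 d2].
exact: (is_derive_comp2 (datum_x dat) (datum_v dat) (datum_cx dat) (datum_cv dat) d1 d2).
Qed.

Lemma transport_deriv_t t x v : t \in `]-r, r[ ->
  is_derive t 1 (fun s => transport r E h s x v)
   (- v * transport_x r E e hx hv t x v + E t x * transport_v r E e hx hv t x v).
Proof.
move=> /foot1_t => /(_ x v) [d1 d2].
have := is_derive_comp2 (datum_x dat) (datum_v dat) (datum_cx dat) (datum_cv dat) d1 d2.
set a := (X in is_derive _ _ _ X -> _); set b := (X in _ -> is_derive _ _ _ X).
by have -> : a = b by rewrite /a /b /transport_x /transport_v; ring.
Qed.

Let comp_c (g : R -> R -> R) t x v : t \in `]-r, r[ ->
  continuous (fun z : R * R => g z.1 z.2) ->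
  {for (t, x, v), continuous (fun z : R * R * R =>
    g ((characteristic r E z.1.1 z.1.2 z.2).1 0) ((characteristic r E z.1.1 z.1.2 z.2).2 0))}.
Proof.
move=> /foot_c => /(_ x v) [c1 c2] cg.
exact: (cvg_comp _ _ (cvg_pair c1 c2) (cg (_, _))).
Qed.

Lemma transport_cont t x v : t \in `]-r, r[ ->
  {for (t, x, v), continuous (fun z : R * R * R => transport r E h z.1.1 z.1.2 z.2)}.
Proof.
move=> tI; have [c1 c2] := foot_c x v tI.
have A0 : 0 <= A by apply: le_trans (datum_bound dat 0 0).
apply: (@gap_continuous r _ (A * (2 * (2 + `|v| + 2 * K)))) => // t' x' v' t'I g1 /=.
apply: le_trans (datum_lip _ _ _ _ p0 dat) _; rewrite -mulrA ler_wpM2l//.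
exact: (characteristic_stable p0 K0 B0 L0 rB adm tI t'I zI g1).
Qed.

Lemma transport_x_cont t x v : t \in `]-r, r[ ->
  {for (t, x, v), continuous (fun z : R * R * R => transport_x r E e hx hv z.1.1 z.1.2 z.2)}.
Proof.
move=> tI; have [c1 c2] := @linearized_c t x v 1 0 tI ltac:(by rewrite normr1 normr0 addr0).
apply: cvgD; apply: cvgM => //; apply: comp_c => //; [exact: datum_cx dat|exact: datum_cv dat].
Qed.

Lemma transport_v_cont t x v : t \in `]-r, r[ ->
  {for (t, x, v), continuous (fun z : R * R * R => transport_v r E e hx hv z.1.1 z.1.2 z.2)}.
Proof.
move=> tI; have [c1 c2] := @linearized_c t x v 0 1 tI ltac:(by rewrite normr1 normr0 add0r).
apply: cvgD; apply: cvgM => //; apply: comp_c => //; [exact: datum_cx dat|exact: datum_cv dat].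
Qed.

Hypothesis rK : r * K <= 1.

Let foot2_near t x v : t \in `]-r, r[ -> `|(characteristic r E t x v).2 0 - v| <= 1.
Proof.
move=> tI; apply: le_trans (characteristic_speed p0 B0 L0 rB adm x v tI zI) _.
apply: le_trans rK; rewrite mulrC ler_wpM2r// sub0r normrN ler_norml.
by move: tI; rewrite in_itv/= => /andP[? ?]; apply/andP; split; lra.
Qed.

Lemma transport_support t x v : t \in `]-r, r[ -> M + 1 < `|v| ->
  [/\ transport r E h t x v = 0, transport_x r E e hx hv t x v = 0 & transport_v r E e hx hv t x v = 0].
Proof.
move=> tI Mv.
have H : M < `|(characteristic r E t x v).2 0|.
  have := foot2_near x v tI; have := lerB_dist v ((characteristic r E t x v).2 0).
  rewrite distrC; lra.
have [a b] := datum_supp_deriv ((characteristic r E t x v).1 0) dat H.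
by rewrite /transport /transport_x /transport_v a b !mul0r addr0; split=> //; exact: (datum_supp dat).
Qed.

Lemma transport_v_bound t x v : t \in `]-r, r[ -> `|transport_v r E e hx hv t x v| <= 2 * A.
Proof.
move=> tI; have A0 : 0 <= A by apply: le_trans (datum_bound dat 0 0).
apply: le_trans (ler_normD _ _) _; rewrite !normrM.
have := linearized_bound p0 B0 L0 rB adm x v 0 1 tI tI zI; rewrite normr0 normr1 add0r mulr1.
rewrite -/(jacobi_v _ _ _ _ _ _) => J.
apply: (@le_trans _ _ (A * `|(jacobi_v r E e t x v).1 0| + A * `|(jacobi_v r E e t x v).2 0|)).
  apply: lerD; apply: ler_wpM2r => //; last exact: (datum_bv dat).
  by apply: le_trans (datum_bx dat _ _) _; rewrite ler_piMr ?decay_le1.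
by rewrite -mulrDr mulrC; apply: ler_wpM2r.
Qed.

(** On the support |v| <= M + 1 the characteristic stays within M + 3 of x, so all
weights along it are comparable with the weight at x. The term with hx decays
because hx does; the term with hv, which need not decay, is multiplied by the
velocity component of [jacobi_x]. The size B of the slope of E enters only
through r B <= 1/4. *)
Lemma transport_x_bound (D : R) t x v :
  (forall x y, `|y - x| <= M + 3 -> decay p y <= D * decay p x) -> 1 <= D ->
  t \in `]-r, r[ -> `|transport_x r E e hx hv t x v| <= (3 * A * D) * decay p x.
Proof.
move=> HD D1 tI; have A0 : 0 <= A by apply: le_trans (datum_bound dat 0 0).
have w0 := decay_gt0 p x.
have [Mv|vM] := ltP (M + 1) `|v|.
  have [_ -> _] := transport_support x tI Mv.
  by rewrite normr0 mulr_ge0 ?(ltW w0)// mulr_ge0// ?mulr_ge0//; lra.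
have HY y : y \in `]-r, r[ -> decay p ((characteristic r E t x v).1 y) <= D * decay p x.
  move=> yI; apply: HD; apply: le_trans (characteristic_near p0 K0 B0 L0 rB adm x v tI yI) _.
  have [_ r4 yt] := dist_itv B0 rB tI yI.
  apply: (@le_trans _ _ ((M + 1 + K) * (2 * r))).
    by rewrite ler_pM// ?addr_ge0//; lra.
  have : M * r <= M * (1/4) by rewrite ler_wpM2l.
  by have := rK; have := M0; lra.
have J2 : `|(jacobi_x r E e t x v).2 0| <= D * decay p x.
  have [_ _ adm3 _ _] := adm.
  have := @jacobi_x_speed _ p K B L r E e p0 B0 L0 rB adm t x v 0 (B * (D * decay p x)) tI zI.
  move=> H; apply: le_trans (H _) _.
    move=> y yI; apply: le_trans (adm3 _ _) _; rewrite ler_wpM2l//; exact: HY.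
  have -> : 4 * r * (B * (D * decay p x)) = (4 * (r * B)) * (D * decay p x) by ring.
  rewrite ler_piMl//; first by rewrite mulr_ge0 ?(ltW w0)//; lra.
  by move: rB r0; lra.
have J1 : `|(jacobi_x r E e t x v).1 0| <= 2.
  have := linearized_bound p0 B0 L0 rB adm x v 1 0 tI tI zI; rewrite normr0 normr1 addr0 mulr1.
  rewrite -/(jacobi_x _ _ _ _ _ _); have := normr_ge0 ((jacobi_x r E e t x v).2 0); lra.
apply: le_trans (ler_normD _ _) _; rewrite !normrM.
have -> : 3 * A * D * decay p x = (A * (D * decay p x)) * 2 + A * (D * decay p x) by ring.
rewrite lerD// ler_pM//; last exact: (datum_bv dat).
apply: le_trans (datum_bx dat _ _) _; rewrite ler_wpM2l//; exact: HY.
Qed.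

End OneTransport.

(** D is chosen before the field; this is what allows the bounds to be invariant
under the iteration. *)
Theorem transport_solves (p M A : R) (h hx hv : R -> R -> R) :
  0 <= p -> 0 <= M -> datum p M A h hx hv ->
  exists2 D : R, 0 <= D & forall K B L r E e,
    0 <= K -> 0 <= B -> 0 <= L -> 0 < r -> r * (1 + B) <= 1/4 -> r * K <= 1 ->
    admissible p K B L E e ->
    transported r p (M + 1) D E (transport r E h) (transport_x r E e hx hv) (transport_v r E e hx hv).
Proof.
move=> p0 M0 dat; have [D D1 HD] := @decay_compare p (M + 3) p0 ltac:(lra).
have A0 : 0 <= A by apply: le_trans (datum_bound dat 0 0).
have AD : A <= A * D by rewrite ler_peMr.
exists (3 * A * D) => [|K B L r E e K0 B0 L0 r0 rB rK adm]; first by lra.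
split=> t x v tI.
- exact: (transport_deriv_x p0 dat K0 B0 L0 r0 rB adm).
- exact: (transport_deriv_v p0 dat K0 B0 L0 r0 rB adm).
- exact: (transport_deriv_t p0 dat K0 B0 L0 r0 rB adm).
- exact: (transport_cont p0 dat K0 B0 L0 r0 rB adm).
- exact: (transport_x_cont p0 dat K0 B0 L0 r0 rB adm).
- exact: (transport_v_cont p0 dat K0 B0 L0 r0 rB adm).
- exact: (transport_support p0 dat K0 B0 L0 r0 rB adm rK).
- by apply: le_trans (datum_bound dat _ _) _; lra.
- exact: (transport_x_bound p0 M0 dat K0 B0 L0 r0 rB adm rK).
- by apply: le_trans (transport_v_bound p0 dat B0 L0 r0 rB adm _ _ tI) _; lra.
Qed.

Lemma transport_field_stable (p M A K B L r : R) (h hx hv E e E' e' : R -> R -> R) m t x v :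
  0 <= p -> datum p M A h hx hv ->
  0 <= K -> 0 <= B -> 0 <= L -> 0 < r -> r * (1 + B) <= 1/4 -> 0 <= m ->
  admissible p K B L E e -> admissible p K B L E' e' ->
  (forall t x, `|E t x - E' t x| <= m) -> t \in `]-r, r[ ->
  `|transport r E h t x v - transport r E' h t x v| <= A * (4 * r * m).
Proof.
move=> p0 dat K0 B0 L0 r0 rB m0 adm adm' EE' tI.
have A0 : 0 <= A by apply: le_trans (datum_bound dat 0 0).
apply: le_trans (datum_lip _ _ _ _ p0 dat) _; rewrite ler_wpM2l//.
apply: (characteristic_field_stable _ _ p0 K0 B0 L0 rB m0 adm adm' EE' tI).
by rewrite in_itv/=; apply/andP; split; lra.
Qed.

End Transport.

(** * The electric field of a decaying density *)

Section Field.
Context {R : realType}.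
Local Notation mu := (@lebesgue_measure R).
Implicit Types (p x y L B : R) (s : R -> R).

Lemma powRN_cvg0 (q : R) : 0 < q -> (1 + x) `^ (- q) @[x --> +oo%R] --> (0 : R).
Proof.
move=> q0; apply/cvgrPdist_lt => e e0.
near=> x.
have x0 : 0 <= x by near: x; exact: nbhs_pinfty_ge.
have xe : e^-1 `^ q^-1 <= x by near: x; apply: nbhs_pinfty_ge; exact: num_real.
rewrite sub0r normrN ger0_norm ?powR_ge0// powRN invf_plt ?posrE ?powR_gt0//; last by lra.
have -> : e^-1 = (e^-1 `^ q^-1) `^ q.
  by rewrite -powRrM mulVf ?gt_eqF// powRr1// invr_ge0 ltW.
by rewrite gt0_ltr_powR ?nnegrE ?powR_ge0//; lra.
Unshelve. all: by end_near. Qed.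

Lemma continuous_integrable_le (D : set R) (f g : R -> R) : measurable D ->
  continuous f -> mu.-integrable D (EFin \o g) ->
  (forall x, D x -> `|f x| <= g x) -> mu.-integrable D (EFin \o f).
Proof.
move=> mD cf ig fg; apply: le_integrable ig => //.
  apply/measurable_EFinP; apply: measurable_funTS.
  exact: continuous_measurable_fun.
move=> x Dx /=; rewrite lee_fin; apply: le_trans (fg _ Dx) _; exact: ler_norm.
Qed.

Lemma weight_continuous : continuous (@weight R).
Proof.
move=> x; apply: (@continuous_comp _ _ _ (fun x => 1 + `|x| ^+ 2) (@Num.sqrt R)).
  apply: cvgD; first exact: cvg_cst.
  by apply: cvgM; exact: norm_continuous.
exact: sqrt_continuous.
Qed.

Lemma decay_continuous p : continuous (decay p : R -> R).
Proof.
move=> x; suff : {for x, continuous ((fun a : R => a `^ (- p)) \o @weight R)} by [].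
apply: continuous_comp; first exact: weight_continuous.
apply: is_derive_continuous; apply: is_derive1_powR.
exact: lt_le_trans (weight_ge1 x).
Qed.

(** An explicit primitive of (1 + x)^-p has a limit at infinity because p > 1. *)
Lemma powR_halfline p : 1 < p ->
  mu.-integrable `[0, +oo[ (EFin \o (fun x : R => (1 + x) `^ (- p))).
Proof.
move=> p1.
pose G x : R := (1 + x) `^ (- p); pose H x : R := - ((p - 1)^-1 * (1 + x) `^ (- (p - 1))).
have dH x : -1 < x -> is_derive x 1 H (G x).
  move=> x1.
  have d1 : is_derive (1 + x) 1 (fun a : R => a `^ (- (p - 1)))
      (- (p - 1) * (1 + x) `^ (- (p - 1) - 1)).
    by apply: is_derive1_powR; lra.
  have d2 : is_derive x 1 (fun x : R => 1 + x) 1.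
    have := @is_deriveD _ _ _ _ _ x 1 _ _ (is_derive_cst (1 : R) x 1) (is_derive_id x 1).
    by rewrite add0r.
  have := is_deriveN (is_deriveZ (p - 1)^-1 (is_derive1_comp d1 d2)).
  rewrite (_ : - ((p - 1)^-1 *: _) = G x) //.
  rewrite -[_ *: _]/(_ * _) mulr1 /G (_ : - (p - 1) - 1 = - p); last by ring.
  by field; lra.
have dG x : -1 < x -> {for x, continuous G}.
  move=> x1.
  suff : {for x, continuous ((fun a : R => a `^ (- p)) \o (fun x => 1 + x))} by [].
  apply: continuous_comp.
    by apply: cvgD; [exact: cvg_cst|exact: cvg_id].
  by apply: is_derive_continuous; apply: is_derive1_powR; lra.
have G0 x : 0 <= G x by exact: powR_ge0.
have cG : {within `[0, +oo[, continuous G}.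
  apply: continuous_in_subspaceT => x; rewrite inE/= in_itv/= andbT => x0.
  by apply: dG; lra.
have E : (\int[mu]_(x in `[0%R, +oo[) (G x)%:E = 0%:E - (H 0%R)%:E)%E.
  apply: ge0_continuous_FTC2y => //.
  - have -> : (0 : R) = - ((p - 1)^-1 * 0) by rewrite mulr0 oppr0.
    by apply: cvgN; apply: cvgM; [exact: cvg_cst|apply: powRN_cvg0; lra].
  - by move=> x x0; have [] := dH x ltac:(lra).
  - apply: cvg_within_filter; have := is_derive_continuous (dH 0 ltac:(lra)).
    exact.
  - move=> x; rewrite in_itv/= andbT => x0; rewrite derive1E.
    by have [_ ->] := dH x ltac:(lra).
apply/integrableP; split.
  apply/measurable_EFinP; apply: subspace_continuous_measurable_fun => //.
under eq_integral do rewrite /= ger0_norm ?powR_ge0//.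
by rewrite E ltry.
Qed.

Lemma decay_even p x : decay p (- x) = decay p x.
Proof. by rewrite /decay /weight normrN. Qed.

(** The weight is even, and 1 + x <= 2 R(x) for x >= 0 compares it with an explicit
power. *)
Lemma decay_integrable p : 1 < p -> mu.-integrable setT (EFin \o decay p).
Proof.
move=> p1; have p0 : 0 <= p by lra.
have half : mu.-integrable `[0, +oo[ (EFin \o decay p).
  have I2 : mu.-integrable `[0, +oo[ (EFin \o (fun x : R => 2 `^ p * (1 + x) `^ (- p))).
    have := @integrableZl _ _ _ mu `[0, +oo[ (measurable_itv _) (2 `^ p) _ (powR_halfline p1).
    by [].
  apply: (continuous_integrable_le _ (@decay_continuous p) I2) => //.
  move=> x /=; rewrite in_itv/= andbT => x0.
  rewrite ger0_norm ?powR_ge0// /decay !powRN ler_pdivlMr ?powR_gt0//; last by lra.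
  rewrite mulrC ler_pdivrMr ?powR_gt0 ?(lt_le_trans _ (weight_ge1 x))//.
  have w0 := le_trans ler01 (weight_ge1 x).
  rewrite -powRM//; apply: ge0_ler_powR; rewrite ?nnegrE ?mulr_ge0//; first by lra.
  rewrite /weight -[leLHS]ger0_norm; last by lra.
  rewrite -sqrtr_sqr -(@ger0_norm _ 2)// -sqrtr_sqr -sqrtrM ?sqr_ge0//.
  rewrite ler_wsqrtr// (ger0_norm x0); nra.
apply/integrableP; split.
  apply/measurable_EFinP; apply: continuous_measurable_fun.
  exact: decay_continuous.
have /integrableP[_] := half.
rewrite /=.
have d0 x : 0 <= decay p x by exact: powR_ge0.
under eq_integral do rewrite ger0_norm//.
under [X in _ -> (X < _)%E]eq_integral do rewrite ger0_norm//.
rewrite ge0_symfun_integralT//; first by rewrite -set_itvcy => ?; exact: lte_mul_pinfty.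
  exact: decay_continuous.
by move=> x; rewrite /= decay_even.
Qed.

Definition field_of s x : R :=
  2^-1 * (\int[mu]_(y in `]-oo, x]) s y - \int[mu]_(y in `[x, +oo[) s y).

Lemma half_diff_le (a b m : R) : `|a| <= m -> `|b| <= m -> `|2^-1 * (a - b)| <= m.
Proof.
move=> am bm; rewrite normrM ger0_norm ?invr_ge0//.
have := ler_normB a b; lra.
Qed.

Lemma field_of_bound_integrable p B s x : 1 < p -> mu.-integrable setT (EFin \o s) ->
  (forall x, `|s x| <= B * decay p x) -> `|field_of s x| <= B * \int[mu]_z decay p z.
Proof.
move=> p1 is_ sB.
have iT : mu.-integrable setT (EFin \o (fun x => B * decay p x)).
  by have := @integrableZl _ _ _ mu setT measurableT B _ (decay_integrable p1).
have half (D : set R) : measurable D ->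
    `|\int[mu]_(y in D) s y| <= B * \int[mu]_z decay p z.
  move=> mD; have iD : mu.-integrable D (EFin \o s) by apply: integrableS is_.
  apply: (@le_trans _ _ (\int[mu]_(y in D) `|s y|)).
    exact: le_normr_Rintegral.
  apply: (@le_trans _ _ (\int[mu]_(y in D) (B * decay p y))).
    apply: le_Rintegral => //; first by have := integrable_norm iD.
    by apply: integrableS iT.
  rewrite -RintegralZl//; last exact: decay_integrable.
  have B0 y : 0 <= B * decay p y by apply: le_trans (sB y).
  rewrite fine_le//.
  - by apply: integrable_fin_num => //; apply: integrableS iT.
  - by apply: integrable_fin_num.
  - apply: ge0_subset_integral => //; last by move=> y _; rewrite lee_fin.
    by have /integrableP[] := iT.
by apply: half_diff_le; exact: half.
Qed.

Section OneDensity.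
Variables (p B : R) (s : R -> R).
Hypotheses (p1 : 1 < p) (cs : continuous s).
Hypothesis sB : forall x, `|s x| <= B * decay p x.

Lemma scaled_decay_integrable : mu.-integrable setT (EFin \o (fun x => B * decay p x)).
Proof.
by have := @integrableZl _ _ _ mu setT measurableT B _ (decay_integrable p1).
Qed.

Lemma density_integrable (D : set R) : measurable D -> mu.-integrable D (EFin \o s).
Proof.
move=> mD; apply: (@integrableS _ _ _ mu setT) => //.
apply: (continuous_integrable_le _ cs scaled_decay_integrable) => //.
Qed.

Lemma field_of_diff x y : x <= y ->
  field_of s y - field_of s x = \int[mu]_(z in `[x, y]) s z.
Proof.
move=> xy.
have E1 := @Rintegral_itvB _ s -oo%O (BRight y) x
  (density_integrable (measurable_itv _)) isT xy.
have E2 := @Rintegral_itvB _ s (BLeft x) +oo%O y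
  (density_integrable (measurable_itv _)) xy isT.
rewrite Rintegral_itv_obnd_cbnd in E1; last exact: density_integrable.
rewrite Rintegral_itv_obnd_cbnd in E2; last exact: density_integrable.
rewrite /field_of; move: E1 E2; lra.
Qed.

Lemma field_of_bound x : `|field_of s x| <= B * \int[mu]_z decay p z.
Proof.
by apply: field_of_bound_integrable => //; exact: density_integrable.
Qed.

Lemma field_of_taylor L x y : 0 <= L -> (forall x y, `|s x - s y| <= L * `|x - y|) ->
  `|field_of s y - field_of s x - s x * (y - x)| <= L * (y - x) ^+ 2.
Proof.
move=> L0 sL.
have H (a b c : R) : a <= b -> c \in `[a, b] ->
    `|\int[mu]_(z in `[a, b]) s z - s c * (b - a)| <= L * (b - a) ^+ 2.
  move=> ab cab.
  rewrite -(Rintegral_itv_cst (s c) ab) -RintegralB//; last 2 first.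
  - exact: integrable_itv.
  - by apply: (@integrable_itv _ (cst (s c))); exact: cst_continuous.
  rewrite expr2 mulrA; apply: Rintegral_norm_le => //.
    by move=> z; apply: cvgB; [exact: cs|exact: cvg_cst].
  move=> z zab; apply: le_trans (sL _ _) _; rewrite ler_wpM2l// ler_norml.
  by move: zab cab; rewrite !in_itv/= => /andP[? ?] /andP[? ?]; apply/andP; split; lra.
have [xy|/ltW yx] := leP x y.
  by rewrite field_of_diff// H// in_itv/= lexx.
have -> : field_of s y - field_of s x - s x * (y - x) =
  - ((field_of s x - field_of s y) - s x * (x - y)) by ring.
rewrite normrN field_of_diff// (_ : (y - x) ^+ 2 = (x - y) ^+ 2); last by ring.
by rewrite H// in_itv/= lexx andbT.
Qed.

Lemma Rintegral_Ny_cvg x :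
  \int[mu]_(z in `[x - n%:R, x]) s z @[n --> \oo] --> \int[mu]_(z in `]-oo, x]) s z.
Proof.
have iN := density_integrable (measurable_itv `]-oo, x]).
have E n : \int[mu]_(z in `[x - n%:R, x]) s z
    = \int[mu]_(z in `]-oo, x]) (s \_ `[x - n%:R, x]) z.
  rewrite -Rintegral_mkcondr; congr Rintegral.
  by apply/seteqP; split=> z /=; rewrite !in_itv/=; [move=> /andP[-> ->]|case].
under eq_fun do rewrite E.
apply: fine_cvg; rewrite fineK; last exact: integrable_fin_num.
apply: (@dominated_cvg _ _ _ mu `]-oo, x] (measurable_itv _)
  (fun n z => ((s \_ `[x - n%:R, x]) z)%:E) (EFin \o s) (EFin \o (fun x => B * decay p x))).
- move=> n; apply/measurable_EFinP; apply: measurable_funTS.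
  apply/(measurable_restrictT _ _).1 => //.
  by apply: measurable_funTS; exact: continuous_measurable_fun.
- move=> z; rewrite /= in_itv/= => zx; apply: cvg_EFin; first exact: nearW.
  apply: cvg_near_cst; near=> n; rewrite /= patchE mem_set//=.
  rewrite in_itv/= zx andbT lerBlDr -lerBlDl; near: n; exact: nbhs_infty_ger.
- by [].
- by apply: (@integrableS _ _ _ mu setT) => //; exact: scaled_decay_integrable.
- move=> n z _; rewrite /= lee_fin patchE; case: ifP => _ //.
  by rewrite normr0; apply: le_trans (sB z).
Unshelve. all: by end_near. Qed.

Lemma Rintegral_y_cvg x :
  \int[mu]_(z in `[x, x + n%:R]) s z @[n --> \oo] --> \int[mu]_(z in `[x, +oo[) s z.
Proof.
have iN := density_integrable (measurable_itv `[x, +oo[).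
have E n : \int[mu]_(z in `[x, x + n%:R]) s z
    = \int[mu]_(z in `[x, +oo[) (s \_ `[x, x + n%:R]) z.
  rewrite -Rintegral_mkcondr; congr Rintegral.
  by apply/seteqP; split=> z /=; rewrite !in_itv/= ?andbT; [move=> /andP[-> ->]|case].
under eq_fun do rewrite E.
apply: fine_cvg; rewrite fineK; last exact: integrable_fin_num.
apply: (@dominated_cvg _ _ _ mu `[x, +oo[ (measurable_itv _)
  (fun n z => ((s \_ `[x, x + n%:R]) z)%:E) (EFin \o s) (EFin \o (fun x => B * decay p x))).
- move=> n; apply/measurable_EFinP; apply: measurable_funTS.
  apply/(measurable_restrictT _ _).1 => //.
  by apply: measurable_funTS; exact: continuous_measurable_fun.
- move=> z; rewrite /= in_itv/= andbT => zx; apply: cvg_EFin; first exact: nearW.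
  apply: cvg_near_cst; near=> n; rewrite /= patchE mem_set//=.
  rewrite in_itv/= zx/= -lerBlDl; near: n; exact: nbhs_infty_ger.
- by [].
- by apply: (@integrableS _ _ _ mu setT) => //; exact: scaled_decay_integrable.
- move=> n z _; rewrite /= lee_fin patchE; case: ifP => _ //.
  by rewrite normr0; apply: le_trans (sB z).
Unshelve. all: by end_near. Qed.

(** The integrals over half-lines are limits of integrals over intervals. This
transfers control of the charge of intervals to the field, without any decay of
the bound m. *)
Lemma field_of_small x (m : R) :
  (forall a b, a <= b -> `|\int[mu]_(z in `[a, b]) s z| <= m) -> `|field_of s x| <= m.
Proof.
move=> H.
have H1 : `|\int[mu]_(z in `]-oo, x]) s z| <= m.
  have c : `|\int[mu]_(z in `[x - n%:R, x]) s z| @[n --> \oo]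
      --> `|\int[mu]_(z in `]-oo, x]) s z|.
    by apply: cvg_norm; exact: Rintegral_Ny_cvg.
  rewrite -(cvg_lim _ c)//; apply: limr_le; first by apply/cvg_ex; eexists; exact: c.
  by apply: nearW => n; apply: H; rewrite gerBl.
have H2 : `|\int[mu]_(z in `[x, +oo[) s z| <= m.
  have c : `|\int[mu]_(z in `[x, x + n%:R]) s z| @[n --> \oo]
      --> `|\int[mu]_(z in `[x, +oo[) s z|.
    by apply: cvg_norm; exact: Rintegral_y_cvg.
  rewrite -(cvg_lim _ c)//; apply: limr_le; first by apply/cvg_ex; eexists; exact: c.
  by apply: nearW => n; apply: H; rewrite lerDl.
exact: half_diff_le.
Qed.

End OneDensity.

Lemma field_ofB p B s s' x : 1 < p -> continuous s -> continuous s' ->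
  (forall x, `|s x| <= B * decay p x) -> (forall x, `|s' x| <= B * decay p x) ->
  field_of s x - field_of s' x = field_of (fun y => s y - s' y) x.
Proof.
move=> p1 cs cs' sB sB'; rewrite /field_of !RintegralB//.
- by ring.
- exact: (density_integrable p1 cs sB).
- exact: (density_integrable p1 cs' sB').
- exact: (density_integrable p1 cs sB).
- exact: (density_integrable p1 cs' sB').
Qed.

Lemma field_of_dist p B s s' x m : 1 < p -> continuous s -> continuous s' ->
  (forall x, `|s x| <= B * decay p x) -> (forall x, `|s' x| <= B * decay p x) ->
  (forall a b, a <= b ->
    `|\int[mu]_(z in `[a, b]) s z - \int[mu]_(z in `[a, b]) s' z| <= m) ->
  `|field_of s x - field_of s' x| <= m.
Proof.
move=> p1 cs cs' sB sB' H.
rewrite (field_ofB _ p1 cs cs' sB sB').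
apply: (@field_of_small p (2 * B)) => //.
- by move=> y; apply: cvgB; [exact: cs|exact: cs'].
- move=> y; apply: le_trans (ler_normB _ _) _; have := sB y; have := sB' y; lra.
- by move=> a b ab; rewrite RintegralB ?H//; exact: integrable_itv.
Qed.

End Field.

(** * Conservation of charge *)

Section Density.
Context {R : realType}.
Local Notation mu := (@lebesgue_measure R).
Implicit Types (p t x y v : R).

(** The integrand is dominated on a bounded interval by the constant C. *)
Lemma is_derive_under_integral (Phi Phi' : R -> R -> R) (a b u w th C : R) : th \in `]u, w[ ->
  (forall th, th \in `]u, w[ -> continuous (Phi th)) ->
  (forall th y, th \in `]u, w[ -> is_derive th 1 (Phi ^~ y) (Phi' th y)) ->
  (forall th y, th \in `]u, w[ -> y \in `[a, b] -> `|Phi' th y| <= C) ->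
  is_derive th 1 (fun th => \int[mu]_(y in `[a, b]) Phi th y)
    (\int[mu]_(y in `[a, b]) Phi' th y).
Proof.
move=> thI cPhi dPhi bPhi.
have E t y : t \in `]u, w[ -> partial1of2 Phi t y = Phi' t y.
  by move=> tI; rewrite partial1of2E; have [_ ->] := dPhi t y tI.
have I1 t : `]u, w[%classic t -> mu.-integrable `[a, b] (EFin \o Phi t).
  by move=> tI; apply: integrable_itv; exact: cPhi.
have I2 t y : `]u, w[%classic t -> `[a, b]%classic y -> derivable (Phi ^~ y) t 1.
  by move=> tI _; have [] := dPhi t y tI.
have I3 (y : R) : 0 <= cst `|C| y by [].
have I4 : mu.-integrable `[a, b] (EFin \o cst `|C|).
  by apply: integrable_itv; exact: cst_continuous.
have I5 t y : `]u, w[%classic t -> `[a, b]%classic y -> `|partial1of2 Phi t y| <= cst `|C| y.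
  by move=> tI yI; rewrite E//; apply: le_trans (bPhi _ _ tI yI) _; exact: ler_norm.
have d1 := @derivable_under_integral _ _ _ mu _ _ (measurable_itv _) _ _ _ thI I1 I2 _ I3 I4 I5.
have d2 := @differentiation_under_integral _ _ _ mu _ _ (measurable_itv _) _ _ _ thI I1 I2 _ I3 I4 I5.
split; first exact: d1.
rewrite -derive1E d2; apply: eq_Rintegral => y _; exact: E.
Qed.

Lemma integral_continuous (Phi : R -> R -> R) (a b u w th C : R) : th \in `]u, w[ ->
  (forall th, th \in `]u, w[ -> continuous (Phi th)) ->
  (forall th y, th \in `]u, w[ -> {for th, continuous (Phi ^~ y)}) ->
  (forall th y, th \in `]u, w[ -> y \in `[a, b] -> `|Phi th y| <= C) ->
  {for th, continuous (fun th => \int[mu]_(y in `[a, b]) Phi th y)}.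
Proof.
move=> thI cPhi dPhi bPhi.
apply: (@continuity_under_integral R _ _ mu Phi `[a, b] (measurable_itv _) u w _ _ (cst `|C|) _ _ th).
- by move=> t tI; apply: integrable_itv; exact: cPhi.
- by apply: aeW => y _ t; rewrite inE/= => tI; exact: dPhi.
- by apply: integrable_itv; exact: cst_continuous.
- move=> t tI; apply: aeW => y yI; apply: le_trans (bPhi _ _ tI yI) _; exact: ler_norm.
- by rewrite inE.
Qed.

Lemma newton_leibniz (G g : R -> R) a b : a <= b -> continuous g ->
  (forall x, is_derive x 1 G (g x)) -> \int[mu]_(x in `[a, b]) g x = G b - G a.
Proof.
move=> ab cg dG.
have [->|ab'] := eqVneq a b; first by rewrite set_itv1 Rintegral_set1 subrr.
have ltab : a < b by rewrite lt_neqAle ab' ab.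
have cG x : {for x, continuous G} := is_derive_continuous (dG x).
rewrite /Rintegral (@continuous_FTC2 _ g G a b ltab).
- by rewrite -EFinB.
- exact: continuous_subspaceT.
- split; first by move=> x _; have [] := dG x.
    by apply: cvg_within_filter; exact: cG.
  by apply: cvg_within_filter; exact: cG.
- by move=> x _; rewrite derive1E; have [_ ->] := dG x.
Qed.

Lemma slice_v (G : R * R * R -> R) t x v :
  {for (t, x, v), continuous G} -> {for v, continuous (fun v => G (t, x, v))}.
Proof.
move=> H.
have c1 : (t, x) @[_ --> v] --> (t, x) by exact: cvg_cst.
have c2 : y @[y --> v] --> v by exact: cvg_id.
exact: (cvg_comp _ _ (cvg_pair c1 c2) H).
Qed.

Lemma slice_x (G : R * R * R -> R) t x v :
  {for (t, x, v), continuous G} -> {for x, continuous (fun x => G (t, x, v))}.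
Proof.
move=> H.
have c1 : t @[_ --> x] --> t by exact: cvg_cst.
have c2 : y @[y --> x] --> x by exact: cvg_id.
have c3 : v @[_ --> x] --> v by exact: cvg_cst.
exact: (cvg_comp _ _ (cvg_pair (cvg_pair c1 c2) c3) H).
Qed.

Lemma supported_integrable (g : R -> R) (n : R) : continuous g ->
  (forall v, n < `|v| -> g v = 0) ->
  mu.-integrable setT (EFin \o g) /\
  \int[mu]_v g v = \int[mu]_(v in `[- n, n]) g v.
Proof.
move=> cg gn.
have E : g = g \_ `[- n, n].
  apply/funext => v; rewrite patchE; case: ifPn => // /negP vn.
  apply: gn; rewrite ltNge; apply/negP => nv; apply: vn.
  by rewrite inE/= in_itv/= -ler_norml.
split; last by rewrite {1}E -Rintegral_mkcond.
rewrite E -restrict_EFin -integrable_mkcond//; exact: integrable_itv.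
Qed.

Section OneSolution.
Variables (r p N D K : R) (F : R -> R) (E : R -> R -> R) (f fx fv : R -> R -> R -> R).
Hypotheses (p0 : 0 <= p) (N0 : 0 <= N) (D0 : 0 <= D) (r0 : 0 < r).
Hypothesis tr : transported r p N D E f fx fv.
Hypotheses (cF : continuous F) (F0 : forall v, N < `|v| -> F v = 0).
Hypothesis EK : forall t x, `|E t x| <= K.

Let n := N + 1.
Let rho := charge_density F f.

(** With f itself this is the current of f up to a constant; with the x-derivative
of f it is the common value of d_t rho and d_x j. The interval exceeds the
velocity support by one, so that f vanishes at its endpoints. *)
Definition current f t x := \int[mu]_(v in `[- n, n]) (v * f t x v).

Let cv t x : t \in `]-r, r[ -> continuous (f t x).
Proof. by move=> tI v; exact: (is_derive_continuous (tr_v tr x v tI)). Qed.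

Let n_ge0 : 0 <= n. Proof. by have := N0; rewrite /n; lra. Qed.
Let nn : - n <= n. Proof. by have := n_ge0; lra. Qed.

Let in_n v : v \in `[- n, n] -> `|v| <= n.
Proof. by rewrite in_itv/= ler_norml. Qed.

Lemma density_supported t x : t \in `]-r, r[ ->
  mu.-integrable setT (EFin \o bg_diff F (f t) x) /\
  rho t x = \int[mu]_(v in `[- n, n]) (F v - f t x v).
Proof.
move=> tI; apply: supported_integrable.
  by move=> v; apply: cvgB; [exact: cF|exact: cv].
move=> v nv; have Nv : N < `|v| by apply: lt_trans nv; rewrite /n ltrDl.
by rewrite /bg_diff F0//; have [-> _ _] := tr_supp tr x tI Nv; rewrite subrr.
Qed.

Let cvfx t x : t \in `]-r, r[ -> continuous (fun v => v * fx t x v).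
Proof.
move=> tI v; apply: cvgM; first exact: cvg_id.
exact: (@slice_v (fun z => fx z.1.1 z.1.2 z.2) t x v (tr_cx tr tI)).
Qed.

Let cfv t x : t \in `]-r, r[ -> continuous (fv t x).
Proof. by move=> tI v; exact: (@slice_v (fun z => fv z.1.1 z.1.2 z.2) t x v (tr_cv tr tI)). Qed.

Lemma current_fx_bound t x : t \in `]-r, r[ ->
  `|current fx t x| <= 2 * n ^+ 2 * D * decay p x.
Proof.
move=> tI.
have -> : 2 * n ^+ 2 * D * decay p x = (n * (D * decay p x)) * (n - - n) by ring.
apply: Rintegral_norm_le => // [|v vI]; first exact: cvfx.
by rewrite normrM ler_pM// ?in_n// (tr_bx tr).
Qed.

Lemma current_bound t x : t \in `]-r, r[ -> `|current f t x| <= 2 * n ^+ 2 * D.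
Proof.
move=> tI.
have -> : 2 * n ^+ 2 * D = (n * D) * (n - - n) by ring.
apply: Rintegral_norm_le => // [v|v vI].
  by apply: cvgM; [exact: cvg_id|exact: cv].
by rewrite normrM ler_pM// ?in_n// (tr_bound tr).
Qed.

(** Integrate the transport equation over v. The term E times the v-derivative of f
integrates to zero because f vanishes at both ends of the interval. *)
Lemma density_derive_t t x : t \in `]-r, r[ ->
  is_derive t 1 (rho ^~ x) (current fx t x).
Proof.
move=> tI.
apply: (@is_derive_near _ _ (fun t => \int[mu]_(v in `[- n, n]) (F v - f t x v))
   _ _ `]-r, r[%classic) => //.
  by move=> s sI; have [_] := density_supported x sI.
have -> : current fx t x =
    \int[mu]_(v in `[- n, n]) (v * fx t x v - E t x * fv t x v).
  rewrite RintegralB//; last 2 first.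
  - by apply: integrable_itv; exact: cvfx.
  - apply: (@integrable_itv _ (fun v => E t x * fv t x v)) => v.
    by apply: cvgM; [exact: cvg_cst|exact: cfv].
  rewrite RintegralZl//; last by apply: integrable_itv; exact: cfv.
  rewrite (newton_leibniz nn (cfv (x:=x) tI) (fun v => tr_v tr x v tI)).
  have n0 : N < `|n| by rewrite ger0_norm// /n ltrDl.
  have n0' : N < `|- n| by rewrite normrN.
  have [-> _ _] := tr_supp tr x tI n0; have [-> _ _] := tr_supp tr x tI n0'.
  by rewrite subrr mulr0 subr0.
apply: (@is_derive_under_integral (fun s v => F v - f s x v)
  (fun s v => v * fx s x v - E s x * fv s x v) (- n) n (-r) r t (n * D + K * D)) => //.
- by move=> s sI v; apply: cvgB; [exact: cF|exact: cv].
- move=> s v sI.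
  have := is_deriveB (is_derive_cst (F v) s 1) (tr_t tr x v sI).
  by rewrite (_ : 0 - _ = v * fx s x v - E s x * fv s x v)//; ring.
- move=> s v sI vI; apply: le_trans (ler_normB _ _) _; rewrite !normrM lerD//.
    rewrite ler_pM// ?in_n//; apply: le_trans (tr_bx tr _ _ sI) _.
    by rewrite ler_piMr ?decay_le1.
  by rewrite ler_pM// (tr_bv tr).
Qed.

Lemma current_derive_x t x : t \in `]-r, r[ ->
  is_derive x 1 (current f t) (current fx t x).
Proof.
move=> tI.
apply: (@is_derive_under_integral (fun y v => v * f t y v) (fun y v => v * fx t y v)
  (- n) n (x - 1) (x + 1) x (n * D)).
- by rewrite in_itv/=; apply/andP; split; lra.
- by move=> y _ v; apply: cvgM; [exact: cvg_id|exact: cv].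
- by move=> y v _; have := is_deriveZ v (tr_x tr y v tI).
- move=> y v _ vI; rewrite normrM ler_pM// ?in_n//.
  by apply: le_trans (tr_bx tr _ _ tI) _; rewrite ler_piMr ?decay_le1.
Qed.

Lemma current_fx_continuous t : t \in `]-r, r[ -> continuous (current fx t).
Proof.
move=> tI x.
apply: (@integral_continuous (fun y v => v * fx t y v) (-n) n (x - 1) (x + 1) x (n * D)).
- by rewrite in_itv/=; apply/andP; split; lra.
- by move=> y _; exact: cvfx.
- move=> y v _; apply: cvgM; first exact: cvg_cst.
  exact: (@slice_x (fun z => fx z.1.1 z.1.2 z.2) t y v (tr_cx tr tI)).
- move=> y v _ vI; rewrite normrM ler_pM// ?in_n//.
  by apply: le_trans (tr_bx tr _ _ tI) _; rewrite ler_piMr ?decay_le1.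
Qed.

Lemma density_dist_x t x y : t \in `]-r, r[ ->
  `|rho t x - rho t y| <= 2 * n * D * `|x - y|.
Proof.
move=> tI; have [_ ->] := density_supported x tI; have [_ ->] := density_supported y tI.
have c z : continuous (fun v => F v - f t z v).
  by move=> v; apply: cvgB; [exact: cF|exact: cv].
rewrite -RintegralB//; [|exact: integrable_itv..].
have -> : 2 * n * D * `|x - y| = D * `|x - y| * (n - - n) by ring.
apply: Rintegral_norm_le => // [v|v vI].
  by apply: cvgB; exact: c.
have -> : F v - f t x v - (F v - f t y v) = f t y v - f t x v by ring.
have inf (z : R) : z \in `]-oo, +oo[ by rewrite in_itv.
rewrite distrC.
apply: (mvt_le (inf y) (inf x) (fun z _ => tr_x tr z v tI)) => z _.
by apply: le_trans (tr_bx tr _ _ tI) _; rewrite ler_piMr ?decay_le1.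
Qed.

Lemma density_continuous t : t \in `]-r, r[ -> continuous (rho t).
Proof.
by move=> tI; apply: (@lipschitz_continuous _ _ (2 * n * D)) => x y; exact: density_dist_x.
Qed.

Lemma density_dist_t t s x : t \in `]-r, r[ -> s \in `]-r, r[ ->
  `|rho t x - rho s x| <= 2 * n ^+ 2 * D * decay p x * `|t - s|.
Proof.
move=> tI sI.
apply: (mvt_le sI tI (fun u uI => density_derive_t x uI)) => u uI.
exact: current_fx_bound.
Qed.

(** Conservation of charge: d_t rho = d_x j, integrated over an interval. *)
Lemma mass_derive t a b : t \in `]-r, r[ -> a <= b ->
  is_derive t 1 (fun t => \int[mu]_(y in `[a, b]) rho t y) (current f t b - current f t a).
Proof.
move=> tI ab.
rewrite -(newton_leibniz ab (current_fx_continuous tI) (fun x => current_derive_x x tI)).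
apply: (@is_derive_under_integral rho (current fx) a b (-r) r t (2 * n ^+ 2 * D)) => //.
- by move=> s sI; exact: density_continuous.
- by move=> s y sI; exact: density_derive_t.
- move=> s y sI _; apply: le_trans (current_fx_bound _ sI) _.
  by rewrite ler_piMr ?decay_le1// !mulr_ge0// exprn_ge0.
Qed.

Lemma mass_dist_t t s a b : t \in `]-r, r[ -> s \in `]-r, r[ -> a <= b ->
  `|\int[mu]_(y in `[a, b]) rho t y - \int[mu]_(y in `[a, b]) rho s y|
    <= 4 * n ^+ 2 * D * `|t - s|.
Proof.
move=> tI sI ab.
apply: (mvt_le sI tI (fun u uI => mass_derive uI ab)) => u uI.
apply: le_trans (ler_normB _ _) _.
have := current_bound a uI; have := current_bound b uI; lra.
Qed.

End OneSolution.

Section TwoSolutions.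
Variables (r p N D K m : R) (F : R -> R) (E E' : R -> R -> R).
Variables (f fx fv f' fx' fv' : R -> R -> R -> R).
Hypotheses (p0 : 0 <= p) (N0 : 0 <= N) (D0 : 0 <= D) (r0 : 0 < r) (m0 : 0 <= m).
Hypothesis tr : transported r p N D E f fx fv.
Hypothesis tr' : transported r p N D E' f' fx' fv'.
Hypotheses (cF : continuous F) (F0 : forall v, N < `|v| -> F v = 0).
Hypothesis EK : forall t x, `|E t x| <= K.
Hypothesis EK' : forall t x, `|E' t x| <= K.
Hypothesis ff' : forall t x v, t \in `]-r, r[ -> `|f t x v - f' t x v| <= m.
Hypothesis ff0 : forall x v, f 0 x v = f' 0 x v.

Let n := N + 1.
Let n_ge0 : 0 <= n. Proof. by have := N0; rewrite /n; lra. Qed.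
Let nn : - n <= n. Proof. by have := n_ge0; lra. Qed.

Let cv t x : t \in `]-r, r[ -> continuous (f t x).
Proof. by move=> tI v; exact: (is_derive_continuous (tr_v tr x v tI)). Qed.
Let cv' t x : t \in `]-r, r[ -> continuous (f' t x).
Proof. by move=> tI v; exact: (is_derive_continuous (tr_v tr' x v tI)). Qed.

Lemma density_dist t x : t \in `]-r, r[ ->
  `|charge_density F f t x - charge_density F f' t x| <= 2 * n * m.
Proof.
move=> tI.
have [_ ->] := density_supported tr cF F0 x tI.
have [_ ->] := density_supported tr' cF F0 x tI.
have c g z : continuous (g t z) -> continuous (fun v => F v - g t z v).
  by move=> cg v; apply: cvgB; [exact: cF|exact: cg].
rewrite -RintegralB//; [|by apply: integrable_itv; apply: c; auto..].
have -> : 2 * n * m = m * (n - - n) by ring.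
apply: Rintegral_norm_le => // [v|v vI].
  by apply: cvgB; apply: c; auto.
have -> : F v - f t x v - (F v - f' t x v) = - (f t x v - f' t x v) by ring.
by rewrite normrN ff'.
Qed.

Lemma current_dist t x : t \in `]-r, r[ ->
  `|current N f t x - current N f' t x| <= 2 * n ^+ 2 * m.
Proof.
move=> tI.
have c g z : continuous (g t z) -> continuous (fun v => v * g t z v : R).
  by move=> cg v; apply: cvgM; [exact: cvg_id|exact: cg].
rewrite /current -RintegralB//; [|by apply: integrable_itv; apply: c; auto..].
have -> : 2 * n ^+ 2 * m = (n * m) * (n - - n) by ring.
apply: Rintegral_norm_le => // [v|v vI].
  by apply: cvgB; apply: c; auto.
rewrite -mulrBr normrM ler_pM// ?ff'//.
by move: vI; rewrite in_itv/= ler_norml.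
Qed.

(** Both solutions start from the same function, so the charges of an interval
agree at time 0 and separate only through the difference of the fluxes. *)
Lemma mass_dist t a b : t \in `]-r, r[ -> a <= b ->
  `|\int[mu]_(y in `[a, b]) charge_density F f t y
    - \int[mu]_(y in `[a, b]) charge_density F f' t y| <= 4 * n ^+ 2 * m * `|t|.
Proof.
move=> tI ab.
have zI : 0 \in `]-r, r[ by rewrite in_itv/= oppr_lt0 r0.
pose G s := \int[mu]_(y in `[a, b]) charge_density F f s y
    - \int[mu]_(y in `[a, b]) charge_density F f' s y.
have dG s : s \in `]-r, r[ -> is_derive s 1 G
    ((current N f s b - current N f s a) - (current N f' s b - current N f' s a)).
  move=> sI; apply: is_deriveB.
    exact: (mass_derive p0 N0 D0 tr cF F0 EK sI ab).
  exact: (mass_derive p0 N0 D0 tr' cF F0 EK' sI ab).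
have G0 : G 0 = 0.
  apply/eqP; rewrite subr_eq0; apply/eqP; apply: eq_Rintegral => y _.
  by apply: eq_Rintegral => v _; rewrite /bg_diff ff0.
have := @mvt_le _ _ G _ _ _ (4 * n ^+ 2 * m) zI tI dG; rewrite G0 !subr0; apply=> s sI.
have -> : (current N f s b - current N f s a) - (current N f' s b - current N f' s a)
  = (current N f s b - current N f' s b) - (current N f s a - current N f' s a) by ring.
apply: le_trans (ler_normB _ _) _.
have := current_dist a sI; have := current_dist b sI; lra.
Qed.

End TwoSolutions.

End Density.

(** * The field as a fixed point *)

Section FixedPoint.
Context {R : realType}.
Local Notation mu := (@lebesgue_measure R).
Implicit Types (t x y v : R).

Lemma cvg_upper_bound (u : nat -> R) (l b : R) :
  u n @[n --> \oo] --> l -> (forall n, u n <= b) -> l <= b.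
Proof.
move=> ul ub; rewrite -(cvg_lim _ ul)//; apply: limr_le.
  by apply/cvg_ex; exists l.
exact: nearW.
Qed.

Lemma cvg_of_geometric (u : nat -> R) (l c : R) :
  (forall n, `|l - u n| <= c / 2 ^+ n) -> u n @[n --> \oo] --> l.
Proof.
move=> H; apply/cvgrPdist_lt => e e0; have [k Hk] := geometric_small c e0.
by exists k => // m /= /Hk; apply: le_lt_trans.
Qed.

Lemma admissible_limit (p K B L c : R) (E e : nat -> R -> R -> R) (E' e' : R -> R -> R) :
  (forall n, admissible p K B L (E n) (e n)) ->
  (forall n t x, `|E' t x - E n t x| <= c / 2 ^+ n) ->
  (forall n t x, `|e' t x - e n t x| <= c / 2 ^+ n) ->
  admissible p K B L E' e'.
Proof.
move=> adm HE He.
have cE t x : E n t x @[n --> \oo] --> E' t x by apply: cvg_of_geometric => n; exact: HE.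
have ce t x : e n t x @[n --> \oo] --> e' t x by apply: cvg_of_geometric => n; exact: He.
split.
- move=> t x; apply: (cvg_upper_bound (cvg_norm (cE t x))) => n.
  by have [H _ _ _ _] := adm n.
- move=> t t' x; apply: (cvg_upper_bound (cvg_norm (cvgB (cE t x) (cE t' x)))) => n.
  by have [_ H _ _ _] := adm n; exact: H.
- move=> t x; apply: (cvg_upper_bound (cvg_norm (ce t x))) => n.
  by have [_ _ H _ _] := adm n.
- move=> t x y.
  apply: (cvg_upper_bound (cvg_norm (cvgB (cvgB (cE t y) (cE t x))
    (cvgM (ce t x) (cvg_cst (y - x)))))) => n.
  by have [_ _ _ H _] := adm n; exact: H.
- move=> t t' x x'; apply: (cvg_upper_bound (cvg_norm (cvgB (ce t x) (ce t' x')))) => n.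
  by have [_ _ _ _ H] := adm n; exact: H.
Qed.

Section Step.
Variables (p M A D : R) (F : R -> R) (h hx hv : R -> R -> R).
Hypotheses (p1 : 1 < p) (M0 : 0 <= M) (A0 : 0 <= A) (D0 : 0 <= D).
Hypothesis dat : datum p M A h hx hv.
Hypotheses (cF : continuous F) (F0 : forall v, M < `|v| -> F v = 0).
Hypothesis rho0 : forall x, `|\int[mu]_v bg_diff F h x v| <= A * decay p x.

(* B leaves room for the density to gain one weight over its initial bound A; K
   bounds the field of such a density, and L its Lipschitz constants. *)
Let B := A + 1.
Let n := M + 1 + 1.
Let K := B * \int[mu]_z decay p z.
Let L := 4 * n ^+ 2 * D + 2 * n * D.

Variable (r : R).
Hypotheses (r0 : 0 < r) (rB : r * (1 + B) <= 1/4) (rK : r * K <= 1).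
Hypotheses (rD : r * (2 * n ^+ 2 * D) <= 1) (rA : r * (32 * n ^+ 2 * A) <= 1).
(* The bound D is given with its defining property, as all fields must share it. *)
Hypothesis sol : forall K B L r E e,
    0 <= K -> 0 <= B -> 0 <= L -> 0 < r -> r * (1 + B) <= 1/4 -> r * K <= 1 ->
    admissible p K B L E e ->
    transported r p (M + 1) D E (transport r E h) (transport_x r E e hx hv) (transport_v r E e hx hv).

Let d := r / 2.

(** The density generated by transporting h with the field E; it is the slope in x
of [next_field]. *)
Definition next_slope (E : R -> R -> R) t x :=
  charge_density F (transport r E h) (clamp (- d) d t) x.
Definition next_field (E : R -> R -> R) t x :=
  field_of (charge_density F (transport r E h) (clamp (- d) d t)) x.

Let p0 : 0 <= p. Proof. by apply: ltW; apply: lt_trans p1. Qed.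
Let B0 : 0 <= B. Proof. by rewrite addr_ge0. Qed.
Let K0 : 0 <= K.
Proof. by rewrite mulr_ge0// Rintegral_ge0// => x _; rewrite ltW// decay_gt0. Qed.
Let n0 : 0 <= n. Proof. by rewrite !addr_ge0. Qed.
Let L0 : 0 <= L.
Proof. by rewrite addr_ge0// !mulr_ge0// exprn_ge0. Qed.
Let N0 : 0 <= M + 1. Proof. by rewrite addr_ge0. Qed.
Let F1 v : M + 1 < `|v| -> F v = 0.
Proof. by move=> H; apply: F0; apply: lt_trans H; rewrite ltrDl. Qed.
Let dd : - d <= d. Proof. by rewrite ge0_cp// /d divr_ge0// ltW. Qed.
Let clI t : clamp (- d) d t \in `]-r, r[.
Proof.
have dr : d < r by have := r0; rewrite /d; lra.
by have := clamp_in t dd; rewrite !in_itv/= => /andP[a b]; apply/andP; split; lra.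
Qed.
Let r4 : r <= 1/4.
Proof. by have := rB; have := mulr_ge0 (ltW r0) B0; lra. Qed.

Lemma transport_initial E e x v : admissible p K B L E e -> transport r E h 0 x v = h x v.
Proof.
move=> adm; have zI : 0 \in `]-r, r[ by rewrite in_itv/= oppr_lt0 r0.
have [_ _ Y V _] := characteristicP p0 B0 L0 rB adm x v zI.
by rewrite /transport Y V.
Qed.

(** By conservation of charge the density moves from its value at time 0 at a speed
bounded by the weight, and r is short enough for it to gain at most one weight. *)
Lemma next_density_bound E e t x : admissible p K B L E e -> t \in `]-r, r[ ->
  `|charge_density F (transport r E h) t x| <= B * decay p x.
Proof.
move=> adm tI; have zI : 0 \in `]-r, r[ by rewrite in_itv/= oppr_lt0 r0.
have T := sol K0 B0 L0 r0 rB rK adm.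
have [EK _ _ _ _] := adm.
have H := density_dist_t p0 N0 D0 T cF F1 EK x tI zI.
have E0 : charge_density F (transport r E h) 0 x = \int[mu]_v bg_diff F h x v.
  by apply: eq_Rintegral => v _; rewrite /bg_diff (transport_initial _ _ adm).
have w0 := decay_gt0 p x.
have := rho0 x; rewrite -E0 => H0.
have Ht : `|t - 0| <= r.
  by rewrite subr0 ler_norml; move: tI; rewrite in_itv/= => /andP[? ?]; apply/andP; split; lra.
have H2 : 2 * n ^+ 2 * D * decay p x * `|t - 0| <= decay p x.
  apply: (@le_trans _ _ (2 * n ^+ 2 * D * decay p x * r)).
    by rewrite ler_wpM2l// !mulr_ge0// ?exprn_ge0// ltW.
  rewrite (_ : _ * r = (r * (2 * n ^+ 2 * D)) * decay p x); last by ring.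
  by rewrite ler_piMl// ltW.
have := lerB_dist (charge_density F (transport r E h) t x) (charge_density F (transport r E h) 0 x).
by move: H; rewrite -/n /B; lra.
Qed.

Lemma next_admissible E e : admissible p K B L E e ->
  admissible p K B L (next_field E) (next_slope E).
Proof.
move=> adm; have T := sol K0 B0 L0 r0 rB rK adm.
have [EK _ _ _ _] := adm.
have bd t x := next_density_bound x adm (clI t).
have cd t := density_continuous p0 N0 D0 T cF F1 (clI t).
have dx t x y := density_dist_x p0 N0 D0 T cF F1 x y (clI t).
split.
- by move=> t x; exact: (field_of_bound p1 (cd t) (bd t)).
- move=> t t' x.
  apply: (@le_trans _ _ (4 * n ^+ 2 * D * `|clamp (- d) d t - clamp (- d) d t'|)).
    apply: (field_of_dist x p1 (cd t) (cd t') (bd t) (bd t')) => a b ab.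
    exact: (mass_dist_t p0 N0 D0 T cF F1 EK (clI t) (clI t') ab).
  rewrite ler_pM ?clamp_lip// ?mulr_ge0// ?exprn_ge0// /L lerDl.
  by rewrite !mulr_ge0.
- by move=> t x; exact: bd.
- move=> t x y.
  apply: (le_trans (field_of_taylor p1 (cd t) (bd t) x y _ (dx t))).
    by rewrite !mulr_ge0.
  by rewrite ler_wpM2r ?sqr_ge0// /L lerDr !mulr_ge0// exprn_ge0.
- move=> t t' x x'; rewrite /next_slope.
  set rho := charge_density F (transport r E h).
  have -> : rho (clamp (- d) d t) x - rho (clamp (- d) d t') x' =
    (rho (clamp (- d) d t) x - rho (clamp (- d) d t') x) +
    (rho (clamp (- d) d t') x - rho (clamp (- d) d t') x') by ring.
  apply: le_trans (ler_normD _ _) _.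
  have H1 := density_dist_t p0 N0 D0 T cF F1 EK x (clI t) (clI t').
  have H2 : 2 * n ^+ 2 * D * decay p x * `|clamp (- d) d t - clamp (- d) d t'|
      <= L * `|t - t'|.
    have c0 : 0 <= 2 * n ^+ 2 * D by rewrite !mulr_ge0// exprn_ge0.
    have c1 : 0 <= 2 * n * D by rewrite !mulr_ge0.
    apply: ler_pM => //; first by rewrite mulr_ge0// ltW// decay_gt0.
      apply: (@le_trans _ _ (2 * n ^+ 2 * D)); first by rewrite ler_piMr// decay_le1.
      by rewrite /L; lra.
    exact: clamp_lip.
  have H3 : 2 * n * D * `|x - x'| <= L * `|x - x'|.
    by rewrite ler_wpM2r// /L lerDr !mulr_ge0// exprn_ge0.
  rewrite mulrDr lerD//; first exact: le_trans H1 H2.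
  exact: le_trans (dx t' x x') H3.
Qed.

(** A geometric rate for the fields makes the slopes converge geometrically,
whatever the factor in the second bound. *)
Lemma next_contraction E e E' e' m : 0 <= m ->
  admissible p K B L E e -> admissible p K B L E' e' ->
  (forall t x, `|E t x - E' t x| <= m) ->
  (forall t x, `|next_field E t x - next_field E' t x| <= m / 2) /\
  (forall t x, `|next_slope E t x - next_slope E' t x| <= 2 * n * A * m).
Proof.
move=> m0 adm adm' EE'.
have T := sol K0 B0 L0 r0 rB rK adm.
have T' := sol K0 B0 L0 r0 rB rK adm'.
have [EK _ _ _ _] := adm; have [EK' _ _ _ _] := adm'.
pose q := A * (4 * r * m).
have q0 : 0 <= q by rewrite !mulr_ge0// ltW.
have ff t x v (tI : t \in `]-r, r[) : `|transport r E h t x v - transport r E' h t x v| <= q.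
  exact: (transport_field_stable x v p0 dat K0 B0 L0 r0 rB m0 adm adm' EE' tI).
have f0 x v : transport r E h 0 x v = transport r E' h 0 x v.
  by rewrite (transport_initial _ _ adm) (transport_initial _ _ adm').
split=> t x.
  have bd t x := next_density_bound x adm (clI t).
  have bd' t x := next_density_bound x adm' (clI t).
  have cd t := density_continuous p0 N0 D0 T cF F1 (clI t).
  have cd' t := density_continuous p0 N0 D0 T' cF F1 (clI t).
  apply: (field_of_dist x p1 (cd t) (cd' t) (bd t) (bd' t)) => a b ab.
  apply: (le_trans (mass_dist p0 N0 D0 r0 T T' cF F1 EK EK' ff f0 (clI t) ab)).
  have H : `|clamp (- d) d t| <= 1.
    by have := clI t; have := r4; rewrite in_itv/= ler_norml => ? /andP[? ?]; apply/andP; split; lra.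
  apply: (@le_trans _ _ (4 * n ^+ 2 * q * 1)).
    by rewrite ler_wpM2l// mulr_ge0// mulr_ge0// exprn_ge0.
  rewrite (_ : _ * 1 = (r * (32 * n ^+ 2 * A)) * (m / 2)); last by rewrite /q; field.
  by rewrite ler_piMl// divr_ge0.
apply: (le_trans (density_dist N0 T T' cF F1 ff x (clI t))).
have -> : 2 * (M + 1 + 1) * q = (4 * r) * (2 * n * A * m) by rewrite /q /n; ring.
by rewrite ler_piMl// ?mulr_ge0//; have := r4; lra.
Qed.

Let Es k := iter k next_field (fun _ _ => 0).
(* es k is the slope of the k-th field Es k. *)
Let es k := if k is k'.+1 then next_slope (Es k') else (fun _ _ => 0).

Let adm_k k : admissible p K B L (Es k) (es k).
Proof.
elim: k => [|k IH] /=; last exact: next_admissible IH.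
split=> [t x|t t' x|t x|t x y|t t' x x']; rewrite ?mul0r ?subrr ?subr0 normr0 //.
- exact: mulr_ge0.
- by apply: mulr_ge0 => //; apply: ltW; exact: decay_gt0.
- by apply: mulr_ge0 => //; exact: sqr_ge0.
- by apply: mulr_ge0 => //; exact: addr_ge0.
Qed.

Let Es_geom k : forall t x, `|Es k.+1 t x - Es k t x| <= K / 2 ^+ k.
Proof.
elim: k => [t x|k IH].
  by rewrite expr0 divr1 /= subr0; have [H _ _ _ _] := adm_k 1; exact: H.
have m0 : 0 <= K / 2 ^+ k by rewrite divr_ge0// exprn_ge0.
move=> t x; have [H _] := next_contraction m0 (adm_k k.+1) (adm_k k) IH.
rewrite (_ : K / 2 ^+ k.+1 = K / 2 ^+ k / 2); first exact: H.
by rewrite exprS; field; rewrite expf_neq0.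
Qed.

Let c := 4 * n * A * K + B.

Let nAK : 0 <= 4 * n * A * K.
Proof. by do 3 (apply: mulr_ge0 => //). Qed.

Let es_geom k t x : `|es k.+1 t x - es k t x| <= c / 2 ^+ k.
Proof.

case: k => [|k].
  rewrite expr0 divr1 /= subr0; have [_ _ H _ _] := adm_k 1.
  apply: le_trans (H _ _) _; apply: (@le_trans _ _ B).
    by rewrite ler_piMr// decay_le1.
  by rewrite /c lerDr.
have m0 : 0 <= K / 2 ^+ k by rewrite divr_ge0// exprn_ge0.
have [_ H] := next_contraction m0 (adm_k k.+1) (adm_k k) (Es_geom k).
apply: le_trans (H _ _) _.
rewrite (_ : 2 * n * A * (K / 2 ^+ k) = (4 * n * A * K) / 2 ^+ k.+1); last first.
  by rewrite exprS; field; rewrite expf_neq0.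
by rewrite ler_wpM2r ?invr_ge0 ?exprn_ge0// /c lerDl.
Qed.

Lemma next_fixpoint : exists E e, admissible p K B L E e /\
  forall t x, E t x = next_field E t x.
Proof.
have c0 : 0 <= c by rewrite addr_ge0.
have [U HU] := @geometric_limit R (R * R) (fun k z => Es k z.1 z.2) K K0
  (fun k z => Es_geom k z.1 z.2).
have [u Hu] := @geometric_limit R (R * R) (fun k z => es k z.1 z.2) c c0
  (fun k z => es_geom k z.1 z.2).
pose E t x := U (t, x); pose e t x := u (t, x).
have HE k t x : `|E t x - Es k t x| <= 2 * K / 2 ^+ k by exact: (HU k (t, x)).
have He k t x : `|e t x - es k t x| <= 2 * c / 2 ^+ k by exact: (Hu k (t, x)).
have adm : admissible p K B L E e.
  apply: (@admissible_limit p K B L (2 * K + 2 * c) Es es) => // k t x.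
    apply: le_trans (HE k t x) _.
    by rewrite ler_wpM2r ?invr_ge0 ?exprn_ge0// lerDl mulr_ge0.
  apply: le_trans (He k t x) _.
  by rewrite ler_wpM2r ?invr_ge0 ?exprn_ge0// lerDr mulr_ge0.
exists E, e; split=> // t x.
apply: (@eq_of_geometric _ _ _ (2 * K)) => k.
have m0 : 0 <= 2 * K / 2 ^+ k.
  by apply: divr_ge0; [apply: mulr_ge0|apply: exprn_ge0].
have [H _] := next_contraction m0 adm (adm_k k) (HE k).
have half (a b b' m : R) : `|a - b| <= m / 2 -> `|b' - b| <= m / 2 -> `|a - b'| <= m.
  move=> ab b'b; have -> : a - b' = (a - b) - (b' - b) by ring.
  by have := ler_normB (a - b) (b' - b); lra.
apply: (half _ (next_field (Es k) t x)); last exact: H.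
rewrite (_ : 2 * K / 2 ^+ k / 2 = 2 * K / 2 ^+ k.+1); first exact: (HE k.+1 t x).
by rewrite exprS; field; rewrite expf_neq0.
Qed.

End Step.

Theorem local_existence (p M A : R) (F : R -> R) (h hx hv : R -> R -> R) :
  1 < p -> 0 <= M -> datum p M A h hx hv ->
  continuous F -> (forall v, M < `|v| -> F v = 0) ->
  (forall x, `|\int[mu]_v bg_diff F h x v| <= A * decay p x) ->
  exists r N D B C E f fx fv,
  [/\ [/\ 0 < r, 0 <= N &
      forall t t' x x', `|E t x - E t' x'| <= C * (`|t - t'| + `|x - x'|)], transported r p N D E f fx fv,
   (forall x v, f 0 x v = h x v), (forall v, N < `|v| -> F v = 0) &
   [/\ (forall t x, t \in `]-r, r[ -> `|charge_density F f t x| <= B * decay p x),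
    (forall t x, t \in `[0, r / 2] -> electric_field F f t x = E t x) &
    (forall t, t \in `]-r, r[ -> continuous (charge_density F f t))]].
Proof.
move=> p1 M0 dat cF F0 rho0.
have p0 : 0 <= p by lra.
have A0 : 0 <= A by apply: le_trans (datum_bound dat 0 0).
have [D D0 sol] := transport_solves p0 M0 dat.
pose B := A + 1; pose n := M + 1 + 1; pose K := B * \int[mu]_z decay p z.
pose L := 4 * n ^+ 2 * D + 2 * n * D.
have B0 : 0 <= B by rewrite addr_ge0.
have K0 : 0 <= K by rewrite mulr_ge0// Rintegral_ge0// => x _; rewrite ltW// decay_gt0.
have n0 : 0 <= n by rewrite !addr_ge0.
have L0 : 0 <= L by rewrite addr_ge0// !mulr_ge0// exprn_ge0.
have X1 : 0 <= 2 * n ^+ 2 * D by rewrite !mulr_ge0// exprn_ge0.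
have X2 : 0 <= 32 * n ^+ 2 * A by rewrite !mulr_ge0// exprn_ge0.
(* Sums up the requirements on r, each of the form r X <= 1. *)
pose q := 4 * (1 + B) + K + 2 * n ^+ 2 * D + 32 * n ^+ 2 * A.
have q0 : 0 < q by rewrite /q; lra.
pose r := q^-1.
have r0 : 0 < r by rewrite invr_gt0.
have small X : X <= q -> r * X <= 1 by move=> Xq; rewrite mulrC ler_pdivrMr// mul1r.
have rB : r * (1 + B) <= 1/4.
  by have := small (4 * (1 + B)) ltac:(rewrite /q; lra); lra.
have rK : r * K <= 1 by apply: small; rewrite /q; lra.
have rD : r * (2 * n ^+ 2 * D) <= 1 by apply: small; rewrite /q; lra.
have rA : r * (32 * n ^+ 2 * A) <= 1 by apply: small; rewrite /q; lra.
have [E [e [adm fixE]]] := next_fixpoint p1 M0 A0 D0 dat cF F0 rho0 r0 rB rK rD rA sol.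
have T := sol K B L r E e K0 B0 L0 r0 rB rK adm.
have N0 : 0 <= M + 1 by rewrite addr_ge0.
have F1 v : M + 1 < `|v| -> F v = 0.
  by move=> H; apply: F0; apply: lt_trans H; rewrite ltrDl.
exists r, (M + 1), D, B, (L + B), E, (transport r E h), (transport_x r E e hx hv), (transport_v r E e hx hv).
split=> //.
- by split=> //; exact: (field_lip2 p0 B0 L0 adm).
- by move=> x v; exact: (transport_initial h p1 M0 A0 D0 r0 rB x v adm).
split.
- move=> t x tI.
  exact: (next_density_bound p1 M0 A0 D0 cF F0 rho0 r0 rB rK rD sol x adm tI).
- move=> t x tI; rewrite fixE /next_field clamp_id//.
  move: tI; rewrite !in_itv/= => /andP[? ?]; apply/andP; split; lra.
- by move=> t tI; exact: (density_continuous p0 N0 D0 T cF F1 tI).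
Qed.

End FixedPoint.

(** * Slabs, one-sided time derivatives and norms *)

Section Slab.
Context {R : realType}.
Local Notation mu := (@lebesgue_measure R).
Implicit Types (t x v T p C : R).

Lemma within_slabP T (G : R * R * R -> R) :
  {within slab T, continuous G} <->
  forall t x v, t \in `[0, T] -> forall e, 0 < e -> exists2 d, 0 < d &
    forall t' x' v', t' \in `[0, T] -> `|t' - t| < d -> `|x' - x| < d ->
      `|v' - v| < d -> `|G (t', x', v') - G (t, x, v)| < e.
Proof.
split.
  move=> /subspace_continuousP H t x v tT e e0.
  have /cvgrPdist_lt/(_ e e0) := H (t, x, v) tT.
  rewrite near_withinE.
  move=> [[A B] /= [[[A1 A2] /= [[a a0 Ha] [b b0 Hb]] HA] [c c0 Hc]] HAB].
  exists (Num.min a (Num.min b c)); first by rewrite !lt_min a0 b0.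
  move=> t' x' v' t'T; rewrite !lt_min !(distrC _ t) !(distrC _ x) !(distrC _ v).
  move=> /and3P[ta tb tc] /and3P[xa xb xc] /and3P[va vb vc].
  rewrite distrC; apply: (HAB (t', x', v')) => //=.
  split; last exact: Hc.
  by apply: (HA (t', x')); split; [exact: Ha|exact: Hb].
move=> H; apply/subspace_continuousP => -[[t x] v] tT; apply/cvgrPdist_lt => e e0.
have [d d0 Hd] := H t x v tT e e0.
rewrite near_withinE.
exists (ball t d `*` ball x d, ball v d) => /=.
  split; last exact: nbhsx_ballx.
  by exists (ball t d, ball x d) => //=; split; exact: nbhsx_ballx.
move=> [[t' x'] v'] /= [[bt bx] bv] t'T.
by rewrite distrC; apply: Hd => //; rewrite distrC.
Qed.

Lemma continuous_pointP (G : R * R * R -> R) t x v :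
  {for (t, x, v), continuous G} -> forall e, 0 < e -> exists2 d, 0 < d &
    forall t' x' v', `|t' - t| < d -> `|x' - x| < d ->
      `|v' - v| < d -> `|G (t', x', v') - G (t, x, v)| < e.
Proof.
move=> H e e0; have /cvgrPdist_lt/(_ e e0) := H.
move=> [[A B] /= [[[A1 A2] /= [[a a0 Ha] [b b0 Hb]] HA] [c c0 Hc]] HAB].
exists (Num.min a (Num.min b c)); first by rewrite !lt_min a0 b0.
move=> t' x' v'; rewrite !lt_min !(distrC _ t) !(distrC _ x) !(distrC _ v).
move=> /and3P[ta tb tc] /and3P[xa xb xc] /and3P[va vb vc].
rewrite distrC; apply: (HAB (t', x', v')) => //=.
split; last exact: Hc.
by apply: (HA (t', x')); split; [exact: Ha|exact: Hb].
Qed.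

Lemma slab_section T (G : R * R * R -> R) t : t \in `[0, T] ->
  {within slab T, continuous G} -> continuous (fun z : R * R => G (t, z.1, z.2)).
Proof.
move=> tT /within_slabP H [x v]; apply/cvgrPdist_lt => e e0.
have [d d0 Hd] := H t x v tT e e0.
exists (ball x d, ball v d) => /=; first by split; exact: nbhsx_ballx.
move=> [x' v'] /= [bx bv].
by rewrite distrC; apply: Hd => //; rewrite ?subrr ?normr0// distrC.
Qed.

Lemma within_timeP T (q : R -> R) t l :
  q s @[s --> within `[0, T] t^'] --> l <->
  forall e, 0 < e -> exists2 d, 0 < d & forall s, s \in `[0, T] -> s != t ->
    `|s - t| < d -> `|q s - l| < e.
Proof.
split.
  move=> /cvgrPdist_lt H e e0; have := H e e0.
  rewrite !near_withinE => -[d d0 Hd]; exists d => // s sT st sd.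
  by rewrite distrC; apply: Hd => //=; rewrite distrC.
move=> H; apply/cvgrPdist_lt => e e0; have [d d0 Hd] := H e e0.
rewrite !near_withinE; exists d => // s /= sd st sT.
by rewrite distrC; apply: Hd => //; rewrite distrC.
Qed.

Lemma proper_time T t : 0 < T -> t \in `[0, T] -> ProperFilter (within `[0, T] t^').
Proof.
move=> T0 tT; apply: Build_ProperFilter_ex.
move=> P [d /= d0 Hd].
move: tT; rewrite in_itv/= => /andP[t0 tT].
have [t2|t2] := leP t (T / 2).
  pose s := t + Num.min (d / 2) (T / 2).
  have m0 : 0 < Num.min (d / 2) (T / 2) by rewrite lt_min !divr_gt0.
  have m1 : Num.min (d / 2) (T / 2) <= d / 2 by rewrite ge_min lexx.
  have m2 : Num.min (d / 2) (T / 2) <= T / 2 by rewrite ge_min lexx orbT.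
  exists s; apply: Hd.
  - rewrite /= distrC /s addrAC subrr add0r gtr0_norm//; lra.
  - by rewrite /s gt_eqF// ltrDl.
  - by rewrite /s in_itv/=; apply/andP; split; lra.
pose m := Num.min (d / 2) (T / 2).
have m0 : 0 < m by rewrite lt_min !divr_gt0.
have m1 : m <= d / 2 by rewrite ge_min lexx.
have m2 : m <= T / 2 by rewrite ge_min lexx orbT.
exists (t - m); apply: Hd.
- rewrite /= opprB addrCA subrr addr0 gtr0_norm//; lra.
- by rewrite lt_eqF// ltrBlDr ltrDl.
- by rewrite in_itv/=; apply/andP; split; lra.
Qed.

(** Uniqueness of the limit needs t to be an accumulation point of [0, T], which
holds since T > 0. *)
Lemma partial_tP T (f : R -> R -> R -> R) t x v l : 0 < T -> t \in `[0, T] ->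
  (forall e, 0 < e -> exists2 d, 0 < d & forall s, s \in `[0, T] -> s != t ->
    `|s - t| < d -> `|time_quotient f t x v s - l| < e) ->
  cvg (time_quotient f t x v s @[s --> within `[0, T] t^']) /\ partial_t T f t x v = l.
Proof.
move=> T0 tT /within_timeP H; have PF := proper_time T0 tT.
by split; [apply/cvg_ex; exists l|apply/cvg_lim].
Qed.

Lemma partial_t_quotient T (f : R -> R -> R -> R) t x v : 0 < T -> t \in `[0, T] ->
  cvg (time_quotient f t x v s @[s --> within `[0, T] t^']) ->
  forall e, 0 < e -> exists2 d, 0 < d & forall s, s \in `[0, T] -> s != t ->
    `|s - t| < d -> `|time_quotient f t x v s - partial_t T f t x v| < e.
Proof. by move=> T0 tT H; apply/within_timeP. Qed.

Lemma derivable_is_derive1 (g : R -> R) x : derivable g x 1 -> is_derive x 1 g (derive1 g x).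
Proof. by move=> H; split=> //; rewrite derive1E. Qed.

Section Norms.
Variable (p : R) (k : R -> R -> R).

Lemma triple_norm_le C : (triple_norm p k <= C%:E)%E ->
  [/\ forall x v, `|k x v| <= C, forall x v, `|partial_v k x v| <= C,
    forall x v, `|partial_x k x v| <= C * decay p x &
    forall x, `|\int[mu]_v k x v| <= C * decay p x].
Proof.
have decayE (a x : R) : a * weight x `^ p <= C -> a <= C * decay p x.
  have w0 : 0 < weight x `^ p by rewrite powR_gt0// (lt_le_trans ltr01 (weight_ge1 x)).
  by rewrite /decay powRN ler_pdivlMr.
have sup_ge (X : Type) (g : X -> R) z : ((g z)%:E <= ereal_sup (range (fun z => (g z)%:E)))%E.
  by apply: ereal_sup_ubound; exists z.
rewrite /triple_norm.
have a0 : (0 <= sup_norm k)%E.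
  by apply: le_trans (sup_ge (R * R)%type (fun z => `|k z.1 z.2|) (0, 0)); rewrite lee_fin.
have b0 : (0 <= sup_norm (partial_v k))%E.
  by apply: le_trans (sup_ge (R * R)%type (fun z => `|partial_v k z.1 z.2|) (0, 0)); rewrite lee_fin.
have c0 : (0 <= wnorm2 p (partial_x k))%E.
  apply: le_trans (sup_ge (R * R)%type (fun z => `|partial_x k z.1 z.2| * weight z.1 `^ p) (0, 0)).
  by rewrite lee_fin mulr_ge0// powR_ge0.
have d0 : (0 <= wnorm p (fun x => \int[mu]_v k x v)%R)%E.
  apply: le_trans (sup_ge R (fun x => `|\int[mu]_v k x v| * weight x `^ p) 0).
  by rewrite lee_fin mulr_ge0// powR_ge0.
move=> H.
have Ha : (sup_norm k <= C%:E)%E.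
  by apply: le_trans H; rewrite -!addeA leeDl// !adde_ge0.
have Hb : (sup_norm (partial_v k) <= C%:E)%E.
  by apply: le_trans H; rewrite -addeA addeAC addeC; rewrite leeDl// !adde_ge0.
have Hc : (wnorm2 p (partial_x k) <= C%:E)%E.
  by apply: le_trans H; rewrite addeAC [leRHS]addeC; rewrite leeDl// !adde_ge0.
have Hd : (wnorm p (fun x => \int[mu]_v k x v)%R <= C%:E)%E.
  by apply: le_trans H; rewrite [leRHS]addeC; rewrite leeDl// !adde_ge0.
split=> x.
- move=> v; rewrite -lee_fin; apply: le_trans Ha.
  exact: (sup_ge (R * R)%type (fun z => `|k z.1 z.2|) (x, v)).
- move=> v; rewrite -lee_fin; apply: le_trans Hb.
  exact: (sup_ge (R * R)%type (fun z => `|partial_v k z.1 z.2|) (x, v)).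
- move=> v; apply: decayE; rewrite -lee_fin; apply: le_trans Hc.
  exact: (sup_ge (R * R)%type (fun z => `|partial_x k z.1 z.2| * weight z.1 `^ p) (x, v)).
- apply: decayE; rewrite -lee_fin; apply: le_trans Hd.
  exact: (sup_ge R (fun x => `|\int[mu]_v k x v| * weight x `^ p) x).
Qed.

Lemma triple_norm_bound C1 C2 C3 C4 :
  (forall x v, `|k x v| <= C1) -> (forall x v, `|partial_v k x v| <= C2) ->
  (forall x v, `|partial_x k x v| <= C3 * decay p x) ->
  (forall x, `|\int[mu]_v k x v| <= C4 * decay p x) ->
  (triple_norm p k <= (C1 + C2 + C3 + C4)%:E)%E.
Proof.
move=> H1 H2 H3 H4.
have decayE (a C x : R) : a <= C * decay p x -> a * weight x `^ p <= C.
  have w0 : 0 < weight x `^ p by rewrite powR_gt0// (lt_le_trans ltr01 (weight_ge1 x)).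
  by rewrite /decay powRN ler_pdivlMr.
rewrite /triple_norm !EFinD; apply: leeD; first apply: leeD; first apply: leeD.
- by apply: ge_ereal_sup => _ [z _ <-]; rewrite lee_fin.
- by apply: ge_ereal_sup => _ [z _ <-]; rewrite lee_fin.
- by apply: ge_ereal_sup => _ [z _ <-]; rewrite lee_fin decayE.
- by apply: ge_ereal_sup => _ [x _ <-]; rewrite lee_fin decayE.
Qed.

End Norms.

End Slab.

(** * Compact velocity support by a maximum principle *)

Section MaximumPrinciple.
Context {R : realType}.
Local Notation mu := (@lebesgue_measure R).
Implicit Types (t x v T p C : R).

Lemma norm_comb_lt (a b c y z q : R) : `|a| < q -> `|b| < q -> `|c| < q ->
  `|a * y - b * z - c| < q * (`|z| + `|y| + 1).
Proof.
move=> aq bq cq.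
have h1 := ler_normB (a * y - b * z) c.
have h2 := ler_normB (a * y) (b * z); rewrite !normrM in h2.
have h3 : `|a| * `|y| <= q * `|y| by apply: ler_wpM2r => //; exact: ltW.
have h4 : `|b| * `|z| <= q * `|z| by apply: ler_wpM2r => //; exact: ltW.
rewrite !mulrDr mulr1; lra.
Qed.

Section Support.
Variables (T K M : R) (E : R -> R -> R) (f : R -> R -> R -> R).
Hypotheses (T0 : 0 < T) (K0 : 0 <= K).
Hypothesis C1 : is_C1_slab T f.
Hypothesis EK : forall t x, t \in `[0, T] -> `|E t x| <= K.
Hypothesis pde : forall t x v, t \in `[0, T] ->
  partial_t T f t x v + v * partial_x (f t) x v - E t x * partial_v (f t) x v = 0.
Hypothesis f0M : forall x v, M < `|v| -> f 0 x v = 0.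

Let dx t x v : t \in `[0, T] -> is_derive x 1 (f t ^~ v) (partial_x (f t) x v).
Proof.
move=> tT; have [H _ _ _ _] := C1; have [_ d _] := H t x v tT.
exact: derivable_is_derive1.
Qed.

Let dv t x v : t \in `[0, T] -> is_derive v 1 (f t x) (partial_v (f t) x v).
Proof.
move=> tT; have [H _ _ _ _] := C1; have [_ _ d] := H t x v tT.
exact: derivable_is_derive1.
Qed.

(** The equation says that the derivative of f in the direction (-1, -v, E) is
zero. Only times before t are used, so this makes sense at t = T. *)
Lemma backward_quotient t x v e : t \in `[0, T] -> 0 < t -> 0 < e ->
  exists s : R, [/\ 0 < s, s <= t &
    `|f (t - s) (x - s * v) (v + s * E t x) - f t x v| < e * s].
Proof.
move=> tT t0 e0.
(* a bounds the length of the direction (1, v, E); the step is chosen so that all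
   displacements stay below d. *)
pose a := `|v| + `|E t x| + 1.
have a0 : 0 < a by rewrite ltr_wpDl// addr_ge0.
pose q := e / a.
have q0 : 0 < q by rewrite divr_gt0.
have [H1 _ _ cx cv] := C1; have [ct _ _] := H1 t x v tT.
have [d1 d10 Hd1] := partial_t_quotient T0 tT ct q0.
have [d2 d20 Hd2] := (within_slabP _ _).1 cx t x v tT q q0.
have [d3 d30 Hd3] := (within_slabP _ _).1 cv t x v tT q q0.
pose d := Num.min (Num.min d1 t) (Num.min d2 d3).
have d0 : 0 < d by rewrite !lt_min d10 t0 d20 d30.
pose s := d / (2 * a).
have s0 : 0 < s by rewrite divr_gt0// mulr_gt0.
have sa : s * a = d / 2 by rewrite /s; field; rewrite gt_eqF.
have a1 : 1 <= a by rewrite lerDr addr_ge0.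
have sd : s < d.
  have : s * 1 <= s * a by rewrite ler_wpM2l// ltW.
  lra.
have svd : `|s * v| < d.
  rewrite normrM gtr0_norm//; have : s * `|v| <= s * a.
    by apply: ler_wpM2l; [exact: ltW|rewrite /a; have := normr_ge0 (E t x); lra].
  lra.
have sEd : `|s * E t x| < d.
  rewrite normrM gtr0_norm//; have : s * `|E t x| <= s * a.
    by apply: ler_wpM2l; [exact: ltW|rewrite /a; have := normr_ge0 v; lra].
  lra.
have [dd1 dd2 dd3 dd4] : [/\ d <= d1, d <= t, d <= d2 & d <= d3].
  by split; rewrite /d !ge_min lexx ?orbT.
have tT' : t - s \in `[0, T].
  by move: tT; rewrite !in_itv/= => /andP[? ?]; apply/andP; split; lra.
have ts : `|t - s - t| < d by rewrite addrAC subrr add0r normrN gtr0_norm.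
exists s; split=> //; first by lra.
have [[c1 c2] /= [cc1 cc2 Ec]] := increment2 (x - s * v) (v + s * E t x) v
   (fun x v => dx x v tT') (fun w => dv x w tT').
rewrite [x - s * v]addrC addrK in cc1.
rewrite [v + _]addrC addrK in cc2.
have -> : f (t - s) (x - s * v) (v + s * E t x) - f t x v =
  (f (t - s) (x - s * v) (v + s * E t x) - f (t - s) x v) + (f (t - s) x v - f t x v) by ring.
have A1 : `|partial_x (f (t - s)) c1 (v + s * E t x) - partial_x (f t) x v| < q.
  apply: (Hd2 (t - s) c1 (v + s * E t x)) => //.
  - exact: lt_le_trans dd3.
  - by apply: le_lt_trans cc1 _; rewrite normrN; exact: lt_le_trans dd3.
  - by rewrite addrC addKr; exact: lt_le_trans dd3.
have A2 : `|partial_v (f (t - s)) x c2 - partial_v (f t) x v| < q.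
  apply: (Hd3 (t - s) x c2) => //.
  - exact: lt_le_trans dd4.
  - by rewrite subrr normr0.
  - by apply: le_lt_trans cc2 _; exact: lt_le_trans dd4.
have A3 : `|time_quotient f t x v (t - s) - partial_t T f t x v| < q.
  apply: Hd1 => //; last exact: lt_le_trans dd1.
  by rewrite lt_eqF// ltrBlDr ltrDl.
have Eq : f (t - s) x v - f t x v = - s * time_quotient f t x v (t - s).
  rewrite /time_quotient addrAC subrr add0r; field.
  by rewrite gt_eqF.
have P := pde x v tT.
set px := partial_x (f t) x v in P A1.
set pv := partial_v (f t) x v in P A2.
set pt := partial_t T f t x v in P A3.
set qx := partial_x _ _ _ in Ec A1.
set qv := partial_v _ _ _ in Ec A2.
set qt := time_quotient _ _ _ _ _ in Eq A3.
have -> : (f (t - s) (x - s * v) (v + s * E t x) - f (t - s) x v) + (f (t - s) x v - f t x v)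
  = s * ((qv - pv) * E t x - (qx - px) * v - (qt - pt)).
  rewrite Ec Eq.
  have -> : pt = E t x * pv - v * px by rewrite -[LHS]subr0 -P; ring.
  by ring.
rewrite normrM gtr0_norm// mulrC ltr_pM2r//.
have -> : e = q * a by rewrite /q divfK// gt_eqF.
exact: norm_comb_lt.
Qed.

Let cone t1 x1 v1 S := [set z : R * R * R | [/\ z.1.1 \in `[0, t1],
   `|z.1.2 - x1| <= S * (t1 - z.1.1) & `|z.2 - v1| <= K * (t1 - z.1.1)]].

Let cone_compact t1 x1 v1 S : 0 <= S -> compact (cone t1 x1 v1 S).
Proof.
move=> S0.
have cB : compact ((`[0, t1]%classic `*` `[x1 - S * t1, x1 + S * t1]%classic)
    `*` `[v1 - K * t1, v1 + K * t1]%classic : set (R * R * R)).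
  by apply: compact_setX; [apply: compact_setX|]; exact: segment_compact.
apply: (subclosed_compact _ cB).
  have cfst (X Y : topologicalType) : continuous (@fst X Y) by move=> z; exact: cvg_fst.
  have csnd (X Y : topologicalType) : continuous (@snd X Y) by move=> z; exact: cvg_snd.
  have c1 : continuous (fun z : R * R * R => z.1.1).
    by move=> z; apply: (continuous_comp (cfst _ _ z) (cfst _ _ z.1)).
  have c2 : continuous (fun z : R * R * R => z.1.2).
    by move=> z; apply: (continuous_comp (cfst _ _ z) (csnd _ _ z.1)).
  have c3 : continuous (fun z : R * R * R => z.2) by exact: csnd.
  have cl (g : R * R * R -> R) : continuous g -> closed [set z | 0 <= g z].
    move=> cg; apply: (@closed_comp _ _ g [set y | 0 <= y]); last exact: closed_ge.
    by move=> z _; exact: cg.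
  rewrite (_ : cone _ _ _ _ = ([set z | 0 <= z.1.1] `&` [set z | 0 <= t1 - z.1.1]) `&`
    ([set z | 0 <= S * (t1 - z.1.1) - `|z.1.2 - x1|] `&`
     [set z | 0 <= K * (t1 - z.1.1) - `|z.2 - v1|])); last first.
    apply/seteqP; split=> -[[t x] v].
      by rewrite /cone /= in_itv/= !subr_ge0 => -[/andP[-> ->] -> ->].
    by rewrite /cone /= !subr_ge0 in_itv/= => -[[-> ->] [-> ->]].
  have c4 : continuous (fun z : R * R * R => t1 - z.1.1).
    by move=> z; apply: cvgB; [exact: cvg_cst|exact: c1].
  have c5 (S' y : R) (g : R * R * R -> R) : continuous g ->
      continuous (fun z : R * R * R => S' * (t1 - z.1.1) - `|g z - y|).
    move=> cg z; apply: cvgB.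
      by apply: cvgM; [exact: cvg_cst|exact: c4].
    by apply: cvg_norm; apply: cvgB; [exact: cg|exact: cvg_cst].
  by apply: closedI; apply: closedI; apply: cl; [exact: c1|exact: c4|exact: c5|exact: c5].
move=> [[t x] v] [/=]; rewrite !in_itv/= => /andP[t0 tt1] Hx Hv.
have St : S * (t1 - t) <= S * t1 by rewrite ler_wpM2l// gerBl.
have Kt : K * (t1 - t) <= K * t1 by rewrite ler_wpM2l// gerBl.
move: Hx Hv; rewrite !ler_norml => /andP[? ?] /andP[? ?].
by split; [split|]; rewrite /= ?in_itv/= ?t0//; apply/andP; split; lra.
Qed.

(** Maximum principle. On the cone of points that can reach (t1, x1, v1), let
b f - e t with b = 1 or -1 be maximal at (t, x, v). If t > 0, a small step in
the direction (-1, -v, E) stays in the cone and changes b f by less than e times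
the step, while -e t grows by e times the step: a contradiction. So t = 0, where
f vanishes because the velocities of the cone exceed M. Let e tend to 0. *)
Lemma support_propagates t1 x1 v1 : t1 \in `[0, T] -> M + K * t1 < `|v1| ->
  f t1 x1 v1 = 0.
Proof.
move=> t1T Mv.
have /andP[t10 t1T'] : 0 <= t1 <= T by move: t1T; rewrite in_itv.
suff H (b : R) : `|b| = 1 -> forall e, 0 < e -> b * f t1 x1 v1 <= e * (T + 1).
  have T1 : 0 < T + 1 by lra.
  have le0 b : `|b| = 1 -> b * f t1 x1 v1 <= 0.
    move=> b1; rewrite leNgt; apply/negP => bf.
    have e0 : 0 < b * f t1 x1 v1 / (2 * (T + 1)).
      by apply: divr_gt0 => //; apply: mulr_gt0.
    have := H b b1 _ e0.
    rewrite (_ : _ / _ * _ = b * f t1 x1 v1 / 2); last by field; rewrite gt_eqF.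
    lra.
  apply/eqP; rewrite eq_le; apply/andP; split.
    by have := le0 1 (normr1 _); rewrite mul1r.
  by have := le0 (-1) (normrN1 _); rewrite mulN1r oppr_le0.
move=> b1 e e0.
(* The velocities of the cone are at most S, so positions in it are traced back with
   speed at most S. *)
pose S := `|v1| + K * T.
have S0 : 0 <= S by rewrite addr_ge0// mulr_ge0// ltW.
pose u (z : R * R * R) := b * f z.1.1 z.1.2 z.2 - e * z.1.1.
have sub : cone t1 x1 v1 S `<=` slab T.
  move=> [[t x] v] [/= + _ _]; rewrite /slab /= !in_itv/= => /andP[-> tt1] /=.
  exact: le_trans tt1 t1T'.
have cu : {within cone t1 x1 v1 S, continuous u}.
  apply: (continuous_subspaceW sub); have [_ cf _ _ _] := C1.
  apply/within_slabP => t x v tT eps eps0.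
  have [d d0 Hd] := (within_slabP _ _).1 cf t x v tT (eps / 2) ltac:(lra).
  exists (Num.min d (eps / (2 * e))); first by rewrite lt_min d0 divr_gt0// mulr_gt0.
  move=> t' x' v' t'T; rewrite !lt_min => /andP[td te] /andP[xd _] /andP[vd _].
  rewrite /u /=.
  have -> : b * f t' x' v' - e * t' - (b * f t x v - e * t)
    = b * (f t' x' v' - f t x v) - e * (t' - t) by ring.
  apply: le_lt_trans (ler_normB _ _) _; rewrite !normrM b1 mul1r (gtr0_norm e0).
  have := Hd t' x' v' t'T td xd vd.
  have : e * `|t' - t| < eps / 2.
    by move: te; rewrite ltr_pdivlMr ?mulr_gt0//; lra.
  move=> /=; lra.
have ne : cone t1 x1 v1 S !=set0.
  by exists (t1, x1, v1); split; rewrite /= ?in_itv/= ?t10 ?lexx// !subrr normr0 mulr0.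
have [[[t x] v] /set_mem zC umax] := compact_EVT_max ne (cone_compact S0) cu.
have [tI xI vI] := zC; rewrite /= in tI xI vI.
have tT : t \in `[0, T] by exact: (sub _ zC).
have /andP[t0 tt1] : 0 <= t <= t1 by move: tI; rewrite in_itv.
have u1 : u (t1, x1, v1) <= u (t, x, v).
  apply: umax; apply: mem_set.
  by split; rewrite /= ?in_itv/= ?t10 ?lexx// !subrr normr0 mulr0.
have Kv : M < `|v| - K * t.
  have := lerB_dist v1 v; rewrite distrC => h1.
  by move: vI; rewrite mulrBr; lra.
have [tz|tn] := eqVneq t 0.
  have f0 : f t x v = 0.
    by rewrite tz; apply: f0M; move: Kv; rewrite tz mulr0 subr0.
  move: u1; rewrite /u /= f0 mulr0 tz mulr0 subr0 => u1.
  have : e * t1 <= e * T by rewrite ler_wpM2l// ltW.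
  lra.
have tp : 0 < t by rewrite lt_neqAle eq_sym tn.
have [s [s0 st Hs]] := backward_quotient x v tT tp e0.
have vS : `|v| <= S.
  have h1 : `|v| <= `|v1| + `|v - v1| by have := lerB_dist v v1; lra.
  have : K * (t1 - t) <= K * T by rewrite ler_wpM2l//; lra.
  by rewrite /S; lra.
have : u (t - s, x - s * v, v + s * E t x) <= u (t, x, v).
  apply: umax; apply: mem_set; split=> /=.
  - by rewrite in_itv/=; apply/andP; split; lra.
  - have -> : x - s * v - x1 = (x - x1) - s * v by ring.
    apply: le_trans (ler_normB _ _) _.
    rewrite normrM gtr0_norm//.
    have : s * `|v| <= s * S by rewrite ler_wpM2l// ltW.
    have -> : S * (t1 - (t - s)) = S * (t1 - t) + s * S by ring.
    lra.
  - have -> : v + s * E t x - v1 = (v - v1) + s * E t x by ring.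
    apply: le_trans (ler_normD _ _) _.
    rewrite normrM gtr0_norm//.
    have : s * `|E t x| <= s * K by rewrite ler_wpM2l ?EK// ltW.
    have -> : K * (t1 - (t - s)) = K * (t1 - t) + s * K by ring.
    lra.
rewrite /u /=.
have : `|b * (f (t - s) (x - s * v) (v + s * E t x) - f t x v)| < e * s.
  by rewrite normrM b1 mul1r.
rewrite ltr_norml => /andP[+ _]; rewrite mulrBr; lra.
Qed.

End Support.

End MaximumPrinciple.

(** * The datum at the restarting time *)

Section DataAtT.
Context {R : realType}.
Local Notation mu := (@lebesgue_measure R).
Implicit Types (t x v T p C : R).

Lemma compact_support_bounded (g : R -> R) (W : R) : continuous g ->
  (forall v, W < `|v| -> g v = 0) -> exists2 C : R, 0 <= C & forall v, `|g v| <= C.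
Proof.
move=> cg gW; have W0 : - `|W| <= `|W| by rewrite ge0_cp.
have cn : {within `[- `|W|, `|W|], continuous (fun v => `|g v|)}.
  by apply: continuous_subspaceT => v; apply: cvg_norm; exact: cg.
have [c _ Hc] := EVT_max W0 cn.
exists `|g c| => // v; have [vW|Wv] := leP `|v| `|W|.
  by apply: Hc; rewrite in_itv/= -ler_norml.
by rewrite gW ?normr0//; apply: le_lt_trans Wv; exact: ler_norm.
Qed.

Lemma background_bounded (F : R -> R) : assumption_A2 F ->
  exists W C : R, [/\ 0 <= W, 0 <= C, forall v, W < `|v| -> F v = 0,
    forall v, is_derive v 1 F (derive1 F v) &
    forall v, `|F v| <= C /\ `|derive1 F v| <= C].
Proof.
move=> [[dF _] _ [W W0 FW]].
have d0 v : is_derive v 1 F (derive1 F v).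
  by apply: derivable_is_derive1; exact: (dF 0%N).
have c1 : continuous (derive1 F).
  by move=> v; apply: differentiable_continuous; apply/derivable1_diffP; exact: (dF 1%N).
have c0 : continuous F by move=> v; exact: (is_derive_continuous (d0 v)).
have F'W v : W < `|v| -> derive1 F v = 0 by exact: (derive_outside_support FW (d0 v)).
have [C1 C10 H1] := compact_support_bounded c0 FW.
have [C2 C20 H2] := compact_support_bounded c1 F'W.
exists W, (C1 + C2); split=> //; [exact: ltW|exact: addr_ge0|].
by move=> v; have := H1 v; have := H2 v; split; lra.
Qed.

(** Derivatives of F - k, through which the norms bound those of k and conversely. *)
Lemma bg_diff_partials (F : R -> R) (k kx kv : R -> R -> R) x v :
  is_derive v 1 F (derive1 F v) -> is_derive x 1 (k ^~ v) (kx x v) ->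
  is_derive v 1 (k x) (kv x v) ->
  partial_x (bg_diff F k) x v = - kx x v /\
  partial_v (bg_diff F k) x v = derive1 F v - kv x v.
Proof.
move=> dF dx dv; split; rewrite /partial_x /partial_v derive1E.
  have [_ H] := is_deriveB (is_derive_cst (F v) x 1) dx.
  by rewrite -sub0r -H.
by have [_ H] := is_deriveB dF dv; rewrite -H.
Qed.

Section Restart.
Variables (p T C0 : R) (F : R -> R) (f0 : R -> R -> R) (f : R -> R -> R -> R).
Hypotheses (p1 : 1 < p) (T0 : 0 < T).
Hypotheses (hA1 : assumption_A1 p F f0) (hA2 : assumption_A2 F).
Hypothesis hf : VP_solution F f0 T f.
Hypothesis hC0 : forall t, t \in `[0, T] -> (triple_norm p (bg_diff F (f t)) <= C0%:E)%E.

Let TT : T \in `[0, T]. Proof. by rewrite in_itv/= lexx ltW. Qed.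

Let dx t x v : t \in `[0, T] -> is_derive x 1 (f t ^~ v) (partial_x (f t) x v).
Proof.
move=> tT; have [[H _ _ _ _] _ _ _ _] := hf; have [_ d _] := H t x v tT.
exact: derivable_is_derive1.
Qed.

Let dv t x v : t \in `[0, T] -> is_derive v 1 (f t x) (partial_v (f t) x v).
Proof.
move=> tT; have [[H _ _ _ _] _ _ _ _] := hf; have [_ _ d] := H t x v tT.
exact: derivable_is_derive1.
Qed.

(** The density is dominated by an integrable weight, uniformly on [0, T]. *)
Lemma electric_field_bounded : exists2 K : R, 0 <= K &
  forall t x, t \in `[0, T] -> `|electric_field F f t x| <= K.
Proof.
exists (`|C0| * \int[mu]_z decay p z).
  by rewrite mulr_ge0// Rintegral_ge0// => z _; rewrite ltW// decay_gt0.
move=> t x tT; have [_ _ irho _ _] := hf.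
apply: (@field_of_bound_integrable _ p `|C0| (charge_density F f t)) => //.
  exact: irho.
move=> y; have [_ _ _ H] := triple_norm_le (hC0 tT).
apply: le_trans (H y) _; rewrite ler_wpM2r ?ler_norm//.
by rewrite ltW// decay_gt0.
Qed.

Lemma solution_support : exists2 M : R, 0 <= M &
  forall x v, M < `|v| -> f T x v = 0.
Proof.
have [K K0 HK] := electric_field_bounded.
have [_ _ [M HM] _] := hA1.
have [C1f _ _ pde ini] := hf.
exists (`|M| + K * T); first by rewrite addr_ge0// mulr_ge0// ltW.
move=> x v Mv.
apply: (@support_propagates _ T K `|M| (electric_field F f)) => //.
  by move=> y w Mw; rewrite ini HM//; apply: le_lt_trans Mw; exact: ler_norm.
Qed.

Lemma restart_datum : exists M A : R, [/\ 0 <= M,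
  datum p M A (f T) (partial_x (f T)) (partial_v (f T)), continuous F,
  forall v, M < `|v| -> F v = 0 &
  forall x, `|\int[mu]_v bg_diff F (f T) x v| <= A * decay p x].
Proof.
have [M M0 HM] := solution_support.
have [W [CF [W0 CF0 FW dF HF]]] := background_bounded hA2.
have [b1 b2 b3 b4] := triple_norm_le (hC0 TT).
have C00 : 0 <= C0 by apply: le_trans (b1 0 0).
have bp x v := bg_diff_partials (dF v) (dx x v TT) (dv x v TT).
have [[_ _ _ cx cv] _ _ _ _] := hf.
exists (M + W), (C0 + CF).
have MW v : M + W < `|v| -> M < `|v| /\ W < `|v|.
  by move=> H; split; apply: le_lt_trans H; rewrite ?lerDl ?lerDr.
split.
- exact: addr_ge0.
- split.
  + by move=> x v; exact: dx.
  + by move=> x v; exact: dv.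
  + exact: (slab_section TT cx).
  + exact: (slab_section TT cv).
  + move=> x v; have := b1 x v; have [H _] := HF v.
    by rewrite /bg_diff; have := lerB_dist (f T x v) (F v); rewrite distrC; lra.
  + move=> x v; have := b3 x v; have [-> _] := bp x v; rewrite normrN => H.
    apply: le_trans H _; rewrite ler_wpM2r ?lerDl//.
    by rewrite ltW// decay_gt0.
  + move=> x v; have := b2 x v; have [_ ->] := bp x v; have [_ H] := HF v.
    have := lerB_dist (partial_v (f T) x v) (derive1 F v); rewrite distrC; lra.
  + by move=> x v /MW[H _]; exact: HM.
- by move=> v; exact: (is_derive_continuous (dF v)).
- by move=> v /MW[_ H]; exact: FW.
- move=> x; apply: le_trans (b4 x) _; rewrite ler_wpM2r ?lerDl//.
  by rewrite ltW// decay_gt0.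
Qed.

End Restart.

(** At time T each of the two pieces controls its own side. *)
Lemma glue_within T d (G1 G2 G : R * R * R -> R) : 0 < T ->
  {within slab T, continuous G1} ->
  (forall t x v, t \in `[0, d] -> {for (t, x, v), continuous G2}) ->
  (forall t x v, t \in `[0, T] -> G (t, x, v) = G1 (t, x, v)) ->
  (forall t x v, t \in `[T, T + d] -> G (t, x, v) = G2 (t - T, x, v)) ->
  {within slab (T + d), continuous G}.
Proof.
move=> T0 /within_slabP H1 H2 E1 E2; apply/within_slabP => t x v tI e e0.
have tI' := tI; move: tI'; rewrite in_itv/= => /andP[t0 tTd].
have d1 t' : t' \in `[0, T + d] -> t' <= T -> t' \in `[0, T].
  by rewrite !in_itv/= => /andP[-> _] ->.
have d2 t' : t' \in `[0, T + d] -> T <= t' -> t' \in `[T, T + d].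
  by rewrite !in_itv/= => /andP[_ ->] ->.
have d3 t' : t' \in `[T, T + d] -> t' - T \in `[0, d].
  by rewrite !in_itv/= => /andP[? ?]; apply/andP; split; lra.
have [tT|Tt|tE] := ltgtP t T.
- have tI1 := d1 _ tI (ltW tT).
  have [r r0 Hr] := H1 t x v tI1 e e0.
  exists (Num.min r (T - t)); first by rewrite lt_min r0 subr_gt0.
  move=> t' x' v' t'I; rewrite !lt_min => /andP[tr tt] /andP[xr _] /andP[vr _].
  have t'T : t' <= T by have := ler_norm (t' - t); lra.
  by rewrite (E1 _ _ _ tI1) (E1 _ _ _ (d1 _ t'I t'T)); apply: Hr => //; exact: d1.
- have tI2 := d2 _ tI (ltW Tt).
  have [r r0 Hr] := continuous_pointP (H2 _ x v (d3 _ tI2)) e0.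
  exists (Num.min r (t - T)); first by rewrite lt_min r0 subr_gt0.
  move=> t' x' v' t'I; rewrite !lt_min => /andP[tr tt] /andP[xr _] /andP[vr _].
  have t'T : T <= t' by have := ler_norm (t - t'); rewrite distrC; lra.
  rewrite (E2 _ _ _ tI2) (E2 _ _ _ (d2 _ t'I t'T)); apply: Hr => //.
  by rewrite opprB addrA subrK.
- have tI1 := d1 t tI ltac:(by rewrite tE).
  have tI2 := d2 t tI ltac:(by rewrite tE).
  have [r r0 Hr] := H1 t x v tI1 e e0.
  have [q q0 Hq] := continuous_pointP (H2 _ x v (d3 _ tI2)) e0.
  exists (Num.min r q); first by rewrite lt_min r0 q0.
  move=> t' x' v' t'I; rewrite !lt_min => /andP[tr tq] /andP[xr xq] /andP[vr vq].
  have [t'T|Tt'] := leP t' T.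
    by rewrite (E1 _ _ _ tI1) (E1 _ _ _ (d1 _ t'I t'T)); apply: Hr => //; exact: d1.
  rewrite (E2 _ _ _ tI2) (E2 _ _ _ (d2 _ t'I (ltW Tt'))); apply: Hq => //.
  by rewrite opprB addrA subrK.
Qed.

End DataAtT.

(** * Gluing the two solutions *)

Section Glue.
Context {R : realType}.
Local Notation mu := (@lebesgue_measure R).
Implicit Types (t x v : R).
Variables (p : R) (F : R -> R) (f0 : R -> R -> R).
Variables (T r N D B C : R) (f : R -> R -> R -> R).
Variables (E : R -> R -> R) (fl flx flv : R -> R -> R -> R).
Hypotheses (p1 : 1 < p) (T0 : 0 < T) (r0 : 0 < r) (N0 : 0 <= N).
Hypothesis hf : VP_solution F f0 T f.
Hypothesis EC : forall t t' x x', `|E t x - E t' x'| <= C * (`|t - t'| + `|x - x'|).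
Hypothesis tr : transported r p N D E fl flx flv.
Hypothesis ini : forall x v, fl 0 x v = f T x v.
Hypothesis cF : continuous F.
Hypothesis FN : forall v, N < `|v| -> F v = 0.
Hypothesis rhoB : forall t x, t \in `]-r, r[ -> `|charge_density F fl t x| <= B * decay p x.
Hypothesis fieldE : forall t x, t \in `[0, r / 2] -> electric_field F fl t x = E t x.
Hypothesis crho : forall t, t \in `]-r, r[ -> continuous (charge_density F fl t).

Let d := r / 2.
Definition glue t : R -> R -> R := if t <= T then f t else fl (t - T).
Local Notation g := glue.
Let T' := T + d.

Let d0 : 0 < d. Proof. by rewrite divr_gt0. Qed.
Let T'0 : 0 < T'. Proof. exact: addr_gt0. Qed.
Let TT : T \in `[0, T]. Proof. by rewrite in_itv/= lexx ltW. Qed.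

Lemma glue_before t : t \in `[0, T] -> g t = f t.
Proof. by rewrite in_itv/= /g => /andP[_ ->]. Qed.

Lemma glue_after t : t \in `[T, T'] -> g t = fl (t - T).
Proof.
rewrite in_itv/= => /andP[Tt _]; rewrite /g; case: ifP => // tT.
have -> : t = T by apply/eqP; rewrite eq_le tT.
by rewrite subrr; apply/funext => x; apply/funext => v; rewrite ini.
Qed.

Let after_I t : t \in `[T, T'] -> t - T \in `[0, d] /\ t - T \in `]-r, r[.
Proof.
have := r0; rewrite !in_itv/= /T' /d => ? /andP[? ?].
by split; apply/andP; split; lra.
Qed.

Let time_split t : t \in `[0, T'] -> t \in `[0, T] \/ t \in `[T, T'].
Proof.
rewrite !in_itv/= => /andP[t0 tT']; have [tT|Tt] := leP t T; [left|right].
  by rewrite t0.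
by rewrite (ltW Tt).
Qed.

Let d_I t : t \in `[0, d] -> t \in `]-r, r[.
Proof. by have := r0; rewrite !in_itv/= /d => ? /andP[? ?]; apply/andP; split; lra. Qed.

Lemma partial_x_after t x v : t \in `[T, T'] -> partial_x (g t) x v = flx (t - T) x v.
Proof.
move=> tI; rewrite glue_after//; have [_ I] := after_I tI.
by rewrite /partial_x derive1E; have [_ ->] := tr_x tr x v I.
Qed.

Lemma partial_v_after t x v : t \in `[T, T'] -> partial_v (g t) x v = flv (t - T) x v.
Proof.
move=> tI; rewrite glue_after//; have [_ I] := after_I tI.
by rewrite /partial_v derive1E; have [_ ->] := tr_v tr x v I.
Qed.

Lemma glue_density_before t : t \in `[0, T] -> charge_density F g t = charge_density F f t.
Proof. by move=> tI; apply/funext => x; rewrite /charge_density glue_before. Qed.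

Lemma glue_density_after t : t \in `[T, T'] ->
  charge_density F g t = charge_density F fl (t - T).
Proof. by move=> tI; apply/funext => x; rewrite /charge_density glue_after. Qed.

Lemma glue_field_before t x : t \in `[0, T] -> electric_field F g t x = electric_field F f t x.
Proof. by move=> tI; rewrite /electric_field glue_density_before. Qed.

Lemma glue_field_after t x : t \in `[T, T'] -> electric_field F g t x = E (t - T) x.
Proof.
move=> tI; have [I _] := after_I tI; have <- := fieldE x I.
by rewrite /electric_field glue_density_after.
Qed.

(** The value of the time derivative of the glued function prescribed by the
equation. Expressed through the field it is the same for both pieces at T. *)
Definition glue_dt t x v := electric_field F g t x * partial_v (g t) x v - v * partial_x (g t) x v.

Let pt_before t x v : t \in `[0, T] -> glue_dt t x v = partial_t T f t x v.
Proof.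
move=> tI; have [_ _ _ pde _] := hf; have P := pde t x v tI.
by rewrite /glue_dt glue_field_before// glue_before// -[RHS]subr0 -P; ring.
Qed.

Let pt_after t x v : t \in `[T, T'] ->
  glue_dt t x v = - v * flx (t - T) x v + E (t - T) x * flv (t - T) x v.
Proof.
by move=> tI; rewrite /glue_dt glue_field_after// partial_x_after// partial_v_after//; ring.
Qed.

Let quotient_after t x v e : t \in `[T, T'] -> 0 < e -> exists2 c, 0 < c &
  forall s, s \in `[T, T'] -> s != t -> `|s - t| < c ->
    `|time_quotient g t x v s - glue_dt t x v| < e.
Proof.
move=> tI e0; have [_ I] := after_I tI.
have /cvg_of_is_derive/cvgrPdist_lt/(_ e e0) := tr_t tr x v I.
rewrite !near_withinE => -[c c0 Hc]; exists c => // s sI st stc.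
have E1 : t - T - (s - T) = t - s by ring.
have E2 : s - T - (t - T) = s - t by ring.
have neq : s - T != t - T by rewrite (inj_eq (addIr _)).
have := Hc (s - T); rewrite /= E1 E2 (distrC t s) => /(_ stc neq).
by rewrite distrC pt_after// /time_quotient !glue_after.
Qed.

Let quotient_before t x v e : t \in `[0, T] -> 0 < e -> exists2 c, 0 < c &
  forall s, s \in `[0, T] -> s != t -> `|s - t| < c ->
    `|time_quotient g t x v s - glue_dt t x v| < e.
Proof.
move=> tI e0; have [[H _ _ _ _] _ _ _ _] := hf; have [ct _ _] := H t x v tI.
have [c c0 Hc] := partial_t_quotient T0 tI ct e0.
exists c => // s sI st sc; rewrite pt_before// /time_quotient !glue_before//.
exact: Hc.
Qed.

Let quotient_glue t x v e : t \in `[0, T'] -> 0 < e -> exists2 c, 0 < c &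
  forall s, s \in `[0, T'] -> s != t -> `|s - t| < c ->
    `|time_quotient g t x v s - glue_dt t x v| < e.
Proof.
move=> tI e0.
have tI' := tI; move: tI'; rewrite in_itv/= => /andP[t0 tT'].
have before s : s \in `[0, T'] -> s <= T -> s \in `[0, T].
  by rewrite !in_itv/= => /andP[-> _] ->.
have after s : s \in `[0, T'] -> T <= s -> s \in `[T, T'].
  by rewrite !in_itv/= => /andP[_ ->] ->.
have [tT|Tt|tE] := ltgtP t T.
- have [c c0 Hc] := quotient_before x v (before t tI (ltW tT)) e0.
  exists (Num.min c (T - t)); first by rewrite lt_min c0 subr_gt0.
  move=> s sI st; rewrite lt_min => /andP[sc sT]; apply: Hc => //; apply: before => //.
  by have := ler_norm (s - t); lra.
- have [c c0 Hc] := quotient_after x v (after t tI (ltW Tt)) e0.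
  exists (Num.min c (t - T)); first by rewrite lt_min c0 subr_gt0.
  move=> s sI st; rewrite lt_min => /andP[sc sT]; apply: Hc => //; apply: after => //.
  by have := ler_norm (t - s); rewrite distrC; lra.
- have [c c0 Hc] := quotient_before x v (before t tI ltac:(by rewrite tE)) e0.
  have [b b0 Hb] := quotient_after x v (after t tI ltac:(by rewrite tE)) e0.
  exists (Num.min c b); first by rewrite lt_min c0 b0.
  move=> s sI st; rewrite lt_min => /andP[sc sb].
  have [sT|Ts] := leP s T; first by apply: Hc => //; exact: before.
  by apply: Hb => //; apply: after => //; exact: ltW.
Qed.

Lemma glue_partial_t t x v : t \in `[0, T'] ->
  cvg (time_quotient g t x v s @[s --> within `[0, T'] t^']) /\
  partial_t T' g t x v = glue_dt t x v.
Proof. by move=> tI; apply: partial_tP => // e e0; exact: quotient_glue. Qed.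

Let before_T' t : t \in `[0, T] -> t \in `[0, T'].
Proof.
by have := d0; rewrite !in_itv/= /T' => ? /andP[-> ?]; lra.
Qed.

Let after_T' t : t \in `[T, T'] -> t \in `[0, T'].
Proof. by have := T0; rewrite !in_itv/= => ? /andP[? ->]; rewrite andbT; lra. Qed.

Lemma glue_C1 : is_C1_slab T' g.
Proof.
have [[H c ct cx cv] _ _ _ _] := hf.
have cE t x v : t \in `]-r, r[ ->
    {for (t, x, v), continuous (fun z : R * R * R => E z.1.1 z.1.2)}.
  move=> tI; apply: (@gap_continuous _ r _ `|C|) => // t' x' v' _ _ /=.
  apply: le_trans (EC _ _ _ _) _.
  have [_ _ _ gv] := gap_ge t x v t' x' v'.
  apply: (@le_trans _ _ (`|C| * (`|t' - t| + `|x' - x|))).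
    by rewrite ler_wpM2r ?addr_ge0// ler_norm.
  by rewrite ler_wpM2l// /gap lerDl.
have c3 : continuous (fun z : R * R * R => z.2) by move=> z; exact: cvg_snd.
split.
- move=> t x v tI; have [Ht _] := glue_partial_t x v tI; split; first exact: Ht.
    have [tI1|tI2] := time_split tI.
      by rewrite (glue_before tI1); have [_ dx _] := H t x v tI1; exact: dx.
    have [_ I] := after_I tI2; rewrite (glue_after tI2).
    by have [dx _] := tr_x tr x v I; exact: dx.
  have [tI1|tI2] := time_split tI.
    by rewrite (glue_before tI1); have [_ _ dv] := H t x v tI1; exact: dv.
  have [_ I] := after_I tI2; rewrite (glue_after tI2).
  by have [dv _] := tr_v tr x v I; exact: dv.
- apply: (glue_within T0 c (G2 := fun z => fl z.1.1 z.1.2 z.2)).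
  + by move=> t x v tI; exact: (tr_c tr (d_I tI)).
  + by move=> t x v tI /=; rewrite glue_before.
  + by move=> t x v tI /=; rewrite glue_after.
- apply: (glue_within T0 ct
    (G2 := fun z => - z.2 * flx z.1.1 z.1.2 z.2 + E z.1.1 z.1.2 * flv z.1.1 z.1.2 z.2)).
  + move=> t x v /d_I tI; apply: cvgD; apply: cvgM.
    * by apply: cvgN; exact: c3.
    * exact: (tr_cx tr tI).
    * exact: (cE t x v tI).
    * exact: (tr_cv tr tI).
  + move=> t x v tI /=.
    by have [_ ->] := glue_partial_t x v (before_T' tI); rewrite pt_before.
  + move=> t x v tI /=.
    by have [_ ->] := glue_partial_t x v (after_T' tI); rewrite pt_after.
- apply: (glue_within T0 cx (G2 := fun z => flx z.1.1 z.1.2 z.2)).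
  + by move=> t x v tI; exact: (tr_cx tr (d_I tI)).
  + by move=> t x v tI /=; rewrite glue_before.
  + by move=> t x v tI /=; rewrite partial_x_after.
- apply: (glue_within T0 cv (G2 := fun z => flv z.1.1 z.1.2 z.2)).
  + by move=> t x v tI; exact: (tr_cv tr (d_I tI)).
  + by move=> t x v tI /=; rewrite glue_before.
  + by move=> t x v tI /=; rewrite partial_v_after.
Qed.

Lemma glue_solution : VP_solution F f0 T' g.
Proof.
have [_ ibg irho _ ini0] := hf.
split; first exact: glue_C1.
- move=> t x tI; have [tI1|tI2] := time_split tI.
    by rewrite glue_before//; exact: ibg.
  rewrite glue_after//; have [_ I] := after_I tI2.
  by have [] := density_supported tr cF FN x I.
- move=> t tI; have [tI1|tI2] := time_split tI.
    by rewrite glue_density_before//; exact: irho.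
  have [_ I] := after_I tI2; rewrite glue_density_after//.
  exact: (density_integrable p1 (crho I) (fun x => rhoB x I) measurableT).
- move=> t x v tI; have [_ ->] := glue_partial_t x v tI; rewrite /glue_dt.
  by ring.
- by move=> x v; rewrite glue_before ?ini0// in_itv/= lexx ltW.
Qed.

Lemma glue_norm (C0 CF : R) : 
  (forall t, t \in `[0, T] -> (triple_norm p (bg_diff F (f t)) <= C0%:E)%E) ->
  (forall v, is_derive v 1 F (derive1 F v)) ->
  (forall v, `|F v| <= CF /\ `|derive1 F v| <= CF) ->
  exists C' : R, forall t, t \in `[0, T'] -> (triple_norm p (bg_diff F (g t)) <= C'%:E)%E.
Proof.
move=> HC dF HF.
exists (`|C0| + `|(CF + D) + (CF + D) + D + B|) => t tI.
have [tI1|tI2] := time_split tI.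
  rewrite glue_before//; apply: le_trans (HC t tI1) _; rewrite lee_fin.
  by have := ler_norm C0; have := normr_ge0 (CF + D + (CF + D) + D + B); lra.
rewrite glue_after//; have [_ I] := after_I tI2.
have bp x v := bg_diff_partials (dF v) (tr_x tr x v I) (tr_v tr x v I).
apply: le_trans (_ : _ <= ((CF + D) + (CF + D) + D + B)%:E)%E _; last first.
  by rewrite lee_fin; have := ler_norm (CF + D + (CF + D) + D + B); have := normr_ge0 C0; lra.
apply: triple_norm_bound.
- move=> x v; apply: le_trans (ler_normB _ _) _; have [H _] := HF v.
  by rewrite lerD// (tr_bound tr).
- move=> x v; have [_ ->] := bp x v; apply: le_trans (ler_normB _ _) _; have [_ H] := HF v.
  by rewrite lerD// (tr_bv tr).
- by move=> x v; have [-> _] := bp x v; rewrite normrN; exact: (tr_bx tr).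
- by move=> x; exact: rhoB.
Qed.

End Glue.

Theorem theorem2 (R : realType) (p : R) (F : R -> R) (f0 : R -> R -> R)
    (hp : 1 < p)
    (hA1 : assumption_A1 p F f0) (hA2 : assumption_A2 F)
    (hA3 : assumption_A3 p F f0)
    (T : R) (hT : 0 < T) (f : R -> R -> R -> R)
    (hf : VP_solution F f0 T f)
    (hbound : exists C : R, forall t : R, t \in `[0, T] ->
       (triple_norm p (bg_diff F (f t)) <= C%:E)%E) :
  exists2 delta : R, 0 < delta &
  exists g : R -> R -> R -> R,
    [/\ forall t x v : R, t \in `[0, T] -> g t x v = f t x v,
        VP_solution F f0 (T + delta) g &
        exists C' : R, forall t : R, t \in `[0, T + delta] ->
          (triple_norm p (bg_diff F (g t)) <= C'%:E)%E].
Proof.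
have [C0 hC0] := hbound.
have [M [A [M0 dat cF FM rho0]]] := restart_datum hp hT hA1 hA2 hf hC0.
have [r [N [D [B [C [E [fl [flx [flv [[r0 N0 EC] tr ini FN [rhoB fieldE crho]]]]]]]]]]] :=
  local_existence hp M0 dat cF FM rho0.
have [W [CF [_ _ _ dF HF]]] := background_bounded hA2.
exists (r / 2); first by rewrite divr_gt0.
exists (glue T f fl); split.
- by move=> t x v tI; rewrite glue_before.
- exact: (glue_solution hp hT r0 hf EC tr ini cF FN rhoB fieldE crho).
- exact: (glue_norm r0 tr ini rhoB hC0 dF HF).
Qed.
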